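(* In the polarized setting described in the context, let $k=\mathbb C((\tau))$ and suppose $\sigma|_k=\mathrm{id}$. Let $\xi\in F^\sigma$ be such that $\nu:=\mathrm{Nm}_{F/k}(\xi)\in\mu_{m/n}(\mathbb C)$ is a primitive $(m/n)$-th root of unity, and put $\gamma=\mathrm{Nm}_{F/k}(c)\in k^\times$, so that $\gamma^{m/n}=\beta^2$. Then $D_i=L_i$ for all $i\in I$, and the following hold. (In every place where ''orthogonal or symplectic'' occurs: when $\sigma=\mathrm{id}_F$ it is orthogonal if $\epsilon=1$ and symplectic if $\epsilon=-1$. In every place where ''$\wedge^2$ or $\mathrm{Sym}^2$'' occurs: when $\sigma=\mathrm{id}_F$ it is $\wedge^2$ if $\epsilon=1$ and $\mathrm{Sym}^2$ if $\epsilon=-1$.) (A) Suppose $m/n$ is odd. Then $L_i=k$ for all $i$, and $Q_\xi$ is a single cycle of length $m/n$ of type (VE). The unique vertex $i=i^\diamondsuit$ corresponds to the unique $b_i\in k$ with $b_i^2=\gamma$ and $b_i^{m/n}=\beta$; the corresponding factor $\mathbf{Aut}_{k}(M_i,\{\cdot,\cdot\}_i)$ of $H$ is an orthogonal or symplectic group over $k$. The unique arrow $e:j\to j^\diamondsuit$ fixed by $(-)^\diamondsuit$ corresponds to the unique $b_j\in k$ with $b_j^2=\gamma\nu^{-1}$ and $b_j^{m/n}=\beta$; the corresponding factor $\mathfrak h^{-\epsilon\epsilon_e}(M_j,M_{j^\diamondsuit})$ of $\mathfrak g(\xi)$ is isomorphic to $\wedge^2(M_{j^\diamondsuit})$ or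 $\mathrm{Sym}^2(M_{j^\diamondsuit})$. (B) Suppose $m/n$ is even (so $\beta=\pm\gamma^{m/2n}$) and $\mathrm{val}_\tau(\gamma)$ is even. Then $L_i=k$ for all $i$ and $Q_\xi$ is a single cycle of length $m/n$. (B1) If $\beta=\gamma^{m/2n}$, then $Q_\xi$ is of type (VV), and the factor of $H$ at each of the two fixed vertices is an orthogonal or symplectic group. (B2) If $\beta=-\gamma^{m/2n}$, then $Q_\xi$ is of type (EE), and the factor of $\mathfrak g(\xi)$ at each fixed arrow $e:i\to i^\diamondsuit$ is isomorphic to $\wedge^2(M_{i^\diamondsuit})$ or $\mathrm{Sym}^2(M_{i^\diamondsuit})$. (C) Suppose $m/n$ is even and $\mathrm{val}_\tau(\gamma)$ is odd. Then each $L_i$ is isomorphic to the unique quadratic extension of $k$, and $Q_\xi$ is a single cycle of length $m/2n$. (C1) If $m/2n$ is odd and $\beta=\gamma^{m/2n}$, then $Q_\xi$ is of type (VE). The vertex $i=i^\diamondsuit$ corresponds to $b_i^2=\gamma$, $\sigma_c|_{L_i}=\mathrm{id}$, and $\mathbf{Aut}_{L_i/k}(M_i,\{\cdot,\cdot\}_i)$ is the Weil restriction of an orthogonal or symplectic group over $L_i$. The fixed arrow $e:j\to j^\diamondsuit$ corresponds to $b_j^2=-\gamma\nu^{-1}$, $\sigma_{c\xi^{-1}}|_{L_j}\ne\mathrm{id}$, and $\mathfrak h^{-\epsilon\epsilon_e}(M_j,M_{j^\diamondsuit})$ is isomorphic to the space of $L_j/k$-Hermitian forms on $M_j$. (C2)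 If $m/2n$ is odd and $\beta=-\gamma^{m/2n}$, then $Q_\xi$ is of type (VE). The vertex $i=i^\diamondsuit$ corresponds to $b_i^2=-\gamma$, $\sigma_c|_{L_i}\neq\mathrm{id}$, and $\mathbf{Aut}_{L_i/k}(M_i,\{\cdot,\cdot\}_i)$ is a unitary group over $k$. The fixed arrow $e:j\to j^\diamondsuit$ corresponds to $b_j^2=\gamma\nu^{-1}$, $\sigma_{c\xi^{-1}}|_{L_j}=\mathrm{id}$, and $\mathfrak h^{-\epsilon\epsilon_e}(M_j,M_{j^\diamondsuit})$ is isomorphic to $\wedge^2_{L_{j^\diamondsuit}}(M_{j^\diamondsuit})$ or $\mathrm{Sym}^2_{L_{j^\diamondsuit}}(M_{j^\diamondsuit})$. (C3) If $m/2n$ is even and $\beta=\gamma^{m/2n}$, then $Q_\xi$ is of type (VV). One fixed vertex $i$ corresponds to $b_i^2=\gamma$, $\sigma_c|_{L_i}=\mathrm{id}$, and $\mathbf{Aut}_{L_i/k}(M_i,\{\cdot,\cdot\}_i)$ is the Weil restriction of an orthogonal or symplectic group over $L_i$. The other fixed vertex $i'$ corresponds to $b_{i'}^2=-\gamma$, $\sigma_c|_{L_{i'}}\ne\mathrm{id}$, and $\mathbf{Aut}_{L_{i'}/k}(M_{i'},\{\cdot,\cdot\}_{i'})$ is a unitary group over $k$. (C4) If $m/2n$ is even and $\beta=-\gamma^{m/2n}$, then $Q_\xi$ is of type (EE). One fixed arrow $e:i\to i^\diamondsuit$ corresponds to $b_i^2=\gamma\nu^{-1}$, $\sigma_{c\xi^{-1}}|_{L_i}=\mathrm{id}$,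 and $\mathfrak h^{-\epsilon\epsilon_e}(M_i,M_{i^\diamondsuit})$ is isomorphic to $\wedge^2_{L_{i^\diamondsuit}}(M_{i^\diamondsuit})$ or $\mathrm{Sym}^2_{L_{i^\diamondsuit}}(M_{i^\diamondsuit})$. The other fixed arrow $e':i'\to i'^\diamondsuit$ corresponds to $b_{i'}^2=-\gamma\nu^{-1}$, $\sigma_{c\xi^{-1}}|_{L_{i'}}\ne\mathrm{id}$, and $\mathfrak h^{-\epsilon\epsilon_{e'}}(M_{i'},M_{i'^\diamondsuit})$ is isomorphic to the space of $L_{i'}/k$-Hermitian forms on $M_{i'}$.
   Context: **Setup.** $k$ is a field with $\mathrm{char}(k)\neq2$ (here $k=\mathbb C((\tau))$, with valuation $\mathrm{val}_\tau$, $\mathrm{val}_\tau(\tau)=1$); $F$ is a finite separable commutative $k$-algebra (possibly a product of fields) with a ring automorphism $\zeta$ of order $n$ such that $F^\zeta=k$; $\mathrm{Nm}_{F/k}(a)=\prod_{j=0}^{n-1}\zeta^j(a)$. $V$ is a finitely generated $F$-module, $\theta:V\to V$ an additive bijection with $\theta(av)=\zeta(a)\theta(v)$ for $a\in F$; $m$ is a multiple of $n$ with $m/n$ invertible in $k$, and $\theta^m=\beta\cdot\mathrm{id}_V$ with $\beta\in k^\times$. $\sigma:F\to F$ is a ring automorphism with $\sigma^2=\mathrm{id}$ (possibly trivial) commuting with $\zeta$. $\epsilon\in\{\pm1\}$, and $\langle\cdot,\cdot\rangle:V\times V\to F$ is a non-degenerate pairing, $F$-linear in the first variable, with $\langle x,y\rangle=\epsilon\sigma(\langle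 y,x\rangle)$ and $\langle\theta x,\theta y\rangle=c\,\zeta(\langle x,y\rangle)$ for some $c\in(F^\times)^\sigma$ with $\mathrm{Nm}_{F/k}(c)^{m/n}=\beta\sigma(\beta)$. **Groups.** For a $k_0$-algebra $A$ and an $A$-module $M$ of finite dimension over the field $k_0$, $\mathbf{Aut}_{A/k_0}(M,\{\cdot,\cdot\})$ is the algebraic group over $k_0$ whose $R$-points are the $R\otimes_{k_0}A$-linear automorphisms of $R\otimes_{k_0}M$ preserving the pairing ($\mathbf{Aut}_{k}$ means $\mathbf{Aut}_{k/k}$). $H$ is the algebraic group over $k^\sigma$ of $F$-linear automorphisms of $V$ commuting with $\theta$ and preserving $\langle\cdot,\cdot\rangle$, and $\mathfrak g(\xi)=\{\varphi\in\mathrm{End}_F(V):\theta\varphi\theta^{-1}=\xi\varphi,\ \langle\varphi x,y\rangle+\langle x,\varphi y\rangle=0\ \forall x,y\}$, with $H$ acting by conjugation. **Algebra.** $A_\beta$ is the quotient of the twisted polynomial ring $F\langle\boldsymbol\theta\rangle$ ($\boldsymbol\theta a=\zeta(a)\boldsymbol\theta$) by the central element $\boldsymbol\theta^m-\beta$. $V$ is an $A_\beta$-module with $\boldsymbol\theta$ acting as $\theta$. The center of $A_\beta$ is $L_\beta=k[b]\cong k[\mathbf b]/(\mathbf b^{m/n}-\beta)$, $b=\boldsymbol\theta^n$. Write $L_\beta=\prod_{i\in I}L_i$ with $L_i$ fields, $b_i\in L_i$ the image of $b$; $A_\beta=\prod_{i\in I}A_i$ with $A_i$ central simple over $L_i$.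 Fix a simple $A_i$-module $S_i$; $D_i=\mathrm{End}_{A_\beta}(S_i)^{\mathrm{opp}}$ is a central division algebra over $L_i$ acting on $S_i$ from the right. $M_i=\mathrm{Hom}_{A_\beta}(S_i,V)$ is a left $D_i$-module, $(dx)(u)=x(ud)$, and $V=\bigoplus_iS_i\otimes_{D_i}M_i$ via $u\otimes x\mapsto x(u)$. **Quiver.** For an $A_\beta$-module $U$, $U^\xi$ is the $F$-module $U$ with $\boldsymbol\theta$ acting as $\xi\boldsymbol\theta$. $\overline\xi:I\to I$ is the permutation with $S_i^\xi\cong S_{\overline\xi(i)}$; equivalently, the permutation of $I=\mathrm{Spec}\,L_\beta$ induced by the $k$-automorphism $b\mapsto\mathrm{Nm}_{F/k}(\xi)b$ of $L_\beta$. $Q_\xi$ is the directed graph with vertex set $I$ and one arrow $i\to\overline\xi(i)$ for each $i$. For $a\in\{c,c\xi^{-1}\}$, $\sigma_a:L_\beta\to L_\beta$ is the ring automorphism that is $\sigma$ on $k$ and sends $b\mapsto\mathrm{Nm}_{F/k}(a)b^{-1}$. The involution $i\mapsto i^\diamondsuit$ on $I$ is defined by $\sigma_c(L_i)=L_{i^\diamondsuit}$; it reverses arrows of $Q_\xi$, sending $e:i\to\overline\xi(i)$ to $e^\diamondsuit:\overline\xi(i)^\diamondsuit\to i^\diamondsuit$. A directed cycle with arrow-reversing involution $(-)^\diamondsuit$ is of type (VV) if exactly two vertices and no arrow are fixed, of type (VE) if exactly one vertex and one arrow are fixed, and of type (EE) if no vertex and exactly two arrows are fixed. **Pairings.** A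 pairing $\langle\cdot,\cdot\rangle_i:S_i\times S_{i^\diamondsuit}\to F$ is admissible if it is $F$-linear in the first variable, $(F,\sigma)$-semilinear in the second, and $\langle\boldsymbol\theta u,\boldsymbol\theta v\rangle_i=c\,\zeta(\langle u,v\rangle_i)$. Fix perfect admissible pairings and signs $\epsilon_i$ with $\langle v,u\rangle_{i^\diamondsuit}=\epsilon_i\sigma(\langle u,v\rangle_i)$, where $\epsilon_i=1$ if $i\ne i^\diamondsuit$, and for $i=i^\diamondsuit$, $\epsilon_i=1$ whenever a perfect admissible pairing with $\langle v,u\rangle_i=\sigma\langle u,v\rangle_i$ exists, and $\epsilon_i=-1$ otherwise. $\{\cdot,\cdot\}'_i:M_i\times M_{i^\diamondsuit}\to D_i$ is the unique pairing with $\langle u\otimes x,v\otimes y\rangle=\langle u\{x,y\}'_i,v\rangle_i$, and $\{x,y\}_i=\mathrm{Trd}_{D_i/L_i}\{x,y\}'_i$. For each arrow $e:i\to\overline\xi(i)$ fix an $A_\beta$-isomorphism $\eta_e:S_i^\xi\to S_{\overline\xi(i)}$ and a sign $\epsilon_e$ with $\sigma\langle v,\eta_e(u)\rangle_{\overline\xi(i)^\diamondsuit}=\epsilon_e\langle u,\eta_{e^\diamondsuit}(v)\rangle_i$, where $\epsilon_e=1$ if $e\ne e^\diamondsuit$, and for $e=e^\diamondsuit$, $\epsilon_e=1$ whenever an $\eta_e$ with $\langle u,\eta_e(v)\rangle_i=\sigma\langle v,\eta_e(u)\rangle_i$ exists, and $\epsilon_e=-1$ otherwise. $\eta_e^\flat:D_i\to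 D_{\overline\xi(i)}$ is the isomorphism with $\eta_e(ud)=\eta_e(u)\eta_e^\flat(d)$. For an arrow $e:i\to i^\diamondsuit$ fixed by $(-)^\diamondsuit$ and $\epsilon'\in\{\pm1\}$, $\mathfrak h^{\epsilon'}(M_i,M_{i^\diamondsuit})$ is the set of additive maps $\varphi:M_i\to M_{i^\diamondsuit}$ with $\varphi(dx)=\eta_e^\flat(d)\varphi(x)$ and $\{y,\varphi(x)\}_i=\epsilon'\sigma_{c\xi^{-1}}(\{x,\varphi(y)\}_i)$ for all $d\in D_i$, $x,y\in M_i$. **Factors.** An element of $H$ is given by a family $g_i\in\mathrm{Aut}_{D_i}(M_i)$, $g(u\otimes x)=u\otimes g_i(x)$; for $i=i^\diamondsuit$ the component $g_i$ ranges over the factor $\mathbf{Aut}_{D_i/k^\sigma}(M_i,\{\cdot,\cdot\}_i)$ of $H$. An element of $\mathfrak g(\xi)$ is given by a family $\varphi_e\in\mathrm{Hom}_{D_i}(M_i,M_{\overline\xi(i)})$ (target a $D_i$-module via $\eta_e^\flat$), $\varphi(u\otimes x)=\eta_e(u)\otimes\varphi_e(x)$; for $e=e^\diamondsuit:i\to i^\diamondsuit$ the component $\varphi_e$ ranges over the factor $\mathfrak h^{-\epsilon\epsilon_e}(M_i,M_{i^\diamondsuit})$ of $\mathfrak g(\xi)$. *)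

(* Defs.v *)
From HB Require Import structures.
From mathcomp Require Import all_boot all_order all_algebra all_fingroup all_field.
From mathcomp Require Import boolp classical_sets functions reals complex.

Set Implicit Arguments.
Unset Strict Implicit.
Unset Printing Implicit Defensive.

Import GRing.Theory.
Local Open Scope ring_scope.

(* K[[tau]] *)
Record pseries (K : fieldType) := PSeries { pscoef : nat -> K }.

Section PowerSeries.
Variable K : fieldType.
Implicit Types x y z : pseries K.

HB.instance Definition _ := gen_eqMixin (pseries K).
HB.instance Definition _ := gen_choiceMixin (pseries K).

Lemma psP x y : (forall n, pscoef x n = pscoef y n) -> x = y.
Proof. by case: x y => [f] [g] /= fg; congr PSeries; apply/funext. Qed.

Definition ps_add x y := PSeries (fun n => pscoef x n + pscoef y n).
Definition ps_opp x := PSeries (fun n => - pscoef x n).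
Definition ps_const (a : K) := PSeries (fun n => if n == 0 then a else 0).
Definition ps_mul x y :=
  PSeries (fun n => \sum_(j < n.+1) pscoef x j * pscoef y (n - j)%N).

Fact ps_addA : associative ps_add.
Proof. by move=> x y z; apply: psP => n /=; rewrite addrA. Qed.
Fact ps_addC : commutative ps_add.
Proof. by move=> x y; apply: psP => n /=; rewrite addrC. Qed.
Fact ps_add0 : left_id (ps_const 0) ps_add.
Proof. by move=> x; apply: psP => n /=; rewrite if_same add0r. Qed.
Fact ps_addN : left_inverse (ps_const 0) ps_opp ps_add.
Proof. by move=> x; apply: psP => n /=; rewrite if_same addNr. Qed.

HB.instance Definition _ :=
  GRing.isZmodule.Build (pseries K) ps_addA ps_addC ps_add0 ps_addN.

Definition ps_trunc n x : {poly K} := \poly_(i < n) pscoef x i.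

Fact ps_mulE n N x y : (n < N)%N ->
  pscoef (ps_mul x y) n = (ps_trunc N x * ps_trunc N y)`_n.
Proof.
move=> ltnN; rewrite coefM /=; apply: eq_bigr => j _.
have leN i : (i <= n)%N -> (i < N)%N by move=> /leq_ltn_trans; apply.
by rewrite !coef_poly !leN ?leq_subr // -ltnS.
Qed.

Fact ps_mulC : commutative ps_mul.
Proof.
by move=> x y; apply: psP => n; rewrite !(@ps_mulE n n.+1) // mulrC.
Qed.

Fact ps_trunc_mul n N x y : (n < N)%N ->
  (ps_trunc N (ps_mul x y))`_n = (ps_trunc N x * ps_trunc N y)`_n.
Proof. by move=> ltnN; rewrite coef_poly ltnN (ps_mulE _ _ ltnN). Qed.

Fact ps_mulA : associative ps_mul.
Proof.
move=> x y z; apply: psP => n; rewrite !(@ps_mulE n n.+1) //.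
have cM (p q p' q' : {poly K}) :
    (forall i, (i <= n)%N -> p`_i = p'`_i) ->
    (forall i, (i <= n)%N -> q`_i = q'`_i) -> (p * q)`_n = (p' * q')`_n.
  move=> pp qq; rewrite !coefM; apply: eq_bigr => j _.
  by rewrite pp ?qq ?leq_subr // -ltnS.
transitivity ((ps_trunc n.+1 x * (ps_trunc n.+1 y * ps_trunc n.+1 z))`_n).
  by apply: cM => // i lein; rewrite ps_trunc_mul.
by rewrite mulrA; apply: cM => // i lein; rewrite ps_trunc_mul.
Qed.

Fact ps_mul1 : left_id (ps_const 1) ps_mul.
Proof.
move=> x; apply: psP => n /=; rewrite big_ord_recl /= mul1r subn0.
by rewrite big1 ?addr0 // => i _; rewrite mul0r.
Qed.

Fact ps_mulDl : left_distributive ps_mul ps_add.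
Proof.
move=> x y z; apply: psP => n /=; rewrite -big_split /=.
by apply: eq_bigr => j _; rewrite mulrDl.
Qed.

Fact ps_oner_neq0 : ps_const 1 != 0 :> pseries K.
Proof.
by apply/eqP => /(congr1 (fun x => pscoef x 0)) /= /eqP; rewrite oner_eq0.
Qed.

HB.instance Definition _ := GRing.Zmodule_isComNzRing.Build (pseries K)
  ps_mulA ps_mulC ps_mul1 ps_mulDl ps_oner_neq0.

Definition ps_unit : pred (pseries K) := fun x => `[< exists y, y * x = 1 >].
Definition ps_inv x : pseries K :=
  if pselect (exists y, y * x = 1) is left xV then sval (cid xV) else x.

Fact ps_mulV : {in ps_unit, left_inverse 1 ps_inv *%R}.
Proof.
move=> x /asboolP xV; rewrite /ps_inv; case: pselect => // {}xV.
exact: (svalP (cid xV)).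
Qed.
Fact ps_unitP x y : y * x = 1 -> ps_unit x.
Proof. by move=> yx1; apply/asboolP; exists y. Qed.
Fact ps_inv_out : {in [predC ps_unit], ps_inv =1 id}.
Proof.
move=> x; rewrite inE => /asboolPn xN; rewrite /ps_inv.
by case: pselect.
Qed.

HB.instance Definition _ := GRing.ComNzRing_hasMulInverse.Build (pseries K)
  ps_mulV ps_unitP ps_inv_out.

Fact ps_neq0 x : x != 0 -> exists n, pscoef x n != 0.
Proof.
move=> /eqP x0; apply: contrapT => xN; apply: x0; apply: psP => n /=.
rewrite if_same; apply/eqP/negP => /negP xn; apply: xN; by exists n.
Qed.

(* the tau-adic order; ord 0 = 0 by convention *)
Definition ps_ord x : nat :=
  if pselect (exists n, pscoef x n != 0) is left x0 then ex_minn x0 else 0.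

Fact ps_mulf_eq0 x y : x * y = 0 -> (x == 0) || (y == 0).
Proof.
move=> xy0; apply/norP => -[/ps_neq0 x0 /ps_neq0 y0].
case: (ex_minnP x0) => p xp pmin; case: (ex_minnP y0) => q yq qmin.
have /eqP := congr1 (fun z => pscoef z (p + q)%N) xy0.
have ltp : (p < (p + q).+1)%N by rewrite ltnS leq_addr.
rewrite /= if_same (bigD1 (Ordinal ltp)) //= addKn big1 ?addr0.
  by rewrite mulf_eq0 (negPf xp) (negPf yq).
move=> j; rewrite -val_eqE /= => jp.
case: (ltnP j p) => [ltjp|lepj].
  have -> : pscoef x j = 0; last by rewrite mul0r.
  by apply: contraTeq ltjp => /pmin; rewrite -leqNgt.
have ltpj : (p < j)%N by rewrite ltn_neqAle eq_sym jp.
have -> : pscoef y (p + q - j)%N = 0; last by rewrite mulr0.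
apply: contraTeq ltpj => /qmin; rewrite -leqNgt => le_q.
have lej : (j <= p + q)%N by rewrite -ltnS.
by rewrite leq_subRL // leq_add2r in le_q.
Qed.

HB.instance Definition _ :=
  GRing.ComUnitRing_isIntegral.Build (pseries K) ps_mulf_eq0.

End PowerSeries.

(* K((tau)) = Frac K[[tau]] *)
Notation laurent K := {fraction (pseries K)}.

Definition lconst (K : fieldType) (a : K) : laurent K := tofrac (ps_const a).

(* val_tau (f / g) = ord f - ord g; val_tau 0 = 0 by convention *)
Definition val_tau (K : fieldType) (x : laurent K) : int :=
  let r := generic_quotient.repr x in (ps_ord (\n_r))%:Z - (ps_ord (\d_r))%:Z.

(* R (x)_K L, in coordinates on the K-basis vbasis {:L} of L *)
Definition tens (K : fieldType) (R : comAlgType K) (L : fieldExtType K) :=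
  {ffun 'I_(\dim {:L}) -> R}.

Section Tensor.
Variables (K : fieldType) (R : comAlgType K) (L : fieldExtType K).
Local Notation d := (\dim {:L}).
Local Notation e := (vbasis {:L}).
Local Notation tens := (tens R L).

HB.instance Definition _ := GRing.Zmodule.on tens.

Definition tpure (r : R) (a : L) : tens := [ffun l => coord e l a *: r].
Definition tmul (x y : tens) : tens :=
  \sum_(i < d) \sum_(j < d) tpure (x i * y j) (e`_i * e`_j).
Definition tone : tens := tpure 1 1.

Fact vbasis_sum (a : L) : a = \sum_(i < d) coord e i a *: e`_i.
Proof. exact: (coord_vbasis (memvf a)). Qed.

Fact tpureDl r r' a : tpure (r + r') a = tpure r a + tpure r' a.
Proof. by apply/ffunP => l; rewrite !ffunE scalerDr. Qed.
Fact tpureDr r a a' : tpure r (a + a') = tpure r a + tpure r a'.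
Proof. by apply/ffunP => l; rewrite !ffunE linearD scalerDl. Qed.
Fact tpure0l a : tpure 0 a = 0.
Proof. by apply/ffunP => l; rewrite !ffunE scaler0. Qed.
Fact tpure0r r : tpure r 0 = 0.
Proof. by apply/ffunP => l; rewrite !ffunE linear0 scale0r. Qed.
Fact tpureZ (c : K) r a : tpure (c *: r) a = tpure r (c *: a).
Proof. by apply/ffunP => l; rewrite !ffunE [in RHS]linearZ /= scalerA mulrC. Qed.
Fact tpure_suml (J : finType) (f : J -> R) a :
  tpure (\sum_j f j) a = \sum_j tpure (f j) a.
Proof. exact: (big_morph (tpure^~ a) (fun r r' => tpureDl r r' a) (tpure0l a)). Qed.
Fact tpure_sumr (J : finType) r (f : J -> L) :
  tpure r (\sum_j f j) = \sum_j tpure r (f j).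
Proof. exact: (big_morph (tpure r) (tpureDr r) (tpure0r r)). Qed.

Fact tens_sum (x : tens) : x = \sum_(i < d) tpure (x i) e`_i.
Proof.
apply/ffunP => l; rewrite sum_ffunE (bigD1 l) //= ffunE.
rewrite coord_free ?(basis_free (vbasisP _)) // eqxx scale1r big1 ?addr0 // => i /negPf il.
by rewrite ffunE coord_free ?(basis_free (vbasisP _)) // il scale0r.
Qed.

Fact tmulDl : left_distributive tmul +%R.
Proof.
move=> x y z; rewrite /tmul -big_split /=; apply: eq_bigr => i _.
rewrite -big_split; apply: eq_bigr => j _.
by rewrite ffunE mulrDl tpureDl.
Qed.

Fact tmulC : commutative tmul.
Proof.
move=> x y; rewrite /tmul exchange_big; apply: eq_bigr => i _.
by apply: eq_bigr => j _; rewrite mulrC [e`_ _ * _]mulrC.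
Qed.

Fact tmulDr : right_distributive tmul +%R.
Proof. by move=> x y z; rewrite !(tmulC x) tmulDl. Qed.

Fact tmul0l x : tmul 0 x = 0.
Proof. by apply: (addIr (tmul 0 x)); rewrite -tmulDl !add0r. Qed.

Fact tmul_suml (J : finType) (f : J -> tens) y :
  tmul (\sum_j f j) y = \sum_j tmul (f j) y.
Proof. exact: (big_morph (tmul^~ y) (fun x x' => tmulDl x x' y) (tmul0l y)). Qed.
Fact tmul_sumr (J : finType) (f : J -> tens) y :
  tmul y (\sum_j f j) = \sum_j tmul y (f j).
Proof. by rewrite tmulC tmul_suml; apply: eq_bigr => j _; rewrite tmulC. Qed.

Fact tpureM r r' a a' : tmul (tpure r a) (tpure r' a') = tpure (r * r') (a * a').
Proof.
rewrite [in RHS](vbasis_sum a) mulr_suml tpure_sumr; apply: eq_bigr => i _.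
rewrite [in RHS](vbasis_sum a') mulr_sumr tpure_sumr; apply: eq_bigr => j _.
rewrite !ffunE -scalerAl -scalerAr -scalerAl -scalerAr !tpureZ.
by rewrite !scalerA [X in X *: _]mulrC.
Qed.

Fact tens_ind (C : tens -> Prop) :
  (forall x y, C x -> C y -> C (x + y)) -> C 0 ->
  (forall r a, C (tpure r a)) -> forall x, C x.
Proof. by move=> CD C0 Cp x; rewrite (tens_sum x); apply: (big_ind C). Qed.

Fact tmulA : associative tmul.
Proof.
move=> x y z; elim/tens_ind: x => [x x'||r a]; first by rewrite !tmulDl => -> ->.
  by rewrite !tmul0l.
elim/tens_ind: y => [y y'||s b]; first by rewrite tmulDr !tmulDl tmulDr => -> ->.
  by rewrite (tmulC _ 0) !tmul0l tmulC tmul0l.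
elim/tens_ind: z => [z z'||t c]; first by rewrite !tmulDr => -> ->.
  by rewrite !(tmulC _ 0) !tmul0l tmulC tmul0l.
by rewrite !tpureM !mulrA.
Qed.

Fact tmul1 : left_id tone tmul.
Proof.
move=> x; rewrite [in LHS](tens_sum x) tmul_sumr [RHS]tens_sum.
by apply: eq_bigr => i _; rewrite tpureM !mul1r.
Qed.

Fact tone_neq0 : tone != 0.
Proof.
apply/eqP => /ffunP t0.
have /eqP := oner_neq0 L; apply; rewrite (vbasis_sum 1); apply: big1 => i _.
have /eqP := t0 i; rewrite !ffunE scaler_eq0 oner_eq0 orbF => /eqP ->.
by rewrite scale0r.
Qed.

HB.instance Definition _ :=
  GRing.Zmodule_isComNzRing.Build tens tmulA tmulC tmul1 tmulDl tone_neq0.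

Definition tscale (a : L) (x : tens) : tens := tpure 1 a * x.

Fact tscaleA a b x : tscale a (tscale b x) = tscale (a * b) x.
Proof. by rewrite /tscale mulrA [_ * tpure 1 b]tpureM mulr1. Qed.
Fact tscale1 : left_id 1 tscale.
Proof. by move=> x; rewrite /tscale mul1r. Qed.
Fact tscaleDr : right_distributive tscale +%R.
Proof. by move=> a x y; rewrite /tscale mulrDr. Qed.
Fact tscaleDl x : {morph tscale^~ x : a b / a + b}.
Proof. by move=> a b; rewrite /tscale tpureDr mulrDl. Qed.

HB.instance Definition _ := GRing.Zmodule_isLmodule.Build L tens
  tscaleA tscale1 tscaleDr tscaleDl.

Fact tscaleAl a (x y : tens) : a *: (x * y) = (a *: x) * y.
Proof. exact: mulrA. Qed.

HB.instance Definition _ := GRing.Lmodule_isLalgebra.Build L tens tscaleAl.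
HB.instance Definition _ := GRing.Lalgebra_isComAlgebra.Build L tens.

(* id (x) s, for a K-linear map s : L -> L *)
Definition tens_sig (s : L -> L) (x : tens) : tens :=
  \sum_(i < d) tpure (x i) (s e`_i).
End Tensor.

(* f (x) id *)
Definition tens_map (K : fieldType) (L : fieldExtType K) (R R' : comAlgType K)
    (f : R -> R') (x : tens R L) : tens R' L := [ffun i => f (x i)].

(* An affine algebraic group over K given by its functor of points: G(R) is the
   set of the elements of the ambient monoid gamb R that satisfy gmem. *)
Record grpfun (K : fieldType) := GrpFun {
  gamb : comAlgType K -> Type;
  gmem : forall R, gamb R -> Prop;
  gmul : forall R, gamb R -> gamb R -> gamb R;
  gmap : forall R R' : comAlgType K, (R -> R') -> gamb R -> gamb R'
}.

Definition grp_iso (K : fieldType) (G G' : grpfun K) : Prop :=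
  exists f : forall R, gamb G R -> gamb G' R,
    [/\ forall R x, gmem x -> gmem (f R x),
        forall R x y, gmem x -> gmem y -> f R (gmul x y) = gmul (f R x) (f R y),
        forall R x y, gmem x -> gmem y -> f R x = f R y -> x = y,
        forall R y, gmem y -> exists2 x, gmem x & f R x = y &
        forall (R R' : comAlgType K) (h : {lrmorphism R -> R'}) x, gmem x ->
          f R' (gmap h x) = gmap h (f R x)].

Definition mx_inv (R : pzRingType) (r : nat) (g : 'M[R]_r) : Prop :=
  exists g', g *m g' = 1%:M /\ g' *m g = 1%:M.

(* Aut_{K/K}(K^r, h), for the bilinear form h with Gram matrix A *)
Definition bil_aut (K : fieldType) (r : nat) (A : 'M[K]_r) : grpfun K :=
  @GrpFun K (fun R => 'M[R]_r)
    (fun R g => let AR := map_mx (in_alg R) A in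
                mx_inv g /\ g^T *m AR *m g = AR)
    (fun R g h => g *m h) (fun R R' f g => map_mx f g).

(* Aut_{L/K}(L^r, h), for the form h with Gram matrix A which is linear in the
   first variable and semilinear with respect to the K-automorphism s of L in
   the second one; here R (x)_K L^r = (R (x)_K L)^r *)
Definition sesq_aut (K : fieldType) (L : fieldExtType K) (s : L -> L) (r : nat)
    (A : 'M[L]_r) : grpfun K :=
  @GrpFun K (fun R => 'M[tens R L]_r)
    (fun R g => let AR := map_mx (in_alg (tens R L)) A in
                mx_inv g /\ g^T *m AR *m map_mx (tens_sig s) g = AR)
    (fun R g h => g *m h)
    (fun R R' f g => map_mx (@tens_map K L R R' f) g).

(* the Weil restriction: Res_{L/K}(G)(R) = G(R (x)_K L) *)
Definition weil_res (K : fieldType) (L : fieldExtType K) (G : grpfun L) :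
    grpfun K :=
  @GrpFun K (fun R => gamb G (tens R L)) (fun R g => gmem g)
    (fun R g h => gmul g h) (fun R R' f g => gmap (@tens_map K L R R' f) g).

Definition is_orthogonal (K : fieldType) (G : grpfun K) : Prop :=
  exists (r : nat) (A : 'M[K]_r),
    [/\ A \in unitmx, A^T = A & grp_iso G (bil_aut A)].

Definition is_symplectic (K : fieldType) (G : grpfun K) : Prop :=
  exists (r : nat) (A : 'M[K]_r),
    [/\ A \in unitmx, A^T = - A, forall i, A i i = 0 & grp_iso G (bil_aut A)].

Definition is_res_orthogonal (K : fieldType) (L : fieldExtType K)
    (G : grpfun K) : Prop :=
  exists2 G' : grpfun L, is_orthogonal G' & grp_iso G (weil_res G').

Definition is_res_symplectic (K : fieldType) (L : fieldExtType K)
    (G : grpfun K) : Prop :=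
  exists2 G' : grpfun L, is_symplectic G' & grp_iso G (weil_res G').

(* the unitary group of a Hermitian space over a quadratic extension E of K *)
Definition is_unitary (K : fieldType) (G : grpfun K) : Prop :=
  exists (E : fieldExtType K) (s : {lrmorphism E -> E}) (r : nat) (A : 'M[E]_r),
    [/\ \dim {:E} = 2 /\ (exists a, s a <> a), A \in unitmx,
        (map_mx s A)^T = A & grp_iso G (sesq_aut s A)].

Section Squares.
Variables (L : fieldType) (W : lmodType L).

Definition bilinear_map (N : lmodType L) (w : W -> W -> N) : Prop :=
  (forall (a : L) x x' y, w (a *: x + x') y = a *: w x y + w x' y) /\
  (forall (a : L) x y y', w x (a *: y + y') = a *: w x y + w x y').

Definition alternating_map (N : lmodType L) (w : W -> W -> N) : Prop :=
  bilinear_map w /\ forall x, w x x = 0.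

Definition symmetric_map (N : lmodType L) (w : W -> W -> N) : Prop :=
  bilinear_map w /\ forall x y, w x y = w y x.

(* The subset H of the L-vector space E is a subspace, and w : W x W -> H is the
   universal bilinear map with property C *)
Definition universal_square (C : forall N : lmodType L, (W -> W -> N) -> Prop)
    (E : lmodType L) (H : E -> Prop) (w : W -> W -> E) : Prop :=
  [/\ H 0 /\ (forall (a : L) x y, H x -> H y -> H (a *: x + y)),
      forall x y, H (w x y),
      C E w &
      forall (N : lmodType L) (h : W -> W -> N), C N h ->
        let fact (f : E -> N) :=
          (forall (a : L) x y, H x -> H y -> f (a *: x + y) = a *: f x + f y) /\
          (forall x y, f (w x y) = h x y) in
        (exists f, fact f) /\
        (forall f f', fact f -> fact f' -> forall x, H x -> f x = f' x)].

Definition ext_square := universal_square alternating_map.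
Definition sym_square := universal_square symmetric_map.

Definition hermitian_form (s : L -> L) (f : W -> W -> L) : Prop :=
  (forall (a : L) x x' y, f (a *: x + x') y = a * f x y + f x' y) /\
  (forall x y, f y x = s (f x y)).
End Squares.

(* F is isomorphic to a finite product of finite separable field extensions of k *)
Definition finite_separable (k : fieldType) (F : comUnitAlgType k) : Prop :=
  exists (r : nat) (K : 'I_r -> fieldExtType k)
         (f : forall j, {lrmorphism F -> K j}),
    (forall j, separable 1%AS {:K j}%AS) /\
    (forall y : (forall j, K j), exists! x : F, forall j, f j x = y j).

Record twdata (k : fieldType) := TwData {
  tF :> comUnitAlgType k;
  tzeta : {rmorphism tF -> tF};
  tn : nat;
  tm : nat;
  tbeta : k;
  tF_separable : finite_separable tF;
  tn_gt0 : (0 < tn)%N;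
  tzeta_order : forall a, iter tn tzeta a = a;
  tzeta_order_min :
    forall j, (0 < j < tn)%N -> exists a, iter j tzeta a <> a;
  tzeta_fixed : forall a, tzeta a = a <-> exists x : k, a = x%:A;
  tn_dvd : (tn %| tm)%N;
  tN_neq0 : (tm %/ tn)%:R != 0 :> k;
  tbeta_neq0 : tbeta != 0
}.

Definition Nm (k : fieldType) (T : twdata k) (a : T) : T :=
  \prod_(j < tn T) iter j (@tzeta k T) a.

(* A left module over A_beta = F<theta> / (theta^m - beta): an F-module with a
   zeta-semilinear operator theta such that theta^m = beta.  As beta <> 0,
   theta is bijective. *)
Record twmod (k : fieldType) (T : twdata k) := TwMod {
  tw_car :> lmodType T;
  tw_th : tw_car -> tw_car;
  tw_thD : forall x y, tw_th (x + y) = tw_th x + tw_th y;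
  tw_thZ : forall (a : T) x, tw_th (a *: x) = @tzeta k T a *: tw_th x;
  tw_thm : forall x, iter (tm T) tw_th x = (tbeta T)%:A *: x
}.

Definition fin_gen (k : fieldType) (T : twdata k) (V : twmod T) : Prop :=
  exists (r : nat) (s : 'I_r -> V),
    forall v, exists a : 'I_r -> T, v = \sum_(j < r) a j *: s j.

Definition is_twhom (k : fieldType) (T : twdata k) (U W : twmod T)
    (f : U -> W) : Prop :=
  [/\ forall x y, f (x + y) = f x + f y,
      forall (a : T) x, f (a *: x) = a *: f x &
      forall x, f (tw_th x) = tw_th (f x)].

(* Hom_{A_beta}(U, W) *)
Record twhom (k : fieldType) (T : twdata k) (U W : twmod T) := TwHom {
  hom_fun :> U -> W;
  homP : is_twhom hom_fun
}.

Section TwHom.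
Variables (k : fieldType) (T : twdata k).
Implicit Types U W X : twmod T.

Lemma hom_eqP U W (f g : twhom U W) : f =1 g -> f = g.
Proof.
case: f g => [f fP] [g gP] /= /funext fg; rewrite fg in fP *.
by rewrite (Prop_irrelevance fP gP).
Qed.

Lemma homD U W (f : twhom U W) x y : f (x + y) = f x + f y.
Proof. by case: (homP f). Qed.
Lemma homZ U W (f : twhom U W) (a : T) x : f (a *: x) = a *: f x.
Proof. by case: (homP f). Qed.
Lemma hom_th U W (f : twhom U W) x : f (tw_th x) = tw_th (f x).
Proof. by case: (homP f). Qed.

Fact th0 U : tw_th 0 = 0 :> U.
Proof. by apply: (addIr (tw_th 0)); rewrite -tw_thD !add0r. Qed.
Fact thN U (x : U) : tw_th (- x) = - tw_th x.
Proof. by apply: (addIr (tw_th x)); rewrite -tw_thD !addNr th0. Qed.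

Lemma hom0 U W (f : twhom U W) : f 0 = 0.
Proof. by apply: (addIr (f 0)); rewrite -homD !add0r. Qed.

Fact hom_id_subproof U : is_twhom (@id U). Proof. by []. Qed.
Definition hom_id U := TwHom (hom_id_subproof U).

Fact hom_comp_subproof U W X (g : twhom W X) (f : twhom U W) :
  is_twhom (g \o f).
Proof.
by split=> [x y|a x|x] /=; rewrite ?homD ?homZ ?hom_th.
Qed.
Definition hom_comp U W X (g : twhom W X) (f : twhom U W) : twhom U X :=
  TwHom (hom_comp_subproof g f).

Fact hom_zero_subproof U W : is_twhom (fun _ : U => 0 : W).
Proof. by split=> *; rewrite ?addr0 ?scaler0 ?th0. Qed.
Fact hom_opp_subproof U W (f : twhom U W) : is_twhom (fun x => - f x).
Proof.
by split=> *; rewrite ?homD ?homZ ?hom_th ?thN ?opprD ?scalerN.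
Qed.
Fact hom_add_subproof U W (f g : twhom U W) : is_twhom (fun x => f x + g x).
Proof.
by split=> *; rewrite ?homD ?homZ ?hom_th ?tw_thD ?scalerDr // addrACA.
Qed.

HB.instance Definition _ U W := gen_eqMixin (twhom U W).
HB.instance Definition _ U W := gen_choiceMixin (twhom U W).

Definition hom_zero U W := TwHom (hom_zero_subproof U W).
Definition hom_opp U W (f : twhom U W) := TwHom (hom_opp_subproof f).
Definition hom_add U W (f g : twhom U W) := TwHom (hom_add_subproof f g).

Fact hom_addA U W : associative (@hom_add U W).
Proof. by move=> f g h; apply: hom_eqP => x /=; rewrite addrA. Qed.
Fact hom_addC U W : commutative (@hom_add U W).
Proof. by move=> f g; apply: hom_eqP => x /=; rewrite addrC. Qed.
Fact hom_add0 U W : left_id (hom_zero U W) (@hom_add U W).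
Proof. by move=> f; apply: hom_eqP => x /=; rewrite add0r. Qed.
Fact hom_addN U W : left_inverse (hom_zero U W) (@hom_opp U W) (@hom_add U W).
Proof. by move=> f; apply: hom_eqP => x /=; rewrite addNr. Qed.

HB.instance Definition _ U W := GRing.isZmodule.Build (twhom U W)
  (@hom_addA U W) (@hom_addC U W) (@hom_add0 U W) (@hom_addN U W).

End TwHom.

(* L_beta = k[b] = k[X] / (X^(m/n) - beta); b acts on A_beta-modules as
   theta^n *)
Definition Lpoly (k : fieldType) (T : twdata k) : {poly k} :=
  'X^(tm T %/ tn T) - (tbeta T)%:P.

Notation Lbeta T := {poly %/ (Lpoly T)}.

Definition b_ (k : fieldType) (T : twdata k) : Lbeta T := 'qX.

Section LbetaAction.
Variables (k : fieldType) (T : twdata k).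
Implicit Types (U : twmod T) (p q : {poly k}).
Local Notation th U := (@tw_th _ _ U).
Local Notation N := (tm T %/ tn T)%N.

Fact tN_gt0 : (0 < N)%N.
Proof. by rewrite lt0n; apply: contraNneq (tN_neq0 T) => ->. Qed.

Fact size_Lpoly : size (Lpoly T) = N.+1.
Proof. by rewrite /Lpoly size_XnsubC ?tN_gt0. Qed.

Fact monic_Lpoly : Lpoly T \is monic.
Proof. by rewrite /Lpoly monicXnsubC ?tN_gt0. Qed.

Fact mk_monic_Lpoly : mk_monic (Lpoly T) = Lpoly T.
Proof. by rewrite /mk_monic size_Lpoly monic_Lpoly ltnS tN_gt0. Qed.

(* p(b) acting on an A_beta-module *)
Definition bact U p (u : U) : U :=
  \sum_(j < size p) (p`_j)%:A *: iter (tn T * j) (th U) u.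

Fact bactE U p r (u : U) : (size p <= r)%N ->
  bact p u = \sum_(j < r) (p`_j)%:A *: iter (tn T * j) (th U) u.
Proof.
move=> le_r; rewrite /bact.
rewrite (big_ord_widen r
  (fun j => (p`_j)%:A *: iter (tn T * j) (th U) u)) //.
rewrite big_mkcond /=; apply: eq_bigr => j _; case: ltnP => // lej.
by rewrite nth_default // !scale0r.
Qed.

Fact tzeta_k (x : k) : @tzeta k T x%:A = x%:A.
Proof. by apply/tzeta_fixed; exists x. Qed.

Fact iter_thD U r (x y : U) :
  iter r (th U) (x + y) = iter r (th U) x + iter r (th U) y.
Proof. by elim: r => //= r ->; rewrite tw_thD. Qed.
Fact iter_th0 U r : iter r (th U) 0 = 0.
Proof. by elim: r => //= r ->; rewrite th0. Qed.
Fact iter_thZ U r (a : T) (x : U) :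
  iter r (th U) (a *: x) = iter r (@tzeta _ T) a *: iter r (th U) x.
Proof. by elim: r => //= r ->; rewrite tw_thZ. Qed.
Fact iter_zeta_mul r (a : T) : iter (tn T * r) (@tzeta _ T) a = a.
Proof. by elim: r => [|r IH]; rewrite ?muln0 // mulnS iterD IH tzeta_order. Qed.
Fact iter_th_sum U r (J : finType) (f : J -> U) :
  iter r (th U) (\sum_j f j) = \sum_j iter r (th U) (f j).
Proof. by apply: (big_morph _ (iter_thD r) (iter_th0 U r)). Qed.

Fact bact_hom_subproof U p : is_twhom (@bact U p).
Proof.
split=> [x y|a x|x]; rewrite /bact.
- by rewrite -big_split; apply: eq_bigr => j _; rewrite iter_thD scalerDr.
- rewrite scaler_sumr; apply: eq_bigr => j _.
  by rewrite iter_thZ iter_zeta_mul !scalerA mulrC.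
- rewrite -[RHS]/(iter 1 (th U) _) iter_th_sum; apply: eq_bigr => j _ /=.
  by rewrite tw_thZ tzeta_k -iterS iterSr.
Qed.

Definition bact_hom U p : twhom U U := TwHom (bact_hom_subproof U p).

Fact bactD U p q (u : U) : bact (p + q) u = bact p u + bact q u.
Proof.
have := size_polyD p q; set r := maxn _ _ => le_r.
rewrite (@bactE _ _ r) // (@bactE _ p r) ?leq_maxl // (@bactE _ q r) ?leq_maxr //.
by rewrite -big_split; apply: eq_bigr => j _; rewrite coefD !scalerDl.
Qed.

Fact bactC U (c : k) (u : U) : bact c%:P u = c%:A *: u.
Proof.
by rewrite (@bactE _ _ 1) ?size_polyC_leq1 // big_ord1 coefC muln0.
Qed.

Fact bactZ U (c : k) p (u : U) : bact (c *: p) u = c%:A *: bact p u.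
Proof.
rewrite (@bactE _ _ (size p)) ?size_scale_leq // scaler_sumr.
by apply: eq_bigr => j _; rewrite coefZ scalerA -scalerAl mul1r scalerA.
Qed.

Fact bactMX U p (u : U) : bact (p * 'X) u = bact p (iter (tn T) (th U) u).
Proof.
rewrite (@bactE _ _ (size p).+1); last first.
  by rewrite (leq_trans (size_polyMleq _ _)) // size_polyX addn2.
rewrite big_ord_recl coefMX !scale0r add0r; apply: eq_bigr => j _.
by rewrite lift0 coefMX /= mulnS addnC iterD.
Qed.

Fact bact_iter U p r (u : U) :
  bact p (iter r (th U) u) = iter r (th U) (bact p u).
Proof. by elim: r => //= r <-; apply: (hom_th (bact_hom U p)). Qed.

Fact bactM U p q (u : U) : bact (p * q) u = bact p (bact q u).
Proof.
elim/poly_ind: p u => [u|p c IH u].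
  by rewrite mul0r -polyC0 !bactC !scale0r.
by rewrite mulrDl !bactD mulrAC !bactMX IH bact_iter mul_polyC bactZ bactC.
Qed.

Fact bactXn U r (u : U) : bact 'X^r u = iter (tn T * r) (th U) u.
Proof.
elim: r u => [|r IH] u.
  by rewrite expr0 -polyC1 bactC muln0 scale1r scale1r.
by rewrite exprSr bactMX IH mulnS addnC iterD.
Qed.

Fact bact_Lpoly U (u : U) : bact (Lpoly T) u = 0.
Proof.
rewrite /Lpoly bactD bactXn mulnC divnK ?tn_dvd // tw_thm.
by rewrite -polyCN bactC -scalerDl scaleNr subrr scale0r.
Qed.

Fact bact_mod U p (u : U) : bact (in_qpoly (Lpoly T) p) u = bact p u.
Proof.
rewrite /= mk_monic_Lpoly {2}(Pdiv.RingMonic.rdivp_eq monic_Lpoly p).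
rewrite bactD bactM bact_Lpoly [X in X + _](_ : _ = 0) ?add0r //.
exact: (hom0 (bact_hom U _)).
Qed.
End LbetaAction.

Definition is_simple (k : fieldType) (T : twdata k) (U : twmod T) : Prop :=
  (exists u : U, u <> 0) /\
  forall P : U -> Prop,
    P 0 -> (forall x y, P x -> P y -> P (x + y)) ->
    (forall (a : T) x, P x -> P (a *: x)) ->
    (forall x, P x -> P (tw_th x)) ->
    (forall x, P x -> x = 0) \/ (forall x, P x).

(* A quotient field L of L_beta and a simple module S over the corresponding
   factor of A_beta, i.e. a simple A_beta-module on which L_beta acts through
   its quotient L. *)
Record vertex (k : fieldType) (T : twdata k) := Vertex {
  vL : fieldExtType k;
  vpr : {lrmorphism Lbeta T -> vL};
  vpr_surj : forall a, exists z, vpr z = a;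
  vS : twmod T;
  vS_simple : is_simple vS;
  vS_factor : forall z, vpr z = 0 -> forall u : vS, bact z u = 0
}.

Definition vb (k : fieldType) (T : twdata k) (v : vertex T) : vL v :=
  vpr v (b_ T).

(* M = Hom_{A_beta}(S, V), with (a x)(u) = x(u a) *)
Definition Mult (k : fieldType) (T : twdata k) (v : vertex T) (V : twmod T) :=
  twhom (vS v) V.

(* D = End_{A_beta}(S)^opp; the product of d and d' in D is d' \o d *)
Notation Dalg v := (Mult v (vS v)).

Section MultModule.
Variables (k : fieldType) (T : twdata k) (v : vertex T).
Local Notation L := (vL v).
Local Notation S := (vS v).

Definition vlift (a : L) : Lbeta T := sval (cid (vpr_surj a)).
Fact vliftK a : vpr v (vlift a) = a. Proof. exact: (svalP (cid (vpr_surj a))). Qed.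

(* the action of L on S *)
Definition lact (a : L) : Dalg v := bact_hom S (vlift a).

Fact lactE z (u : S) : lact (vpr v z) u = bact z u.
Proof.
have /vS_factor/(_ u) : vpr v (vlift (vpr v z) - z) = 0.
  by rewrite raddfB /= vliftK subrr.
by rewrite bactD -scaleN1r bactZ !scaleN1r => /eqP; rewrite subr_eq0 => /eqP.
Qed.

Fact lactD a b (u : S) : lact (a + b) u = lact a u + lact b u.
Proof. by rewrite -[a]vliftK -[b]vliftK -raddfD !lactE bactD. Qed.
Fact lactM a b (u : S) : lact (a * b) u = lact a (lact b u).
Proof. by rewrite -[a]vliftK -[b]vliftK -rmorphM !lactE bact_mod bactM. Qed.
Fact lact1 (u : S) : lact 1 u = u.
Proof. by rewrite -(rmorph1 (vpr v)) lactE bactC !scale1r. Qed.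

Variable V : twmod T.
HB.instance Definition _ := GRing.Zmodule.copy (Mult v V) (twhom S V).

Definition mult_scale (a : L) (x : Mult v V) : Mult v V := hom_comp x (lact a).

Fact mult_scaleA a b x :
  mult_scale a (mult_scale b x) = mult_scale (a * b) x.
Proof.
apply: hom_eqP => u; rewrite mulrC -[RHS]/(x (lact (b * a) u)).
by rewrite lactM.
Qed.
Fact mult_scale1 : left_id 1 mult_scale.
Proof.
by move=> x; apply: hom_eqP => u; rewrite -[LHS]/(x (lact 1 u)) lact1.
Qed.
Fact mult_scaleDr : right_distributive mult_scale +%R.
Proof. by move=> a x y; apply: hom_eqP. Qed.
Fact mult_scaleDl x : {morph mult_scale^~ x : a b / a + b}.
Proof.
move=> a b; apply: hom_eqP => u; rewrite -[LHS]/(x (lact (a + b) u)).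
by rewrite lactD homD.
Qed.

HB.instance Definition _ := GRing.Zmodule_isLmodule.Build L (Mult v V)
  mult_scaleA mult_scale1 mult_scaleDr mult_scaleDl.

(* the action of D on M: (d x)(u) = x(u d) *)
Definition dact (d : Dalg v) (x : Mult v V) : Mult v V := hom_comp x d.
End MultModule.

Definition lbasis (K : fieldType) (W : lmodType K) (r : nat) (e : 'I_r -> W) :=
  forall x, exists! a : 'rV[K]_r, x = \sum_(j < r) a 0 j *: e j.

(* t = Trd_{D/L}(d): the trace of d in a splitting D -> M_r(E) over some field
   extension E of L, where r^2 = [D : L] *)
Definition is_trd (k : fieldType) (T : twdata k) (v : vertex T)
    (d : Dalg v) (t : vL v) : Prop :=
  exists (E : fieldType) (iota : {rmorphism vL v -> E}) (r : nat)
         (rho : Dalg v -> 'M[E]_r),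
    [/\ exists e : 'I_(r * r) -> Dalg v, lbasis e,
        (forall d1 d2, rho (d1 + d2) = rho d1 + rho d2) /\
        (forall d1 d2, rho (hom_comp d2 d1) = rho d1 *m rho d2),
        forall a, rho (lact a) = (iota a)%:M &
        \tr (rho d) = iota t].

Record polarization (k : fieldType) (T : twdata k) (V : twmod T) :=
  Polarization {
  psig : {rmorphism T -> T};
  psig_invol : forall a, psig (psig a) = a;
  psig_zeta : forall a, psig (@tzeta k T a) = @tzeta k T (psig a);
  peps : int;
  peps_sign : peps = 1 \/ peps = -1;
  pc : T;
  pc_unit : pc \is a GRing.unit;
  pc_fixed : psig pc = pc;
  pc_norm : Nm pc ^+ (tm T %/ tn T) = (tbeta T)%:A * psig (tbeta T)%:A;
  pform : V -> V -> T;
  pformDl : forall x x' y, pform (x + x') y = pform x y + pform x' y;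
  pformZl : forall a x y, pform (a *: x) y = a * pform x y;
  pform_sym : forall x y, pform x y = peps%:~R * psig (pform y x);
  pform_nondeg : forall x, (forall y, pform x y = 0) -> x = 0;
  pform_th : forall x y,
    pform (tw_th x) (tw_th y) = pc * @tzeta k T (pform x y)
}.

(* k-points of H *)
Definition in_H (k : fieldType) (T : twdata k) (V : twmod T)
    (P : polarization V) (g : twhom V V) : Prop :=
  bijective g /\ forall x y, pform P (g x) (g y) = pform P x y.

Section Admissible.
Variables (k : fieldType) (T : twdata k) (V : twmod T) (P : polarization V).
Definition admissible (S S' : twmod T) (h : S -> S' -> T) : Prop :=
  [/\ forall u u' v, h (u + u') v = h u v + h u' v,
      forall u v v', h u (v + v') = h u v + h u v',
      forall a u v, h (a *: u) v = a * h u v,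
      forall a u v, h u (a *: v) = psig P a * h u v &
      forall u v, h (tw_th u) (tw_th v) = pc P * @tzeta k T (h u v)].

Definition perfect (S S' : twmod T) (h : S -> S' -> T) : Prop :=
  (forall f : S -> T,
     (forall u u', f (u + u') = f u + f u') ->
     (forall a u, f (a *: u) = a * f u) ->
     exists! v, forall u, f u = h u v) /\
  (forall f : S' -> T,
     (forall v v', f (v + v') = f v + f v') ->
     (forall a v, f (a *: v) = psig P a * f v) ->
     exists! u, forall v, f v = h u v).

(* f is an A_beta-isomorphism U^xi -> S, where theta acts on U^xi as xi theta *)
Definition twist_iso (xi : T) (U S : twmod T) (f : U -> S) : Prop :=
  [/\ forall x y, f (x + y) = f x + f y,
      forall (a : T) x, f (a *: x) = a *: f x,
      forall x, f (xi *: tw_th x) = tw_th (f x) &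
      bijective f].

(* s is the ring automorphism sigma_a of L_beta *)
Definition is_sigma (a : T) (s : {rmorphism Lbeta T -> Lbeta T}) : Prop :=
  (forall x y : k, psig P x%:A = y%:A -> s x%:A = y%:A) /\
  (forall g : k, g%:A = Nm a -> s (b_ T) = g *: (b_ T)^-1).
End Admissible.

(* Arrows are indexed by their source: the arrow i goes from i to qxi i.
   The families qS, qbr', qbr (resp. qeta) carry two indices i, j and are only
   meaningful when j = qdia i (resp. j = qxi i); this avoids transporting along
   these equalities when i is a fixed vertex (resp. a fixed arrow). *)
Record quiver (k : fieldType) (T : twdata k) (V : twmod T)
    (P : polarization V) (xi : T) := Quiver {
  qI :> finType;
  qv : qI -> vertex T;
  qv_prod : forall y : (forall i, vL (qv i)),
    exists! z : Lbeta T, forall i, vpr (qv i) z = y i;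

  qsc : {rmorphism Lbeta T -> Lbeta T};
  qsc_spec : is_sigma P (pc P) qsc;
  qscx : {rmorphism Lbeta T -> Lbeta T};
  qscx_spec : is_sigma P (pc P / xi) qscx;

  qdia : qI -> qI;
  qdiaK : involutive qdia;
  (* sigma_c maps the factor L_i of L_beta, embedded as the ideal where the
     other components vanish, onto the factor L_(qdia i) *)
  qdia_spec : forall i z,
    (forall j, j != i -> vpr (qv j) z = 0) <->
    (forall j, j != qdia i -> vpr (qv j) (qsc z) = 0);

  qS : forall i j, vS (qv i) -> vS (qv j) -> T;
  qS_adm : forall i j, j = qdia i -> admissible P (@qS i j);
  qS_perfect : forall i j, j = qdia i -> perfect P (@qS i j);
  qsgn : qI -> int;
  qS_sym : forall i j, j = qdia i -> forall u v,
    @qS j i v u = (qsgn i)%:~R * psig P (@qS i j u v);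
  qsgn_neq : forall i, qdia i <> i -> qsgn i = 1;
  qsgn_1 : forall i, qdia i = i ->
    (exists h : vS (qv i) -> vS (qv i) -> T,
       [/\ admissible P h, perfect P h & forall u v, h v u = psig P (h u v)]) ->
    qsgn i = 1;
  qsgn_N1 : forall i, qdia i = i ->
    ~ (exists h : vS (qv i) -> vS (qv i) -> T,
       [/\ admissible P h, perfect P h & forall u v, h v u = psig P (h u v)]) ->
    qsgn i = -1;

  qbr' : forall i j, Mult (qv i) V -> Mult (qv j) V -> Dalg (qv i);
  qbr'_spec : forall i j, j = qdia i ->
    forall (x : Mult (qv i) V) (y : Mult (qv j) V) u v,
    pform P (x u) (y v) = @qS i j (@qbr' i j x y u) v;
  qbr : forall i j, Mult (qv i) V -> Mult (qv j) V -> vL (qv i);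
  qbr_spec : forall i j, j = qdia i -> forall x y,
    is_trd (@qbr' i j x y) (@qbr i j x y);

  qxi : {perm qI};
  qeta : forall i j, vS (qv i) -> vS (qv j);
  qeta_iso : forall i j, j = qxi i -> twist_iso xi (@qeta i j);
  qesgn : qI -> int;
  qeta_sym : forall i j i' l, j = qxi i -> i' = qdia i -> l = qdia j ->
    forall (u : vS (qv i)) (v : vS (qv l)),
      psig P (@qS l j v (@qeta i j u)) =
      (qesgn i)%:~R * @qS i i' u (@qeta l i' v);
  qesgn_neq : forall i, qdia (qxi i) <> i -> qesgn i = 1;
  qesgn_1 : forall i j, j = qxi i -> qdia j = i ->
    (exists2 f : vS (qv i) -> vS (qv j), twist_iso xi f &
       forall u v, @qS i j u (f v) = psig P (@qS i j v (f u))) ->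
    qesgn i = 1;
  qesgn_N1 : forall i j, j = qxi i -> qdia j = i ->
    ~ (exists2 f : vS (qv i) -> vS (qv j), twist_iso xi f &
       forall u v, @qS i j u (f v) = psig P (@qS i j v (f u))) ->
    qesgn i = -1
}.

Section Quiver.
Variables (k : fieldType) (T : twdata k) (V : twmod T) (P : polarization V).
Variables (xi : T) (Q : quiver P xi).
Implicit Types i j : qI Q.
Local Notation M i := (Mult (qv i) V).
Local Notation L i := (vL (qv i)).

(* the source of e^dia, for the arrow e with source i *)
Definition qadia i : Q := qdia (qxi Q i).

Definition fixed_vertex i : Prop := qdia i = i.
Definition fixed_arrow i : Prop := qadia i = i.

Definition single_cycle (len : nat) : Prop :=
  #|qI Q| = len /\ forall i j, j \in porbit (qxi Q) i.

Definition nb_fixed_vertices := #|[set i : Q | qdia i == i]|.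
Definition nb_fixed_arrows := #|[set i : Q | qadia i == i]|.
Definition type_VV : Prop := nb_fixed_vertices = 2%N /\ nb_fixed_arrows = 0%N.
Definition type_VE : Prop := nb_fixed_vertices = 1%N /\ nb_fixed_arrows = 1%N.
Definition type_EE : Prop := nb_fixed_vertices = 0%N /\ nb_fixed_arrows = 2%N.

(* the map L_i -> L_i induced by a ring endomorphism of L_beta preserving the
   factor L_i *)
Definition restr (s : Lbeta T -> Lbeta T) i (a : L i) : L i :=
  vpr (qv i) (s (vlift a)).

(* the space h^{eps'}(M_i, M_j) for j = qdia i = qxi i; eta_e^flat(d) = d' is
   expressed by eta_e(u d) = eta_e(u) d' *)
Definition hspace (eps' : int) i j (phi : M i -> M j) : Prop :=
  [/\ forall x y, phi (x + y) = phi x + phi y,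
      forall (d : Dalg (qv i)) (d' : Dalg (qv j)),
        (forall u, @qeta _ _ _ _ _ Q i j (d u) = d' (@qeta _ _ _ _ _ Q i j u)) ->
        forall x, phi (dact d x) = dact d' (phi x) &
      forall x y, @qbr _ _ _ _ _ Q i j y (phi x) =
                  eps'%:~R * restr (qscx Q) (@qbr _ _ _ _ _ Q i j x (phi y))].

Definition gram i r (e : 'I_r -> M i) : 'M[L i]_r :=
  \matrix_(s, t) @qbr _ _ _ _ _ Q i i (e s) (e t).

(* the group Aut_k(M_i, {,}_i) has property C, when i = qdia i and L_i = k *)
Definition Aut_k_is (C : grpfun k -> Prop) i : Prop :=
  exists r (e : 'I_r -> M i) (A : 'M[k]_r),
    [/\ lbasis e, gram e = map_mx (in_alg (L i)) A & C (bil_aut A)].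

(* the group Aut_{L_i/k}(M_i, {,}_i) has property C, when i = qdia i *)
Definition Aut_Lk_is (C : grpfun k -> Prop) i : Prop :=
  exists r (e : 'I_r -> M i),
    lbasis e /\ C (sesq_aut (@restr (qsc Q) i) (gram e)).

(* H acts on M_i by composition, and on h^{eps'}(M_i, M_j) by conjugation *)
Definition equivariant_square i j (w : M j -> M j -> (M i -> M j)) : Prop :=
  forall g, in_H P g -> forall x y z,
    w (hom_comp g x) (hom_comp g y) (hom_comp g z) = hom_comp g (w x y z).

(* h^{eps'}(M_i, M_j) is isomorphic, over L_j and H-equivariantly, to
   Lambda^2_{L_j}(M_j), resp. to Sym^2_{L_j}(M_j) *)
Definition hspace_is_ext2 eps' i j : Prop :=
  exists2 w : M j -> M j -> (M i -> M j),
    ext_square (@hspace eps' i j) w & equivariant_square w.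

Definition hspace_is_sym2 eps' i j : Prop :=
  exists2 w : M j -> M j -> (M i -> M j),
    sym_square (@hspace eps' i j) w & equivariant_square w.

(* h^{eps'}(M_i, M_j) is isomorphic, over k and H-equivariantly, to the space of
   Hermitian forms on M_i with respect to sigma_{c xi^-1} restricted to L_i *)
Definition hspace_is_herm eps' i j : Prop :=
  let H := @hspace eps' i j in
  let herm := @hermitian_form (L i) (M i) (@restr (qscx Q) i) in
  exists Phi : (M i -> M j) -> (M i -> M i -> L i),
    [/\ forall phi, H phi -> herm (Phi phi),
        forall (a : k) phi psi, H phi -> H psi ->
          Phi (fun x => a%:A *: phi x + psi x) =
          (fun x y => a%:A * Phi phi x y + Phi psi x y),
        forall phi psi, H phi -> H psi -> Phi phi = Phi psi -> phi = psi,
        forall f, herm f -> exists2 phi, H phi & Phi phi = f &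
        forall g, in_H P g -> forall phi psi, H phi -> H psi ->
          (forall x, psi (hom_comp g x) = hom_comp g (phi x)) ->
          forall x y, Phi psi (hom_comp g x) (hom_comp g y) = Phi phi x y].

(* "X or Y": when sigma = id_F, it is X if epsilon = 1 and Y if epsilon = -1 *)
Definition or_by_sign (X Y : Prop) : Prop :=
  [/\ X \/ Y,
      (forall a, psig P a = a) -> peps P = 1 -> X &
      (forall a, psig P a = a) -> peps P = -1 -> Y].

(* h^{- eps eps_e}(M_i, M_j), for the fixed arrow e : i -> j = qdia i *)
Definition arrow_ext_or_sym i : Prop :=
  let eps' := - (peps P * qesgn i) in
  or_by_sign (hspace_is_ext2 eps' i (qdia i)) (hspace_is_sym2 eps' i (qdia i)).

Definition arrow_herm i : Prop :=
  hspace_is_herm (- (peps P * qesgn i)) i (qdia i).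

Definition vertex_orth_or_sympl i : Prop :=
  or_by_sign (Aut_k_is (@is_orthogonal k) i) (Aut_k_is (@is_symplectic k) i).

Definition vertex_res_orth_or_sympl i : Prop :=
  or_by_sign (Aut_Lk_is (@is_res_orthogonal k (L i)) i)
             (Aut_Lk_is (@is_res_symplectic k (L i)) i).

Definition vertex_unitary i : Prop := Aut_Lk_is (@is_unitary k) i.

(* D_i = L_i *)
Definition D_eq_L i : Prop :=
  forall d : Dalg (qv i), exists! a : L i, d = lact a.

Definition L_eq_k i : Prop := forall a : L i, exists x : k, a = x%:A.

Definition L_is_quadratic i : Prop :=
  \dim {:L i} = 2%N /\
  forall K : fieldExtType k, \dim {:K} = 2%N ->
    exists f : {lrmorphism L i -> K}, bijective f.

Definition restr_id (s : Lbeta T -> Lbeta T) i : Prop :=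
  forall a, @restr s i a = a.
End Quiver.

(* Main.v *)
(* Over k = K((tau)) every element of k^x is a power of tau times an n-th power,
   for all n; this persists in quadratic extensions, since K[[t]] embeds there
   with t^2 = tau.  Kummer theory for the order-n automorphism zeta gives
   F = k[y], zeta y = w y, y^n = d, so A_i is the symbol algebra of (d, b_i) over
   L_i.  As the values of d and b_i are integers, a common eigenvector of two
   commuting monomials in y and theta yields a vector U with S_i = F[b] U.

   This cyclicity replaces the triviality of the Brauer group.  An endomorphism
   of S_i is multiplication by some q in F[b], and averaging q over zeta puts it
   in L_i: hence D_i = L_i.  When sigma = id, an F-bilinear form on S_i for which
   b is self-adjoint is symmetric, as h(p U, q U) = h(p q U, U): hence eps_i = 1
   and eps_e = 1.  Finally theta U = a U with a in F[b] identifies M_i with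
   {x : theta x = a x}, so M_i has finite dimension, V is spanned over F by the
   images of the S_i, and the pairings {,}_i are nondegenerate.

   Vertices are told apart by b_i (or by b_i^2 if L_i is quadratic), xi
   multiplies it by nu (or nu^2) and the involution is b -> gamma / b, so fixed
   vertices and arrows are the solutions of b^2 = gamma and b^2 = gamma / nu (or
   of b^4 = gamma^2 and b^4 = gamma^2 / nu^2) with b^(m/n) = beta. *)
Require Import Defs.
From HB Require Import structures.
From mathcomp Require Import all_boot all_order all_algebra all_fingroup all_field.
From mathcomp Require Import boolp classical_sets functions reals complex.
From mathcomp Require Import ring.

Set Implicit Arguments.
Unset Strict Implicit.
Unset Printing Implicit Defensive.

Import GRing.Theory.
Local Open Scope ring_scope.

(** * Power series and Laurent series *)

(** The polarization, the pairings of simple modules and the form h(u, v) = <u, eta v> of a fixed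
    arrow all obey one rule, h(theta u, theta v) = c0 zeta(h(u, v)), with c0 = c or c0 = c / xi.
    Applied n times, it makes sigma_c0 the adjunction for h; so a fixed arrow is treated as a fixed
    vertex with c / xi in place of c. F may have zero divisors. Arguments by eigenvectors of zeta
    survive because the n-th power of a nonzero eigenvector is a nonzero element of k, so that the
    eigenvector is a unit. Which fixed points exist is a question of signs. With N = m/n even,
    nu^(N/2) = -1 puts opposite signs into the conditions for vertices and for arrows. With N odd, a
    power of nu is a square root of nu whose N-th power is 1, and each kind occurs once. *)

Section PseriesRoots.
Import Num.Theory.
Variable K : numClosedFieldType.
Implicit Types (u w x y : pseries K) (p q : {poly K}).

Lemma ps_trunc_coef N x j : (j < N)%N -> (ps_trunc N x)`_j = pscoef x j.
Proof. by move=> jN; rewrite coef_poly jN. Qed.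

Lemma pscoefM N x y j : (j < N)%N ->
  pscoef (x * y) j = (ps_trunc N x * ps_trunc N y)`_j.
Proof. exact: ps_mulE. Qed.

Lemma coefM_eq N (p q p' q' : {poly K}) :
  (forall j, (j < N)%N -> p`_j = p'`_j) -> (forall j, (j < N)%N -> q`_j = q'`_j) ->
  forall j, (j < N)%N -> (p * q)`_j = (p' * q')`_j.
Proof.
move=> pp qq j jN; rewrite !coefM; apply: eq_bigr => i _.
have iN : (i < N)%N by apply: leq_ltn_trans jN; rewrite -ltnS.
by rewrite pp // qq // (leq_ltn_trans (leq_subr _ _)).
Qed.

Lemma pscoefXn N x n j : (j < N)%N ->
  pscoef (x ^+ n) j = ((ps_trunc N x) ^+ n)`_j.
Proof.
elim: n j => [|n IH] j jN; first by rewrite !expr0 coef1 /=; case: eqP.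
rewrite !exprS (pscoefM _ _ jN); apply: (coefM_eq _ _ jN) => // i iN.
by rewrite ps_trunc_coef // IH.
Qed.

(** Newton's linear term: [(p + c X^m)^n - p^n] is [c X^m] times a cofactor, and degree [m] sees
    only the constant term [n p_0^(n-1)] of that cofactor. *)
Lemma coef_exprDXn p c m n j : (0 < m)%N -> (j <= m)%N ->
  ((p + c *: 'X^m) ^+ n)`_j =
  (p ^+ n)`_j + (c *+ (j == m)) * (p`_0 ^+ n.-1 *+ n).
Proof.
move=> m0 jm.
rewrite -[(p + _) ^+ n](subrK (p ^+ n)) coefD addrC; congr (_ + _).
rewrite subrXX [X in (X - p) * _]addrC addrK -scalerAl coefZ coefXnM ltnNge.
case: (ltngtP j m) jm => // [jm|->] _ /=; first by rewrite mulr0 mul0r.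
rewrite subnn mulr1n -horner_coef0 horner_sum; congr (_ * _).
transitivity (\sum_(i < n) p`_0 ^+ n.-1); last by rewrite sumr_const card_ord.
apply: eq_bigr => i _; rewrite hornerM !horner_exp hornerD hornerZ hornerXn.
rewrite -horner_coef0 expr0n (gtn_eqF m0) mulr0 addr0 -exprD; congr (_ ^+ _).
by case: n i => [[]|n i] //=; rewrite ?subSS subnK // -ltnS.
Qed.

(** Hensel lifting by one degree at a time: the defect in degree [m] is divided by [n r^(n-1)], the
    derivative of the n-th power at the constant term [r]. *)
Fixpoint ps_root_approx n u (r : K) m : {poly K} :=
  if m is m'.+1 then
    let p := ps_root_approx n u r m' in
    p + ((pscoef u m - (p ^+ n)`_m) / (r ^+ n.-1 *+ n)) *: 'X^m
  else r%:P.

Lemma ps_root_exists n u : (0 < n)%N -> pscoef u 0 != 0 ->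
  exists w, w ^+ n = u.
Proof.
move=> n0 u0; pose r := n.-root (pscoef u 0).
have rn : r ^+ n = pscoef u 0 by apply: rootCK.
have r0 : r != 0 by apply: contraNneq u0 => r0; rewrite -rn r0 expr0n (gtn_eqF n0).
pose a := ps_root_approx n u r.
have a0 m : (a m)`_0 = r.
  elim: m => [|m IH]; first by rewrite coefC.
  by rewrite /a /= coefD IH coefZ coefXn mulr0 addr0.
have an m j : (j <= m)%N -> (a m ^+ n)`_j = pscoef u j.
  elim: m j => [|m IH] j; first by rewrite leqn0 => /eqP ->; rewrite -polyC_exp coefC rn.
  move=> jm; rewrite {1}/a /= coef_exprDXn //= -/a a0.
  move: jm; rewrite leq_eqVlt ltnS => /orP[/eqP ->|jm].
    rewrite eqxx mulr1n divfK ?subrKC //.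
    by rewrite -mulr_natr mulf_neq0 ?expf_neq0 // pnatr_eq0 -lt0n.
  by rewrite ltn_eqF ?ltnS // mulr0n mul0r addr0 IH.
have ac m j : (j <= m)%N -> (a m)`_j = (a j)`_j.
  elim: m => [|m IH]; first by rewrite leqn0 => /eqP ->.
  rewrite leq_eqVlt ltnS => /orP[/eqP -> //|jm].
  by rewrite {1}/a /= coefD IH // coefZ coefXn ltn_eqF ?ltnS // mulr0 addr0.
(* Coefficient [j] is frozen from stage [j] on, so the diagonal is the limit of the
   approximations. *)
exists (PSeries (fun m => (a m)`_m)); apply: psP => m.
rewrite (@pscoefXn m.+1) // -(an m m) //; set w := ps_trunc _ _.
suff wa n' j : (j < m.+1)%N -> (w ^+ n')`_j = (a m ^+ n')`_j by apply: wa.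
elim: n' j => [|n' IH] j jm; first by rewrite !expr0.
rewrite !exprS; apply: (@coefM_eq m.+1) => // i im.
by rewrite ps_trunc_coef //= (ac m).
Qed.

Definition ps_X : pseries K := PSeries (fun n => (n == 1)%:R).

Lemma ps_XM x j : pscoef (ps_X * x) j = if j is j'.+1 then pscoef x j' else 0.
Proof.
rewrite -[LHS]/(\sum_(i < j.+1) _) big_ord_recl /= mul0r add0r.
case: j => [|j]; first by rewrite big_ord0.
rewrite big_ord_recl /= mul1r big1 ?addr0 //; first by rewrite /bump subSS subn0.
by move=> i _; rewrite mul0r.
Qed.

Lemma ps_XnM m x j :
  pscoef (ps_X ^+ m * x) j = if (j < m)%N then 0 else pscoef x (j - m).
Proof.
elim: m j => [|m IH] j; first by rewrite mul1r subn0.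
by rewrite exprS -mulrA ps_XM; case: j => [|j] //; rewrite IH ltnS subSS.
Qed.

Lemma ps_X_neq0 : ps_X != 0.
Proof.
by apply/eqP => /(congr1 (fun x => pscoef x 1)) /= /eqP; rewrite oner_eq0.
Qed.

Lemma ps_unitX x : x != 0 -> exists2 u, pscoef u 0 != 0 & x = ps_X ^+ ps_ord x * u.
Proof.
move=> /ps_neq0 x0; rewrite /ps_ord; case: pselect => // {}x0.
case: ex_minnP => m xm mmin; exists (PSeries (fun j => pscoef x (j + m))) => //=.
apply: psP => j; rewrite ps_XnM; case: ltnP => [jm|mj] /=; last by rewrite subnK.
by apply/eqP; apply: contraTT jm => /mmin; rewrite -leqNgt.
Qed.

Lemma ps_ordXM m u : pscoef u 0 != 0 -> ps_ord (ps_X ^+ m * u) = m.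
Proof.
move=> u0; rewrite /ps_ord; case: pselect => [x0|[]]; last first.
  by exists m; rewrite ps_XnM ltnn subnn.
case: ex_minnP => j; rewrite ps_XnM; case: ltnP => [|mj xj /(_ m)]; first by rewrite eqxx.
by rewrite ps_XnM ltnn subnn => /(_ u0) jm; apply/eqP; rewrite eqn_leq jm.
Qed.

Lemma pscoefM0 x y : pscoef (x * y) 0 = pscoef x 0 * pscoef y 0.
Proof. by rewrite -[LHS]/(\sum_(i < 1) _) big_ord1. Qed.

Lemma ps_ordM x y : x != 0 -> y != 0 -> ps_ord (x * y) = (ps_ord x + ps_ord y)%N.
Proof.
move=> /ps_unitX[u u0 {1}->] /ps_unitX[w w0 {1}->].
by rewrite mulrACA -exprD ps_ordXM // pscoefM0 mulf_neq0.
Qed.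

End PseriesRoots.

(** All that the cyclicity of simple modules needs from the valuation. One [t] serves every [n], and
    the exponent can be natural because negative powers are absorbed into [w]. *)
Definition root_uniform (L : fieldType) : Prop :=
  exists2 t : L, t != 0 &
  forall n a, (0 < n)%N -> a != 0 -> exists v w, a = t ^+ v * w ^+ n.

(** [val_tau] reads a chosen representative of the fraction, so a value can be computed only after
    writing [x] with the numerator and denominator of that very representative. *)
Lemma tofrac_ratio (R : idomainType) (x : {fraction R}) :
  x = tofrac (\n_(generic_quotient.repr x)) / tofrac (\d_(generic_quotient.repr x)).
Proof.
rewrite -{1}[x]generic_quotient.reprK; set r := generic_quotient.repr x.
rewrite -[tofrac _ / _]/(FracField.mul _ (FracField.inv _)).
rewrite !generic_quotient.piE; apply/generic_quotient.eqmodP.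
rewrite /= /FracField.equivf /FracField.mulf /FracField.invf.
rewrite !numden_Ratio ?mulf_neq0 ?oner_neq0 ?denom_ratioP //.
by rewrite mulr1 mul1r mulrC.
Qed.

Lemma rmorph_sqrtM (R R' : comNzRingType) (f : {rmorphism R -> R'}) s a b c d t :
  s ^+ 2 = f t ->
  f (a * c + t * (b * d)) + f (a * d + b * c) * s = (f a + f b * s) * (f c + f d * s).
Proof. by move=> st; rewrite !rmorphD !rmorphM -st; ring. Qed.

Section Laurent.
Import Num.Theory.
Variable K : numClosedFieldType.
Local Notation k := (laurent K).
Local Notation tau := (tofrac (ps_X K)).

Lemma tau_neq0 : tau != 0 :> k.
Proof. by rewrite tofrac_eq0 ps_X_neq0. Qed.

Lemma laurent_neq0 (x : k) : x != 0 ->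
  exists f g, [/\ f != 0, g != 0, x = tofrac f / tofrac g &
    val_tau x = (ps_ord f)%:Z - (ps_ord g)%:Z].
Proof.
move=> x0; exists (\n_(generic_quotient.repr x)), (\d_(generic_quotient.repr x)).
split; rewrite ?denom_ratioP //; last exact: tofrac_ratio.
by apply: contraNneq x0 => n0; rewrite (tofrac_ratio x) n0 tofrac0 mul0r.
Qed.

Lemma laurent_root n (x : k) : (0 < n)%N -> x != 0 ->
  exists v w, x = tau ^+ v * w ^+ n.
Proof.
move=> n0 /laurent_neq0[f [g [f0 g0 -> _]]].
have [u u0 {1}->] := ps_unitX f0; have [w w0 {1}->] := ps_unitX g0.
have [r <-] := ps_root_exists n0 u0; have [s <-] := ps_root_exists n0 w0.
have t0 := tau_neq0.
(* The exponent ord f - ord g is raised by n ord g to become natural; the power of tau in the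
   denominator of the root compensates. *)
exists (ps_ord f + ps_ord g * n.-1)%N, (tofrac r / (tofrac s * tau ^+ ps_ord g)).
rewrite !tofracM !tofracXn expr_div_n exprMn -!exprM exprD.
have -> : (ps_ord g * n = ps_ord g * n.-1 + ps_ord g)%N by rewrite -mulnSr prednK.
have h : tau ^+ (ps_ord g * n.-1) != 0 by rewrite expf_neq0.
rewrite exprD !invfM; move: (tau ^+ (_ * _)) h => B B0.
by rewrite -[LHS]mulr1 -(mulfV B0); ring.
Qed.

Lemma laurent_root_uniform : root_uniform k.
Proof. by exists tau => [|n x]; [exact: tau_neq0 | exact: laurent_root]. Qed.

(** Units of K[[tau]] have square roots, so only ord f - ord g matters, and its parity is that of
    ord f + ord g. *)
Lemma odd_val_nonsquare (x : k) : x != 0 ->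
  odd `|val_tau x|%N <-> (forall y : k, y ^+ 2 != x).
Proof.
move=> /laurent_neq0[f [g [f0 g0 -> ->]]].
have -> : odd `|((ps_ord f)%:Z - (ps_ord g)%:Z)%R|%N = odd (ps_ord f + ps_ord g).
  by case: (leqP (ps_ord g) (ps_ord f)) => h;
     rewrite ?(distnEl h) ?(distnEr (ltnW h)) oddB ?(ltnW h) // oddD // addbC.
split=> [|sq].
  move=> oddfg y; apply/eqP => ye.
  have y0 : y != 0.
    apply/eqP => y0; move/eqP: ye.
    by rewrite y0 expr0n eq_sym mulf_eq0 invr_eq0 !tofrac_eq0 (negPf f0) (negPf g0).
  have [a [b [a0 b0 yE _]]] := laurent_neq0 y0.
  have : a ^+ 2 * g = b ^+ 2 * f.
    apply/eqP; rewrite -tofrac_eq (tofracM (a ^+ 2)) (tofracM (b ^+ 2)) !tofracXn.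
    move: ye; rewrite yE expr_div_n => /eqP.
    by rewrite eqr_div ?expf_neq0 ?tofrac_eq0 // mulrC [X in _ == X]mulrC.
  rewrite !expr2 => /(congr1 (@ps_ord _)); rewrite !ps_ordM ?mulf_neq0 //.
  move=> /(congr1 odd); rewrite !oddD !addbb /=.
  by move: oddfg; rewrite oddD => /[swap] ->; rewrite addbb.
case: (boolP (odd _)) => // ev; case: notF.
have [u u0 fE] := ps_unitX f0; have [w w0 gE] := ps_unitX g0.
have [r rE] := ps_root_exists (ltn0Sn 1) u0.
have [s sE] := ps_root_exists (ltn0Sn 1) w0.
have := sq (tau ^+ (ps_ord f + ps_ord g)./2 * tofrac r / (tofrac s * tau ^+ ps_ord g)).
rewrite expr_div_n !exprMn -!exprM muln2 halfK (negPf ev) subn0 -!tofracXn rE sE.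
move=> /eqP[]; apply/eqP; have w'0 : w != 0.
  by apply: contraNneq w0 => ->; rewrite /= ?if_same.
rewrite -!tofracM eqr_div ?tofrac_eq0 ?mulf_neq0 ?expf_neq0 ?ps_X_neq0 //.
rewrite -!tofracM tofrac_eq; move: (ps_ord f) (ps_ord g) fE gE => a b -> ->.
by apply/eqP; rewrite muln2 -addnn !exprD; ring.
Qed.
(** In x(t) = even(t^2) + t odd(t^2) the two halves are the coordinates of K[[t]] over K[[tau]],
    where t^2 = tau. *)
Definition ps_even (x : pseries K) := PSeries (fun j => pscoef x j.*2).
Definition ps_odd (x : pseries K) := PSeries (fun j => pscoef x j.*2.+1).

Lemma sum_double (F : nat -> K) n :
  \sum_(j < n.*2) F j = \sum_(i < n) F i.*2 + \sum_(i < n) F i.*2.+1.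
Proof.
elim: n => [|n IH]; first by rewrite !big_ord0 addr0.
by rewrite doubleS !big_ord_recr /= IH -!addrA; congr (_ + _); rewrite addrCA.
Qed.

Lemma ps_evenM x y :
  ps_even (x * y) = ps_even x * ps_even y + ps_X K * (ps_odd x * ps_odd y).
Proof.
apply: psP => n.
rewrite -[RHS]/(pscoef (ps_even x * ps_even y) n + pscoef (ps_X K * _) n) ps_XM.
rewrite -[LHS]/(\sum_(j < n.*2.+1) pscoef x j * pscoef y (n.*2 - j)).
rewrite big_ord_recr (sum_double (fun j => pscoef x j * pscoef y (n.*2 - j))) /=.
rewrite addrAC; congr (_ + _).
  rewrite [RHS]big_ord_recr /= !subnn; congr (_ + _).
  by apply: eq_bigr => i _; rewrite doubleB.
case: n => [|n]; first by rewrite big_ord0.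
apply: eq_bigr => i _ /=; congr (_ * pscoef y _).
by rewrite doubleS subSS doubleB subSn // leq_double -ltnS.
Qed.

Lemma ps_oddM x y : ps_odd (x * y) = ps_even x * ps_odd y + ps_odd x * ps_even y.
Proof.
apply: psP => n.
rewrite -[LHS]/(\sum_(j < n.+1.*2) pscoef x j * pscoef y (n.*2.+1 - j)).
rewrite (sum_double (fun j => pscoef x j * pscoef y (n.*2.+1 - j))).
congr (_ + _); apply: eq_bigr => i _ /=; congr (_ * pscoef y _).
  by rewrite doubleB subSn // leq_double -ltnS.
by rewrite subSS doubleB.
Qed.

Section Quadratic.
Variables (L : fieldExtType k) (s : L).
Hypothesis s2 : s ^+ 2 = in_alg L tau.

(** The substitution t -> s for s^2 = tau; the even-odd splitting makes it algebraic, with no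
    convergence in L to discuss. *)
Definition ps_eval (x : pseries K) : L :=
  in_alg L (tofrac (ps_even x)) + in_alg L (tofrac (ps_odd x)) * s.

Lemma ps_evalM x y : ps_eval (x * y) = ps_eval x * ps_eval y.
Proof.
rewrite /ps_eval ps_evenM ps_oddM !tofracD !tofracM.
exact: rmorph_sqrtM s2.
Qed.

Lemma ps_evalX : ps_eval (ps_X K) = s.
Proof.
rewrite /ps_eval; have -> : ps_even (ps_X K) = 0.
  by apply: psP => n /=; rewrite if_same; case: n.
have -> : ps_odd (ps_X K) = 1 by apply: psP => -[].
by rewrite tofrac0 tofrac1 rmorph0 rmorph1 add0r mul1r.
Qed.

Lemma ps_eval1 : ps_eval 1 = 1.
Proof.
rewrite /ps_eval; have -> : ps_odd 1 = 0.
  by apply: psP => n /=; rewrite if_same.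
have -> : ps_even 1 = 1 by apply: psP => -[].
by rewrite tofrac0 tofrac1 rmorph0 rmorph1 mul0r addr0.
Qed.

Lemma ps_evalXn x n : ps_eval (x ^+ n) = ps_eval x ^+ n.
Proof.
by elim: n => [|n IH]; rewrite ?expr0 ?ps_eval1 // !exprS ps_evalM IH.
Qed.

(** After clearing denominators, an element of L is the value at [s] of a power series, hence a
    power of [s] times an n-th power; the denominator lies in k, where tau = s^2 is available. *)
Lemma quadratic_root_uniform :
  (forall a : L, exists x y : k, a = in_alg L x + in_alg L y * s) -> root_uniform L.
Proof.
move=> Lxy; have s0 : s != 0.
  apply/eqP => s0; have /eqP := s2.
  by rewrite s0 expr0n eq_sym fmorph_eq0 (negPf tau_neq0).
exists s => // n a n0 a0; have [x [y aE]] := Lxy a.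
have xE := tofrac_ratio x; have yE := tofrac_ratio y.
have dx0 := denom_ratioP (generic_quotient.repr x).
have dy0 := denom_ratioP (generic_quotient.repr y).
move: (_.1) (_.2) dx0 xE (_.1) (_.2) dy0 yE => f h h0 xE g l l0 yE.
have hl0 : h * l != 0 by rewrite mulf_neq0.
have [h1 l1] : tofrac h != 0 /\ tofrac l != 0 by rewrite !tofrac_eq0.
(* Over the common denominator [h l], the rational part fills the even degrees and the coefficient
   of [s] the odd ones. *)
pose F := PSeries (fun j => if odd j then pscoef (g * h) j./2 else pscoef (f * l) j./2).
have aF : in_alg L (tofrac (h * l)) * a = ps_eval F.
  have evF : ps_even F = f * l by apply: psP => j /=; rewrite odd_double doubleK.
  have odF : ps_odd F = g * h.
    by apply: psP => j /=; rewrite odd_double /= uphalf_double.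
  rewrite /ps_eval evF odF aE mulrDr mulrA -!rmorphM; congr (in_alg L _ + in_alg L _ * _).
    by rewrite xE tofracM [RHS]tofracM mulrC mulrA divfK.
  by rewrite yE tofracM [RHS]tofracM mulrC [tofrac h * tofrac l]mulrC mulrA divfK.
have F0 : F != 0.
  apply: contraNneq a0 => F0; move: aF; rewrite F0 /ps_eval.
  have -> : ps_even 0 = 0 by apply: psP => j /=; rewrite ?if_same.
  have -> : ps_odd 0 = 0 by apply: psP => j /=; rewrite ?if_same.
  rewrite tofrac0 rmorph0 mul0r addr0 => /eqP.
  by rewrite mulf_eq0 fmorph_eq0 tofrac_eq0 (negPf hl0).
have [W W0 FE] := ps_unitX F0; have [r rE] := ps_root_exists n0 W0.
have tl0 : tofrac (h * l) != 0 by rewrite tofrac_eq0.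
have [v [w hlE]] := laurent_root n0 tl0.
move: aF; rewrite FE ps_evalM ps_evalXn ps_evalX -rE ps_evalXn hlE.
have w0 : w != 0.
  by apply: contraNneq tl0 => w0; rewrite hlE w0 expr0n (gtn_eqF n0) mulr0.
have -> : in_alg L (tau ^+ v * w ^+ n) = s ^+ (2 * v) * in_alg L w ^+ n.
  by rewrite rmorphM !rmorphXn exprM s2.
have w1 : in_alg L w != 0 by rewrite fmorph_eq0.
move: (in_alg L w) w1 (ps_eval r) (ps_ord F) => w' w'0 r' m aF.
(* The true exponent m - 2v, raised by 2vn to stay natural. *)
exists (m + 2 * v * n.-1)%N, (r' / (s ^+ (2 * v) * w')).
apply: (mulfI (_ : s ^+ (2 * v) * w' ^+ n != 0)); first by rewrite mulf_neq0 ?expf_neq0.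
rewrite aF exprD expr_div_n exprMn -!exprM.
have -> : (2 * v * n = 2 * v * n.-1 + 2 * v)%N by rewrite -mulnSr prednK.
rewrite exprD; have: s ^+ (2 * v * n.-1) != 0 by rewrite expf_neq0.
have: s ^+ (2 * v) != 0 by rewrite expf_neq0.
have: w' ^+ n != 0 by rewrite expf_neq0.
move: (w' ^+ n) (s ^+ (2 * v * _)) (s ^+ (2 * v)) => A B C' A0 C0 B0.
by move: (s ^+ _) (r' ^+ n) => G H; field; rewrite A0 B0 C0.
Qed.
End Quadratic.

(** Modulo squares, the only possible classes are 1 and tau; hence there is only one quadratic
    extension. *)
Lemma nonsquareE (u : k) : (forall z : k, z ^+ 2 != u) ->
  exists2 z, z != 0 & u = z ^+ 2 * tau.
Proof.
move=> uN; have u0 : u != 0.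
  by apply: contraTneq (uN 0) => ->; rewrite expr0n negbK.
have [v [w uE]] := laurent_root (ltn0Sn 1) u0.
have: u = tau ^+ odd v * (tau ^+ v./2 * w) ^+ 2.
  by rewrite uE -{1}(odd_double_half v) exprD -muln2 exprM exprMn [RHS]mulrA.
case: (odd v) => [uE'|uE']; last first.
  by move: (uN (tau ^+ v./2 * w)); rewrite uE' mul1r eqxx.
exists (tau ^+ v./2 * w); last by rewrite {1}uE' mulrC.
by apply: contraNneq u0 => w0; rewrite uE' w0 expr0n mulr0.
Qed.

Lemma nonsquare_ratio (x y : k) : (forall z, z ^+ 2 != x) -> (forall z, z ^+ 2 != y) ->
  exists2 z, z != 0 & x = z ^+ 2 * y.
Proof.
move=> /nonsquareE[a a0 ->] /nonsquareE[c c0 ->].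
by exists (a / c); rewrite ?mulf_neq0 ?invr_eq0 // expr_div_n mulrA divfK // expf_neq0.
Qed.
End Laurent.

(** * Kummer theory of F / k *)

Section Kummer.
Variables (k : fieldType) (T : twdata k) (w : k).
Local Notation n := (tn T).
Local Notation zeta := (@tzeta k T).
Hypothesis w_prim : n.-primitive_root w.
Hypothesis n_neq0 : n%:R != 0 :> k.

Lemma sum_unity_root (L : fieldType) r (x : L) : x ^+ r = 1 ->
  \sum_(s < r) x ^+ s = if x == 1 then r%:R else 0.
Proof.
move=> xr; case: eqP => [->|/eqP x1].
  by under eq_bigr do rewrite expr1n; rewrite sumr_const card_ord.
by apply: (mulfI (_ : x - 1 != 0)); rewrite ?subr_eq0 // mulr0 -subrX1 xr subrr.
Qed.

Lemma w_expr_eq1 j : (w^-1 ^+ j == 1) = (n %| j)%N.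
Proof. by rewrite exprVn invr_eq1 -(prim_order_dvd w_prim). Qed.

Lemma sum_w j : \sum_(s < n) w^-1 ^+ (s * j) = if (n %| j)%N then n%:R else 0.
Proof.
under eq_bigr do rewrite mulnC exprM.
rewrite sum_unity_root ?w_expr_eq1 // -exprM mulnC exprM exprVn.
by rewrite (prim_expr_order w_prim) invr1 expr1n.
Qed.

Lemma tzetaZ (x : k) (a : T) : zeta (x *: a) = x *: zeta a.
Proof. by rewrite -mulr_algl rmorphM /= tzeta_k mulr_algl. Qed.

Lemma iter_zeta_rmorph j : exists f : {rmorphism T -> T}, f =1 iter j zeta.
Proof.
elim: j => [|j [f fE]]; first by exists idfun.
by exists (zeta \o f) => a /=; rewrite fE.
Qed.

Lemma iter_zetaZ j (x : k) (a : T) : iter j zeta (x *: a) = x *: iter j zeta a.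
Proof. by elim: j => //= j ->; rewrite tzetaZ. Qed.

Lemma iter_zetaM j (a b : T) : iter j zeta (a * b) = iter j zeta a * iter j zeta b.
Proof. by have [f fE] := iter_zeta_rmorph j; rewrite -!fE rmorphM. Qed.

Lemma tF_reduced (a : T) r : a ^+ r = 0 -> a = 0.
Proof.
have [m [E [f [_ fK]]]] := tF_separable T.
move=> ar; have [x [_ xU]] := fK (fun=> 0).
rewrite -[RHS](xU 0) => [|j]; last exact: rmorph0.
apply/esym/xU => j; apply/eqP; have /eqP := congr1 (f j) ar.
by rewrite rmorphXn rmorph0 expf_eq0 => /andP[].
Qed.

(** The Lagrange resolvent: n times the projection of F onto the [w^s]-eigenspace of zeta. *)
Definition tproj s (a : T) : T := \sum_(j < n) w^-1 ^+ (s * j) *: iter j zeta a.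

Lemma tprojE s a : zeta (tproj s a) = w ^+ s *: tproj s a.
Proof.
have w0 : w != 0 by rewrite (prim_root_eq0 w_prim) gtn_eqF ?tn_gt0.
rewrite /tproj rmorph_sum scaler_sumr /=.
have [m nE] : exists m, n = m.+1 by exists n.-1; rewrite prednK ?tn_gt0.
have wn : w ^+ n = 1 := prim_expr_order w_prim.
have zn := tzeta_order (t := T).
rewrite nE in wn zn *.
rewrite big_ord_recr [RHS]big_ord_recl addrC /=; congr (_ + _); last first.
  rewrite tzetaZ -iterS zn muln0 expr0 scale1r exprVn mulnC exprM.
  apply/(scalerI (_ : (w ^+ m) ^+ s != 0)); rewrite ?expf_neq0 // !scalerA.
  by rewrite mulfV ?expf_neq0 // -exprMn -exprSr wn expr1n.
apply: eq_bigr => j _; rewrite tzetaZ scalerA /bump /=; congr (_ *: _).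
by rewrite mulnDr muln1 exprD mulrA -exprMn mulfV // expr1n mul1r.
Qed.

Lemma sum_tproj a : \sum_(s < n) tproj s a = n%:R *: a.
Proof.
rewrite /tproj exchange_big /= (bigD1 (Ordinal (tn_gt0 T))) //= [X in _ + X]big1 ?addr0.
  by rewrite -scaler_suml sum_w dvdn0.
move=> j j0; rewrite -scaler_suml sum_w.
have j1 : (0 < j)%N by rewrite lt0n; apply: contraNneq j0 => j0; apply/eqP/val_inj.
by rewrite ifN ?scale0r //; apply/negP => /(dvdn_leq j1); rewrite leqNgt ltn_ord.
Qed.

(** [x^n] is fixed by zeta, so it lies in k, and it is nonzero because F is reduced. *)
Lemma eigen_unit s (x : T) : zeta x = w ^+ s *: x -> x != 0 ->
  x \is a GRing.unit.
Proof.
move=> xs x0; have: zeta (x ^+ n) = x ^+ n.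
  by rewrite rmorphXn /= xs exprZn -exprM mulnC exprM (prim_expr_order w_prim) expr1n scale1r.
case/tzeta_fixed => d xd; have d0 : d != 0.
  by apply: contraNneq x0 => d0; apply/eqP/(@tF_reduced _ n); rewrite xd d0 scale0r.
rewrite -(unitrX_pos _ (tn_gt0 T)) xd -mulr_algl mulr1.
by apply/unitrP; exists d^-1%:A; rewrite !mulr_algl !scalerA mulVf ?mulfV // scale1r.
Qed.

(* The set of those s whose w^s-eigenspace is nonzero is a subgroup of Z / n;
   it is everything because zeta has order exactly n. *)
Lemma kummer_generator : exists y : T,
  [/\ y \is a GRing.unit, zeta y = w *: y & exists d : k, y ^+ n = d%:A].
Proof.
pose G s := `[< (0 < s)%N /\ exists2 x : T, x != 0 & zeta x = w ^+ s *: x >].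
have wn := prim_expr_order w_prim.
have Gn : G n.
  by apply/asboolP; split; rewrite ?tn_gt0 //; exists 1; rewrite ?oner_eq0 // rmorph1 wn scale1r.
have exG : exists s, G s by exists n.
case: (ex_minnP exG) => s /asboolP[s0 [y y0 ys]] smin.
have yU := eigen_unit ys y0.
have dvd_s t (x : T) : x != 0 -> zeta x = w ^+ t *: x -> (s %| t)%N.
  move=> x0 xt; rewrite /dvdn; apply/negPn/negP => ts0.
  have: G (t %% s)%N; last first.
    by move/smin; rewrite leqNgt ltn_mod s0.
  apply/asboolP; split; first by rewrite lt0n.
  exists (x / y ^+ (t %/ s)).
    apply: contraNneq x0 => /(congr1 ( *%R^~ (y ^+ (t %/ s)))).
    by rewrite mul0r divrK ?unitrX // => ->.
  rewrite rmorphM rmorphV ?unitrX // rmorphXn /= xt ys exprZn -exprM.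
  have w0 : w != 0 by rewrite (prim_root_eq0 w_prim) gtn_eqF ?tn_gt0.
  rewrite invrZ ?unitrX ?unitfE // -scalerAr -scalerAl scalerA; congr (_ *: _).
  have -> : w ^+ t = w ^+ (t %/ s * s) * w ^+ (t %% s) by rewrite -exprD -divn_eq.
  by rewrite [(s * _)%N]mulnC mulKf ?expf_neq0.
(* If every eigenvalue is a power of [w^s], then zeta^(n/s) is the identity, and minimality of the
   order n leaves s = 1. *)
have sn : (s %| n)%N by apply: (@dvd_s n 1); rewrite ?oner_eq0 // rmorph1 wn scale1r.
have per a : iter (n %/ s) zeta a = a.
  apply: (scalerI n_neq0); rewrite -iter_zetaZ -sum_tproj.
  have [f fE] := iter_zeta_rmorph (n %/ s); rewrite -fE rmorph_sum; apply: eq_bigr => t _.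
  rewrite fE; have [->|x0] := eqVneq (tproj t a) 0; first by rewrite -fE rmorph0.
  have /dvdnP[q tE] := dvd_s _ _ x0 (tprojE t a).
  have itE r : iter r zeta (tproj t a) = (w ^+ t) ^+ r *: tproj t a.
    by elim: r => [|r IH] /=; rewrite ?scale1r // IH tzetaZ tprojE scalerA exprSr.
  by rewrite itE -exprM tE -mulnA [(s * _)%N]mulnC divnK // mulnC exprM wn expr1n scale1r.
have s1 : s = 1%N.
  apply/eqP; rewrite eqn_leq s0 andbT leqNgt; apply/negP => s1.
  have [|a []] := @tzeta_order_min _ T (n %/ s); last exact: per.
  by rewrite divn_gt0 // dvdn_leq ?tn_gt0 //= ltn_Pdiv ?tn_gt0.
rewrite s1 expr1 in ys; exists y; split=> //.
by apply/tzeta_fixed; rewrite rmorphXn /= ys exprZn wn scale1r.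
Qed.
End Kummer.

(** * The action of F (x) k[b] *)

Section FAction.
Variables (k : fieldType) (T : twdata k).
Implicit Types (U V : twmod T) (p q : {poly T}).
Local Notation n := (tn T).
Local Notation zeta := (@tzeta k T).

(** [X] acts as theta^n, which commutes with F because zeta^n = 1: this is an action of the
    commutative ring F (x) k[b]. *)
Definition eact U q (u : U) : U :=
  \sum_(j < size q) q`_j *: iter (n * j) (@tw_th _ _ U) u.

Lemma eactE U q r (u : U) : (size q <= r)%N ->
  eact q u = \sum_(j < r) q`_j *: iter (n * j) (@tw_th _ _ U) u.
Proof.
move=> le_r; rewrite /eact (big_ord_widen r
  (fun j => q`_j *: iter (n * j) (@tw_th _ _ U) u)) //.
rewrite big_mkcond /=; apply: eq_bigr => j _; case: ltnP => // lej.
by rewrite nth_default // scale0r.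
Qed.

Lemma eactDl U p q (u : U) : eact (p + q) u = eact p u + eact q u.
Proof.
have := size_polyD p q; set r := maxn _ _ => le_r.
rewrite (@eactE _ _ r) // (@eactE _ p r) ?leq_maxl // (@eactE _ q r) ?leq_maxr //.
by rewrite -big_split; apply: eq_bigr => j _; rewrite coefD scalerDl.
Qed.

Lemma eactDr U q (u u' : U) : eact q (u + u') = eact q u + eact q u'.
Proof. by rewrite -big_split; apply: eq_bigr => j _; rewrite iter_thD scalerDr. Qed.

Lemma eact0r U q : eact q (0 : U) = 0.
Proof. by rewrite /eact big1 // => j _; rewrite iter_th0 scaler0. Qed.

Lemma eactC U (a : T) (u : U) : eact a%:P u = a *: u.
Proof. by rewrite (@eactE _ _ 1) ?size_polyC_leq1 // big_ord1 coefC muln0. Qed.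

Lemma eact0l U (u : U) : eact 0 u = 0.
Proof. by rewrite -polyC0 eactC scale0r. Qed.

Lemma eact1 U (u : U) : eact 1 u = u.
Proof. by rewrite -polyC1 eactC scale1r. Qed.

Lemma eact_suml U (I : Type) (r : seq I) (f : I -> {poly T}) (u : U) :
  eact (\sum_(i <- r) f i) u = \sum_(i <- r) eact (f i) u.
Proof. by apply: (big_morph (fun p => eact p u)) => [p q|]; rewrite ?eactDl ?eact0l. Qed.

Lemma eactZ U (a : T) q (u : U) : eact (a *: q) u = a *: eact q u.
Proof.
rewrite (@eactE _ _ (size q)) ?size_scale_leq // scaler_sumr.
by apply: eq_bigr => j _; rewrite coefZ scalerA.
Qed.

Lemma eact_iter U q r (u : U) :
  iter r (@tw_th _ _ U) (eact q u) =
  eact (map_poly (iter r zeta) q) (iter r (@tw_th _ _ U) u).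
Proof.
have [f fE] := @iter_zeta_rmorph _ T r.
have -> : map_poly (iter r zeta) q = map_poly f q by apply: eq_map_poly => a; rewrite fE.
rewrite iter_th_sum (@eactE _ _ (size q)) ?size_poly //; apply: eq_bigr => j _.
by rewrite iter_thZ coef_map /= fE -!iterD addnC.
Qed.

Lemma eact_th U q (u : U) : tw_th (eact q u) = eact (map_poly zeta q) (tw_th u).
Proof. exact: (eact_iter q 1). Qed.

Lemma map_poly_id_fun (q : {poly T}) (f : T -> T) : f =1 id -> map_poly f q = q.
Proof. by move=> fE; apply: map_poly_id => a _; rewrite fE. Qed.

Lemma eactMX U q (u : U) : eact (q * 'X) u = eact q (iter n (@tw_th _ _ U) u).
Proof.
rewrite (@eactE _ _ (size q).+1); last first.
  by rewrite (leq_trans (size_polyMleq _ _)) // size_polyX addn2.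
rewrite big_ord_recl coefMX scale0r add0r; apply: eq_bigr => j _.
by rewrite lift0 coefMX /= mulnS addnC iterD.
Qed.

Lemma eact_iter_n U q r (u : U) :
  iter (n * r) (@tw_th _ _ U) (eact q u) = eact q (iter (n * r) (@tw_th _ _ U) u).
Proof.
by rewrite eact_iter map_poly_id_fun // => a; rewrite iter_zeta_mul.
Qed.

Lemma eactM U p q (u : U) : eact (p * q) u = eact p (eact q u).
Proof.
elim/poly_ind: p u => [u|p c IH u]; first by rewrite mul0r !eact0l.
rewrite mulrDl !eactDl mulrAC !eactMX IH mul_polyC eactZ eactC.
by have := eact_iter_n q 1 u; rewrite muln1 => ->.
Qed.

Lemma eactZr U (a : T) q (u : U) : eact q (a *: u) = a *: eact q u.
Proof. by rewrite -!eactC -!eactM mulrC. Qed.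

Lemma eact_hom U V (f : twhom U V) q (u : U) : f (eact q u) = eact q (f u).
Proof.
rewrite /eact (big_morph f (homD f) (hom0 f)); apply: eq_bigr => j _.
by rewrite homZ; congr (_ *: _); elim: (_ * _)%N => //= r <-; rewrite hom_th.
Qed.

Lemma eact_bact U (p : {poly k}) (u : U) : eact (map_poly (in_alg T) p) u = bact p u.
Proof.
by rewrite (@eactE _ _ (size p)) ?size_poly //; apply: eq_bigr => j _; rewrite coef_map.
Qed.

Lemma th_inj U : injective (@tw_th _ _ U).
Proof.
move=> x y xy; have m0 : (0 < tm T)%N.
  by rewrite lt0n; apply: contraNneq (tN_neq0 T) => ->; rewrite div0n.
have xyE : (tbeta T)%:A *: x = (tbeta T)%:A *: y :> U.
  by rewrite -!tw_thm -(prednK m0) !iterSr xy.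
have bU (z : U) : ((tbeta T)^-1%:A : T) *: ((tbeta T)%:A *: z) = z.
  by rewrite scalerA mulr_algl scalerA mulVf ?tbeta_neq0 // !scale1r.
by rewrite -[x]bU xyE bU.
Qed.

Lemma th_surj U (x : U) : exists y, x = tw_th y.
Proof.
have m0 : (0 < tm T)%N.
  by rewrite lt0n; apply: contraNneq (tN_neq0 T) => ->; rewrite div0n.
exists (iter (tm T).-1 (@tw_th _ _ U) ((tbeta T)^-1%:A *: x)).
rewrite -iterS prednK // tw_thm scalerA mulr_algl scalerA mulfV ?tbeta_neq0 //.
by rewrite !scale1r.
Qed.

Lemma iter_th_neq0 U r (x : U) : x <> 0 -> iter r (@tw_th _ _ U) x <> 0.
Proof. by move=> x0; elim: r => //= r IH /esym; rewrite -{1}(th0 U) => /th_inj/esym. Qed.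

Lemma bact0 U (p : {poly k}) : bact p (0 : U) = 0.
Proof. exact: (hom0 (bact_hom U p)). Qed.

Lemma bact_th U (p : {poly k}) (u : U) : bact p (tw_th u) = tw_th (bact p u).
Proof. exact: (hom_th (bact_hom U p)). Qed.

Lemma bactDr U (p : {poly k}) (u u' : U) : bact p (u + u') = bact p u + bact p u'.
Proof. exact: (homD (bact_hom U p)). Qed.

Lemma bactZr U (p : {poly k}) (a : T) (u : U) : bact p (a *: u) = a *: bact p u.
Proof. exact: (homZ (bact_hom U p)). Qed.

Lemma bactLM U (z z' : Lbeta T) (u : U) : bact (z * z') u = bact z (bact z' u).
Proof. by rewrite bact_mod bactM. Qed.

Lemma algLE (x : k) : (x%:A : Lbeta T) = in_qpoly (Lpoly T) x%:P.
Proof. by rewrite -[x%:P]mulr1 mul_polyC in_qpolyZ in_qpoly1. Qed.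

Lemma bact_alg U (x : k) (u : U) : bact (x%:A : Lbeta T) u = x%:A *: u.
Proof. by rewrite algLE bact_mod bactC. Qed.

Lemma bactX U (u : U) : bact 'X u = iter n (@tw_th _ _ U) u.
Proof. by rewrite -(expr1 'X) bactXn muln1. Qed.

Lemma bact_b U (u : U) : bact (b_ T) u = iter n (@tw_th _ _ U) u.
Proof. by rewrite bact_mod bactX. Qed.

Lemma Lbeta_in (z : Lbeta T) : in_qpoly (Lpoly T) z = z.
Proof. by apply/val_inj/in_qpoly_small; rewrite size_mk_monic. Qed.

Lemma Lbeta_ind (C : Lbeta T -> Prop) :
  (forall x : k, C x%:A) -> (forall z, C z -> C (z * b_ T)) ->
  (forall z z', C z -> C z' -> C (z + z')) -> forall z, C z.
Proof.
move=> Ck Cb CD z; suff H (p : {poly k}) : C (in_qpoly (Lpoly T) p).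
  by rewrite -(Lbeta_in z); apply: H.
elim/poly_ind: p => [|p c IH].
  by rewrite -polyC0 -algLE.
by rewrite raddfD /= -algLE in_qpolyM; apply: CD => //; apply: Cb.
Qed.

Lemma b_exp : b_ T ^+ (tm T %/ tn T) = (tbeta T)%:A.
Proof.
rewrite -[b_ T]/(in_qpoly (Lpoly T) 'X) algLE -(rmorphXn (in_qpoly (Lpoly T))) /=.
apply/eqP; rewrite -subr_eq0 -(raddfB (in_qpoly (Lpoly T))).
apply/eqP/val_inj; rewrite /= mk_monic_Lpoly.
exact: Pdiv.RingMonic.rmodpp (monic_Lpoly T).
Qed.
End FAction.

(** * The action of the field L on a simple module *)

Section Vertex.
Variables (k : fieldType) (T : twdata k) (v : vertex T).
Local Notation n := (tn T).
Local Notation L := (vL v).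
Local Notation S := (vS v).
Local Notation th := (@tw_th _ _ S).
Implicit Types (a c l : L) (u : S).

Lemma vS_neq0 : exists u : S, u <> 0.
Proof. by case: (vS_simple v). Qed.

Lemma lact0r a : lact a (0 : S) = 0.
Proof. exact: hom0. Qed.

Lemma lact0 u : lact (0 : L) u = 0.
Proof. by apply: (addIr (lact 0 u)); rewrite -lactD !add0r. Qed.

Lemma lactC a c u : lact a (lact c u) = lact c (lact a u).
Proof. by rewrite -!lactM mulrC. Qed.

Lemma lact_alg (x : k) u : lact (x%:A : L) u = x%:A *: u.
Proof. by rewrite -(bact_alg x u) -lactE linearZ /= rmorph1. Qed.

Lemma lact_eq0 a u : u <> 0 -> lact a u = 0 -> a = 0.
Proof.
move=> u0 au; apply/eqP/negPn/negP => a0; apply: u0.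
by rewrite -(lact1 u) -(mulVf a0) lactM au lact0r.
Qed.

Lemma lactN a u : lact (- a) u = - lact a u.
Proof. by apply: (addIr (lact a u)); rewrite -lactD !addNr lact0. Qed.

Lemma lact_inj a c u : u <> 0 -> lact a u = lact c u -> a = c.
Proof.
move=> u0 acu; apply/eqP; rewrite -subr_eq0; apply/eqP/(lact_eq0 u0).
by rewrite lactD lactN acu subrr.
Qed.

Lemma lact_sumr (I : Type) (r : seq I) a (f : I -> S) :
  lact a (\sum_(i <- r) f i) = \sum_(i <- r) lact a (f i).
Proof. by apply: (big_morph (lact a)) => [x y|]; rewrite ?homD ?hom0. Qed.

Lemma lact_suml (I : Type) (r : seq I) (f : I -> L) u :
  lact (\sum_(i <- r) f i) u = \sum_(i <- r) lact (f i) u.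
Proof. by apply: (big_morph (fun a => lact a u)) => [x y|]; rewrite ?lactD ?lact0. Qed.

Lemma lact_th a u : lact a (th u) = th (lact a u).
Proof. exact: hom_th. Qed.

Lemma lact_iter a r u : lact a (iter r th u) = iter r th (lact a u).
Proof. by elim: r => [|r IH]; rewrite ?iterS ?lact_th ?IH. Qed.

Lemma lact_b u : lact (vb v) u = iter n th u.
Proof. by rewrite lactE bact_b. Qed.

Lemma lact_eact a u : lact a u = eact (map_poly (in_alg T) (vlift a)) u.
Proof. by rewrite eact_bact. Qed.

Lemma vb_exp : vb v ^+ (tm T %/ tn T) = (tbeta T)%:A.
Proof. by rewrite -rmorphXn b_exp /= rmorph_alg. Qed.

Lemma vb_neq0 : vb v != 0.
Proof.
apply/eqP => b0; have /eqP := vb_exp.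
rewrite b0 expr0n (gtn_eqF (tN_gt0 T)) /= eq_sym scaler_eq0 oner_eq0 orbF.
by rewrite (negPf (tbeta_neq0 T)).
Qed.

(** The operator of the pure tensor a (x) l of F (x) L. *)
Definition pact (a : T) (l : L) (u : S) : S := a *: lact l u.

Lemma pactM (a a' : T) l (l' : L) u : pact a l (pact a' l' u) = pact (a * a') (l * l') u.
Proof. by rewrite /pact homZ scalerA lactM. Qed.

Lemma pact_iter r (a : T) l u : iter r (pact a l) u = pact (a ^+ r) (l ^+ r) u.
Proof.
elim: r => [|r IH]; first by rewrite /pact scale1r lact1.
by rewrite iterS IH pactM !exprS.
Qed.

Lemma pactD (a : T) l u u' : pact a l (u + u') = pact a l u + pact a l u'.
Proof. by rewrite /pact homD scalerDr. Qed.

Lemma pact_lact (a : T) l c u : pact a l (lact c u) = lact c (pact a l u).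
Proof. by rewrite /pact [RHS]homZ lactC. Qed.

(* An operator f with f^r = lam^r on u has an eigenvector in the span of the
   f^i u, as the r eigenprojections of u sum up to r u. *)
Lemma eigenvector (f : S -> S) (r : nat) (lam rho : L) u :
  (forall x y, f (x + y) = f x + f y) -> (forall a x, f (lact a x) = lact a (f x)) ->
  r.-primitive_root rho -> r%:R != 0 :> L -> lam != 0 -> u <> 0 ->
  iter r f u = lact (lam ^+ r) u ->
  exists j u' (c : 'I_r -> L), [/\ u' <> 0, f u' = lact (lam * rho ^+ j) u' &
    u' = \sum_i lact (c i) (iter i f u)].
Proof.
move=> fD fl; case: r => [|r] rhoP r0 lam0 u0 fru; first by rewrite eqxx in r0.
have f0 : f 0 = 0 by apply: (addIr (f 0)); rewrite -fD !add0r.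
have fsum (F : 'I_r.+1 -> S) : f (\sum_i F i) = \sum_i f (F i).
  exact: (big_morph f fD f0).
have rho0 : rho != 0.
  by rewrite (prim_root_eq0 rhoP); apply: contraNneq r0 => ->.
pose c j (i : 'I_r.+1) := (lam * rho ^+ j)^-1 ^+ i.
pose p j := \sum_(i < r.+1) lact (c j i) (iter i f u).
have pE j : f (p j) = lact (lam * rho ^+ j) (p j).
  set m := lam * rho ^+ j; have m0 : m != 0 by rewrite mulf_neq0 ?expf_neq0.
  have mr : m ^+ r.+1 = lam ^+ r.+1.
    by rewrite exprMn -exprM mulnC exprM (prim_expr_order rhoP) expr1n mulr1.
  rewrite /p fsum lact_sumr; under eq_bigr do rewrite fl -iterS.
  under [RHS]eq_bigr do rewrite -lactM.
  rewrite /c -/m big_ord_recr [RHS]big_ord_recl addrC; congr (_ + _); last first.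
    rewrite -[iter _ f u]/(iter r.+1 f u) fru -lactM mulr1 -mr exprSr mulrA.
    by rewrite exprVn mulVf ?mul1r ?expf_neq0.
  by apply: eq_bigr => i _; rewrite lift0 exprSr mulrCA mulfV // mulr1.
have [[j pj]|pN] := pselect (exists j, p j <> 0); first by exists j, (p j), (c j).
have: \sum_(j < r.+1) p j = lact r.+1%:R u.
  rewrite exchange_big /=; under eq_bigr do rewrite -lact_suml.
  rewrite big_ord_recl [X in _ + X]big1 ?addr0 => [|i _].
    by rewrite (eq_bigr (fun=> 1)) ?sumr_const ?card_ord // => j _; rewrite /c expr0.
  have E (j : 'I_r.+1) : c j (lift ord0 i) = lam^-1 ^+ i.+1 * (rho^-1 ^+ i.+1) ^+ j.
    by rewrite /c lift0 invfM exprMn -exprVn -!exprM mulnC.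
  rewrite (eq_bigr _ (fun j _ => E j)) -mulr_sumr sum_unity_root; last first.
    by rewrite -exprM mulnC exprM exprVn (prim_expr_order rhoP) invr1 expr1n.
  rewrite [rho^-1 ^+ _]exprVn invr_eq1 -(prim_order_dvd rhoP) gtnNdvd ?mulr0 ?lact0 //.
  by rewrite ltnS.
rewrite big1 => [/esym/(lact_eq0 u0)/eqP|j _]; first by rewrite (negPf r0).
by apply: contrapT => pj; apply: pN; exists j.
Qed.
End Vertex.

(** * Cyclicity of the simple modules *)

Local Opaque lact.

Section Cyclic.
Variables (k : fieldType) (T : twdata k) (v : vertex T) (w : k) (y : T) (d : k).
Local Notation n := (tn T).
Local Notation zeta := (@tzeta k T).
Local Notation L := (vL v).
Local Notation S := (vS v).
Local Notation th := (@tw_th _ _ S).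
Hypothesis w_prim : n.-primitive_root w.
Hypothesis w_roots : forall r, (0 < r)%N -> exists x : k, x ^+ r = w.
Hypothesis k_char0 : forall r, (0 < r)%N -> r%:R != 0 :> k.
Hypothesis y_unit : y \is a GRing.unit.
Hypothesis y_eigen : zeta y = w *: y.
Hypothesis y_exp : y ^+ n = d%:A.
Hypothesis L_unif : root_uniform L.
Implicit Types (a c l : L) (u : S).

Lemma iter_zeta_y r s : iter r zeta (y ^+ s) = w ^+ (r * s) *: y ^+ s.
Proof.
elim: r => [|r IH]; first by rewrite scale1r.
by rewrite iterS IH tzetaZ rmorphXn /= y_eigen exprZn scalerA -exprD -mulSnr.
Qed.

Lemma scale_lact (x : k) (a : T) u : (x *: a) *: u = lact (x%:A : L) (a *: u).
Proof. by rewrite lact_alg scalerA mulr_algl. Qed.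

Lemma th_pact r s l u :
  iter r th (pact (y ^+ s) l u) = lact ((w ^+ (r * s))%:A : L) (pact (y ^+ s) l (iter r th u)).
Proof. by rewrite /pact iter_thZ iter_zeta_y scale_lact lact_iter. Qed.

Lemma rfactor_neq0 r : (0 < r)%N -> r%:R != 0 :> L.
Proof.
by move=> r0; rewrite -(rmorph_nat (in_alg L)) fmorph_eq0 k_char0.
Qed.

Lemma prim_root_L r : (r %| n)%N -> r.-primitive_root ((w ^+ (n %/ r))%:A : L).
Proof. by move=> rn; rewrite -in_algE fmorph_primitive_root (dvdn_prim_root w_prim). Qed.

Lemma d_neq0 : d != 0.
Proof.
apply/eqP => d0; have: y ^+ n \is a GRing.unit by rewrite unitrX.
by rewrite y_exp d0 scale0r unitr0.
Qed.

Lemma algX (x : k) m : ((x ^+ m)%:A : L) = x%:A ^+ m.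
Proof. exact: (rmorphXn (in_alg L)). Qed.

(* Writing d = y^n and b = theta^n as powers of the uniformizer t of L times
   n-th powers, a monomial z in y has order g = gcd(val d, n), and on each
   eigenspace of z a monomial Y in y and theta^g has Y^(n/g) scalar and equal to
   an (n/g)-th power.  A common eigenvector u0 of z and Y yields the cyclic
   vector \sum_(j < g) theta^j u0. *)
Lemma cyclic_vector : exists2 U : S, U <> 0 & forall u, exists q, u = eact q U.
Proof.
have [t t0 tP] := L_unif; have n0 := tn_gt0 T.
have dL0 : (d%:A : L) != 0 by rewrite -in_algE fmorph_eq0 d_neq0.
have [e [W dE]] := tP n _ n0 dL0; have [f [W2 bE]] := tP n _ n0 (vb_neq0 v).
have W0 : W != 0.
  by apply: contraNneq dL0 => W0; rewrite dE W0 expr0n (gtn_eqF n0) mulr0.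
have W20 : W2 != 0.
  by apply: contraNneq (vb_neq0 v) => W0'; rewrite bE W0' expr0n (gtn_eqF n0) mulr0.
pose g := gcdn e n; have g0 : (0 < g)%N by rewrite gcdn_gt0 n0 orbT.
pose n' := (n %/ g)%N; pose e' := (e %/ g)%N.
have gn : (g %| n)%N by apply: dvdn_gcdr.
have nE : (n' * g = n)%N by rewrite divnK.
have eE : (e' * g = e)%N by rewrite divnK ?dvdn_gcdl.
have n'0 : (0 < n')%N by rewrite divn_gt0 // dvdn_leq.
have n'n : (n' %| n)%N by rewrite -nE dvdn_mulr.
have cop : gcdn n' e' = 1%N.
  by apply/eqP; rewrite -(eqn_pmul2r g0) muln_gcdl nE eE mul1n gcdnC.
(* Normalized so that z^g = y^n / (t^e W^n) = 1. *)
pose z := pact (y ^+ n') (W^-1 ^+ n' * t^-1 ^+ e') : S -> S.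
have zD x x' : z (x + x') = z x + z x' by rewrite /z pactD.
have zl a x : z (lact a x) = lact a (z x) by rewrite /z pact_lact.
have zg x : iter g z x = x.
  rewrite /z pact_iter -exprM nE exprMn -!exprM nE eE /pact y_exp -lact_alg -lactM.
  by rewrite dE [t ^+ e * _]mulrC mulrACA -!exprMn !mulfV // !expr1n mul1r lact1.
pose rho : L := (w ^+ n')%:A.
have rhoP : g.-primitive_root rho.
  by have := prim_root_L gn.
have rho0 : rho != 0 by rewrite (prim_root_eq0 rhoP) gtn_eqF.
have zth r x : iter r th (z x) = lact (rho ^+ r) (z (iter r th x)).
  by rewrite /z th_pact mulnC exprM -in_algE rmorphXn.
have zth' r x : z (iter r th x) = lact (rho^-1 ^+ r) (iter r th (z x)).
  by rewrite zth -lactM -exprMn mulVf // expr1n lact1.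
(* Each application of theta divides the z-eigenvalue by [rho], so shifting an eigenvector by
   theta^j reaches eigenvalue 1. *)
have [u2 u20 zu2] : exists2 x : S, x <> 0 & z x = x.
  have [x x0] := vS_neq0 v.
  have zgx : iter g z x = lact (1 ^+ g) x by rewrite expr1n lact1 zg.
  have [j [x' [_ [x'0 zx' _]]]] :=
    eigenvector zD zl rhoP (rfactor_neq0 g0) (oner_neq0 L) x0 zgx.
  exists (iter j th x'); first exact: iter_th_neq0.
  by rewrite zth' zx' mul1r -lact_iter -lactM -exprMn mulVf // expr1n lact1.
(* As e' is prime to n', some power y^s corrects theta^g: the exponent f + s e' of [t] in Y^n'
   becomes the multiple h n' of n'. *)
have [s /dvdnP[h hE]] : exists s, (n' %| f + s * e')%N.
  have [a [_ aE]] := Bezoutl e' n'0.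
  exists (f * a)%N; rewrite cop in aE.
  by rewrite -mulnA -{1}(muln1 f) -mulnDr dvdn_mull.
pose Y x := pact (y ^+ s) (W^-1 ^+ s) (iter g th x).
have YD x x' : Y (x + x') = Y x + Y x' by rewrite /Y iter_thD pactD.
have Yl a x : Y (lact a x) = lact a (Y x) by rewrite /Y -lact_iter pact_lact.
(* Each passage of theta^g across y^s costs w^(g s), whence the binomial exponent. *)
have Yr r x : iter r Y x = lact ((w ^+ (g * s * 'C(r, 2)))%:A : L)
    (pact (y ^+ (s * r)) (W^-1 ^+ (s * r)) (iter (g * r) th x)).
  elim: r => [|r IH]; first by rewrite !muln0 /pact !scale1r !lact1.
  rewrite iterS IH Yl {1}/Y th_pact pact_lact pactM -lactM -exprD -exprD -mulnS -iterD.
  rewrite -mulnS -(rmorphM (in_alg L)) -exprD mulnA -mulnDr.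
  by rewrite binS bin1.
have [r0 r0E] := w_roots n'0.
(* An n'-th root of the scalar by which Y^n' acts on [u2]: [r0] is an n'-th root of w, and W2^n is
   the n'-th power of W2^g. *)
pose lam : L := (r0%:A) ^+ (g * s * 'C(n', 2)) * t ^+ h * W2 ^+ g.
have r00 : (r0%:A : L) != 0.
  have w0 : w != 0 by rewrite (prim_root_eq0 w_prim) gtn_eqF.
  rewrite -in_algE fmorph_eq0; apply: contraNneq w0 => r00.
  by rewrite -r0E r00 expr0n (gtn_eqF n'0).
have lam0 : lam != 0 by rewrite !mulf_neq0 ?expf_neq0.
have YrE : iter n' Y u2 = lact (lam ^+ n') u2.
  have P1 : pact (y ^+ n') (W^-1 ^+ n') u2 = lact (t ^+ e') u2.
    rewrite -[in RHS]zu2 /z -pact_lact /pact -lactM -mulrA -exprMn mulVf //.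
    by rewrite expr1n mulr1.
  have Ps : pact (y ^+ (s * n')) (W^-1 ^+ (s * n')) u2 = lact (t ^+ (s * e')) u2.
    elim: (s) => [|j IH]; first by rewrite /pact scale1r.
    by rewrite !mulSn !exprD -pactM IH pact_lact P1 -lactM mulrC.
  rewrite Yr [(g * n')%N]mulnC nE -lact_b pact_lact Ps -!lactM; congr (lact _ u2).
  rewrite -[vb v]/(vb v) bE !exprMn -!exprM [(g * n')%N]mulnC nE -hE exprD.
  rewrite algX -r0E algX -exprM [(n' * _)%N]mulnC; ring.
have rho2P : n'.-primitive_root ((w ^+ g)%:A : L).
  by have := prim_root_L n'n; rewrite (_ : (n %/ n')%N = g) // -nE mulKn.
have [j [u0 [c [u00 Yu0 u0E]]]] :=
  eigenvector YD Yl rho2P (rfactor_neq0 n'0) lam0 u20 YrE.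
set mu := lam * _ in Yu0.
have zp (a : T) l x : z (pact a l x) = pact a l (z x).
  by rewrite /z !pactM [a * _]mulrC [l * _]mulrC.
have zY x : z (Y x) = Y (z x).
  by rewrite /Y zp zth' [rho^-1 ^+ _]exprVn (prim_expr_order rhoP) invr1 lact1.
have zu0 : z u0 = u0.
  have z0 : z 0 = 0 by apply: (addIr (z 0)); rewrite -zD !add0r.
  rewrite u0E (big_morph z zD z0); apply: eq_bigr => i _; rewrite zl; congr (lact _ _).
  by elim: (nat_of_ord i) => //= m IH; rewrite zY IH.
(* The summands have the distinct z-eigenvalues rho^-i. As z lies in F (x) L, it separates them
   inside F[b] U. *)
pose U := \sum_(i < g) iter i th u0; pose C x := exists q, x = eact q U.
have CD x x' : C x -> C x' -> C (x + x').
  by move=> [q ->] [q' ->]; exists (q + q'); rewrite eactDl.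
have C0 : C 0 by exists 0; rewrite eact0l.
have Csum (I : Type) (r : seq I) (F : I -> S) : (forall i, C (F i)) -> C (\sum_(i <- r) F i).
  by move=> CF; apply: big_ind.
have Ceact q x : C x -> C (eact q x) by move=> [q' ->]; exists (q * q'); rewrite eactM.
have CZ (a : T) x : C x -> C (a *: x) by move=> /(Ceact a%:P); rewrite eactC.
have Cl a x : C x -> C (lact a x) by rewrite lact_eact; apply: Ceact.
have Cp (a : T) l x : C x -> C (pact a l x) by move=> Cx; apply/CZ/Cl.
have CU : C U by exists 1; rewrite eact1.
(* theta^i u0 is the i-th eigenprojection of U for z *)
have u0U (i : 'I_g) : lact g%:R (iter i th u0) =
    \sum_(s' < g) lact ((rho ^+ i) ^+ s') (iter s' z U).
  have zU s' : iter s' z U = \sum_(j < g) lact ((rho^-1 ^+ j) ^+ s') (iter j th u0).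
    elim: s' => [|s' IH]; first by apply: eq_bigr => j' _; rewrite lact1.
    have z0 : z 0 = 0 by apply: (addIr (z 0)); rewrite -zD !add0r.
    rewrite iterS IH (big_morph z zD z0); apply: eq_bigr => j' _.
    by rewrite zl zth' zu0 -lactM -exprSr.
  under eq_bigr do rewrite zU lact_sumr.
  rewrite exchange_big /= (bigD1 i) //= [X in _ + X]big1 ?addr0 => [|j' j'i].
    under eq_bigr do rewrite -lactM -exprMn -exprMn mulfV // !expr1n.
    by rewrite -lact_suml sumr_const card_ord.
  under eq_bigr do rewrite -lactM -exprMn.
  rewrite -lact_suml sum_unity_root; last first.
    rewrite exprMn -!exprM ![(_ * g)%N]mulnC !exprM exprVn (prim_expr_order rhoP).
    by rewrite invr1 !expr1n mulr1.
  rewrite ifN ?lact0 //; apply: contraNneq j'i => /(canRL (mulfK _)).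
  rewrite exprVn invr_eq0 expf_neq0 // mul1r invrK => /(_ isT)/eqP.
  by rewrite (eq_prim_root_expr rhoP) !modn_small // eq_sym.
have gL := rfactor_neq0 g0.
have Cu0 (i : 'I_g) : C (iter i th u0).
  rewrite -[iter i th u0](lact1) -(mulVf gL) lactM u0U; apply/Cl/Csum => s'.
  by apply: Cl; elim: (nat_of_ord s') => //= m; apply: Cp.
have U0 : U <> 0.
  move=> U0; apply: u00; have gu0 := u0U (Ordinal g0).
  rewrite -[u0]lact1 -(mulVf gL) lactM gu0 U0 [X in lact _ X]big1 ?lact0r // => s' _.
  have z0 : z 0 = 0 by apply: (addIr (z 0)); rewrite -zD !add0r.
  by rewrite [iter _ _ _](_ : _ = 0) ?lact0r //; elim: (nat_of_ord s') => //= m ->.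
(* Y u0 = mu u0 expresses theta^g u0 as a multiple of u0 by a unit of F (x) L; so theta preserves
   the F[b]-span of the theta^i u0 with i < g. *)
have Cgu0 : C (iter g th u0).
  have -> : iter g th u0 = pact (y ^- s) (W ^+ s) (Y u0).
    rewrite /Y pactM mulVr ?unitrX // exprVn mulfV ?expf_neq0 //.
    by rewrite /pact scale1r lact1.
  by rewrite Yu0; apply/Cp/Cl/(Cu0 (Ordinal g0)).
exists U => // x; have [_ /(_ C C0 CD CZ)[]] := vS_simple v.
- move=> _ [q ->]; rewrite eact_th; apply: Ceact.
  rewrite /U -[tw_th _]/(iter 1 th _) iter_th_sum; apply: Csum => i; rewrite -iterD add1n.
  have [ig|gi] := ltnP i.+1 g; first exact: (Cu0 (Ordinal ig)).
  by have -> : i.+1 = g by apply/eqP; rewrite eqn_leq gi ltn_ord.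
- by move=> /(_ _ CU).
- by apply.
Qed.
End Cyclic.

(** * The trace from F[X] to k[X] and annihilators of cyclic vectors *)

Section PolyTrace.
Variables (k : fieldType) (T : twdata k) (w : k) (y : T).
Local Notation n := (tn T).
Local Notation zeta := (@tzeta k T).
Hypothesis w_prim : n.-primitive_root w.
Hypothesis y_unit : y \is a GRing.unit.
Hypothesis y_eigen : zeta y = w *: y.

Definition ptr (q : {poly T}) : {poly T} := \sum_(j < n) map_poly (iter j zeta) q.

Lemma coef_iter_zeta j (q : {poly T}) i : (map_poly (iter j zeta) q)`_i = iter j zeta q`_i.
Proof.
have [f fE] := @iter_zeta_rmorph _ T j.
have -> : map_poly (iter j zeta) q = map_poly f q by apply: eq_map_poly => a; rewrite fE.
by rewrite coef_map /= fE.
Qed.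

Lemma ptr_k q : exists p : {poly k}, ptr q = map_poly (in_alg T) p.
Proof.
have trk i : exists x : k, (ptr q)`_i = x%:A.
  apply/tzeta_fixed; rewrite /ptr coef_sum rmorph_sum /=.
  under eq_bigr do rewrite coef_iter_zeta -iterS.
  under [RHS]eq_bigr do rewrite coef_iter_zeta.
  have := tzeta_order q`_i; case: n => [|m] zn; first by rewrite !big_ord0.
  by rewrite big_ord_recr [RHS]big_ord_recl zn addrC.
have [f fE] := choice trk; exists (\poly_(i < size (ptr q)) f i).
apply/polyP => i; rewrite coef_map coef_poly; case: ltnP => /= [_|si]; first exact: fE.
by rewrite scale0r nth_default.
Qed.

(** The families y^s and y^-s / n are dual for the trace form of F over k, so [q] is recovered from
    the traces of its multiples, which have coefficients in k. *)
Lemma ptr_expand q : n%:R *: q = \sum_(s < n) y ^+ s *: ptr (y ^- s *: q).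
Proof.
have w0 : w != 0 by rewrite (prim_root_eq0 w_prim) gtn_eqF ?tn_gt0.
have itY j s : iter j zeta (y ^- s) = w^-1 ^+ (s * j) *: y ^- s.
  elim: j => [|j IH]; first by rewrite muln0 scale1r.
  rewrite iterS IH tzetaZ rmorphV ?unitrX // rmorphXn /= y_eigen exprZn.
  by rewrite invrZ ?unitrX ?unitfE // scalerA -exprVn -exprD mulnS addnC.
apply/polyP => i; rewrite coefZ coef_sum.
under eq_bigr => s _.
  rewrite coefZ coef_sum mulr_sumr.
  under eq_bigr => j _.
    rewrite coef_iter_zeta coefZ iter_zetaM itY -scalerAl -scalerAr mulrA mulrV ?unitrX // mul1r.
    over.
  over.
rewrite exchange_big /= (bigD1 (Ordinal (tn_gt0 T))) //= [X in _ + X]big1 ?addr0 => [|j j0].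
  by rewrite -scaler_suml sum_w // dvdn0 scaler_nat mulr_natl.
rewrite -scaler_suml sum_w //.
have j1 : (0 < j)%N by rewrite lt0n; apply: contraNneq j0 => j0; apply/eqP/val_inj.
by rewrite ifN ?scale0r //; apply/negP => /(dvdn_leq j1); rewrite leqNgt ltn_ord.
Qed.
End PolyTrace.

(** Membership in the isotypic part of V at [v], expressed by annihilators so that V need not be
    decomposed beforehand. *)
Definition vfac (k : fieldType) (T : twdata k) (v : vertex T) (V : twmod T) (x : V) :=
  forall z : Lbeta T, vpr v z = 0 -> bact z x = 0.

Section CyclicVertex.
Variables (k : fieldType) (T : twdata k) (v : vertex T) (w : k) (y : T).
Local Notation n := (tn T).
Local Notation zeta := (@tzeta k T).
Local Notation L := (vL v).
Local Notation S := (vS v).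
Hypothesis w_prim : n.-primitive_root w.
Hypothesis n_neq0 : n%:R != 0 :> k.
Hypothesis y_unit : y \is a GRing.unit.
Hypothesis y_eigen : zeta y = w *: y.
Variable U : S.
Hypothesis U_neq0 : U <> 0.
Hypothesis U_cyc : forall u, exists q, u = eact q U.

Lemma nT_unit : (n%:R : T) \is a GRing.unit.
Proof.
by rewrite -(rmorph_nat (in_alg T)) rmorph_unit // unitfE.
Qed.

Lemma eact_iter_zeta0 q j (s : S) : (forall s : S, eact q s = 0) ->
  eact (map_poly (iter j zeta) q) s = 0.
Proof.
move=> q0; have [s' ->] : exists s', s = iter j (@tw_th _ _ S) s'.
  elim: j s => [|j IH] s; first by exists s.
  by have [x ->] := th_surj s; have [x' ->] := IH x; exists x'; rewrite -iterS.
by rewrite -eact_iter q0 iter_th0.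
Qed.

(** By commutativity [q] kills all of S, and so do the traces of its multiples. These lie in k[X],
    hence vanish in L and kill [x]; [ptr_expand] then recovers n q. *)
Lemma eact_ann q : eact q U = 0 -> forall (V : twmod T) (x : V), vfac v x -> eact q x = 0.
Proof.
move=> qU V x xv; have qS (s : S) : eact q s = 0.
  by have [q' ->] := U_cyc s; rewrite -eactM mulrC eactM qU eact0r.
have trS (a : T) (s : S) : eact (ptr (a *: q)) s = 0.
  rewrite /ptr eact_suml big1 // => j _; apply: eact_iter_zeta0 => s'.
  by rewrite eactZ qS scaler0.
have trx (a : T) : eact (ptr (a *: q)) x = 0.
  have [p pE] := ptr_k (a *: q); rewrite pE eact_bact -bact_mod; apply: xv.
  apply: (lact_eq0 U_neq0); rewrite lactE bact_mod -eact_bact -pE; exact: trS.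
have /(congr1 (fun q => eact q x)) := ptr_expand w_prim y_unit y_eigen q.
rewrite eact_suml big1 => [|s _]; last by rewrite eactZ trx scaler0.
by rewrite eactZ => nq; rewrite -[LHS]scale1r -(mulVr nT_unit) -scalerA nq scaler0.
Qed.

Lemma eact_ann2 q q' : eact q U = eact q' U ->
  forall (V : twmod T) (x : V), vfac v x -> eact q x = eact q' x.
Proof.
move=> qq V x xv; have: eact (q - q') x = 0.
  apply: eact_ann => //; rewrite eactDl -scaleN1r eactZ scaleN1r qq subrr //.
by rewrite eactDl -scaleN1r eactZ scaleN1r => /eqP; rewrite subr_eq0 => /eqP.
Qed.

Lemma cyclic_D_eq_L (d : Mult v S) : exists! a : L, d = lact a.
Proof.
have [q qE] := U_cyc (d U).
have dE s : d s = eact q s.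
  by have [q' ->] := U_cyc s; rewrite eact_hom qE -!eactM mulrC.
(* [d] commutes with theta, so conjugation by theta shows that q and its zeta-conjugates act alike:
   the average of q still acts as [d]. *)
have qz j (s : S) : eact (map_poly (iter j zeta) q) s = eact q s.
  elim: j s => [|j IH] s; first by rewrite map_poly_id.
  have [s' ->] := th_surj s; have := congr1 (@tw_th _ _ S) (IH s').
  rewrite -dE -hom_th dE eact_th => <-; congr eact; apply/polyP => i.
  by rewrite coef_map !coef_iter_zeta.
have [p pE] := ptr_k q.
have lE (s : S) : lact (n%:R^-1 *: vpr v (in_qpoly (Lpoly T) p)) s = d s.
  rewrite -mulr_algl lactM lactE bact_mod -eact_bact -pE /ptr eact_suml.
  under eq_bigr do rewrite qz; rewrite sumr_const card_ord -dE lact_alg.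
  rewrite -[d s *+ n]scaler_nat scalerA mulr_algl -(scaler_nat n (1 : T)).
  by rewrite scalerA mulVf // !scale1r.
exists (n%:R^-1 *: vpr v (in_qpoly (Lpoly T) p)); split.
  by apply: hom_eqP => s; rewrite lE.
by move=> a da; apply: (lact_inj U_neq0); rewrite lE da.
Qed.
End CyclicVertex.

(** * Multiplicity spaces *)

(** In a spanning family of minimal size, a nontrivial relation would allow one vector to be
    dropped. *)
Lemma lbasis_of_span (L : fieldType) (W : lmodType L) (J : finType) (m : J -> W) :
  (forall x, exists c : J -> L, x = \sum_j c j *: m j) ->
  exists r (e : 'I_r -> W), lbasis e.
Proof.
move=> span; pose Sp r := `[< exists e : 'I_r -> W,
  forall x, exists a : 'rV[L]_r, x = \sum_(j < r) a 0 j *: e j >].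
have exSp : exists r, Sp r.
  exists #|J|; apply/asboolP; exists (m \o enum_val) => x; have [c ->] := span x.
  exists (\row_j c (enum_val j)); rewrite (reindex (enum_val (A := J))) /=; last first.
    exact/onW_bij/enum_val_bij.
  by apply: eq_big => [j|j _]; rewrite ?enum_valP // mxE.
case: (ex_minnP exSp) => r /asboolP[e eS] rmin; exists r, e => x.
have [a xa] := eS x; exists a; split=> // a' xa'.
apply/eqP; rewrite -subr_eq0; apply/negPn/negP => aa'.
have /rV0Pn[j0 cj0] := aa'; set c := a - a' in cj0.
have c0 : \sum_(j < r) c 0 j *: e j = 0.
  under eq_bigr do rewrite !mxE scalerBl.
  by rewrite sumrB -xa -xa' subrr.
case: r e eS rmin x a xa a' xa' aa' j0 c cj0 c0 => [|r] e eS rmin x a xa a' xa' aa' j0 c cj0 c0.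
  by case: j0 cj0.
suff /rmin : Sp r by rewrite ltnn.
apply/asboolP; exists (e \o lift j0) => z; have [d ->] := eS z.
exists (\row_j (d 0 (lift j0 j) - d 0 j0 / c 0 j0 * c 0 (lift j0 j))).
have ej0 : e j0 = - (c 0 j0)^-1 *: \sum_(j < r) c 0 (lift j0 j) *: e (lift j0 j).
  apply: (scalerI cj0); rewrite scalerA mulrN mulfV // scaleN1r.
  by apply/eqP; rewrite -addr_eq0; move: c0; rewrite (bigD1_ord j0) //= => ->.
rewrite (bigD1_ord j0) //= ej0 scalerA scaler_sumr -big_split; apply: eq_bigr => j _ /=.
by rewrite mxE scalerA -scalerDl mulrN mulNr addrC.
Qed.

Section HomStructure.
Variables (k : fieldType) (T : twdata k) (v : vertex T) (w : k) (y : T).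
Local Notation n := (tn T).
Local Notation zeta := (@tzeta k T).
Local Notation L := (vL v).
Local Notation S := (vS v).
Hypothesis w_prim : n.-primitive_root w.
Hypothesis n_neq0 : n%:R != 0 :> k.
Hypothesis y_unit : y \is a GRing.unit.
Hypothesis y_eigen : zeta y = w *: y.
Variable U : S.
Hypothesis U_neq0 : U <> 0.
Hypothesis U_cyc : forall u, exists q, u = eact q U.
Variable V : twmod T.
Implicit Types (x : V).

Let ann2 := eact_ann2 w_prim n_neq0 y_unit y_eigen U_neq0 U_cyc.

Lemma hom_ext (f g : Mult v V) : f U = g U -> f = g.
Proof. by move=> fg; apply: hom_eqP => u; have [q ->] := U_cyc u; rewrite !eact_hom fg. Qed.

Lemma bact_eact (z : Lbeta T) q x : bact z (eact q x) = eact q (bact z x).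
Proof. by rewrite -!eact_bact -!eactM mulrC. Qed.

Lemma vfac_eact q x : vfac v x -> vfac v (eact q x).
Proof. by move=> xv z z0; rewrite bact_eact xv // eact0r. Qed.

Lemma vfac_th x : vfac v x -> vfac v (tw_th x).
Proof. by move=> xv z z0; rewrite bact_th xv // th0. Qed.

Lemma vfac_hom (f : Mult v V) u : vfac v (f u).
Proof.
move=> z z0; have -> : bact z (f u) = f (bact z u).
  by rewrite -!eact_bact eact_hom.
by rewrite vS_factor // hom0.
Qed.

Lemma vfacD x x' : vfac v x -> vfac v x' -> vfac v (x + x').
Proof. by move=> xv xv' z z0; rewrite bactDr xv // xv' // addr0. Qed.

Lemma vfac_sum (I : Type) (r : seq I) (F : I -> V) :
  (forall i, vfac v (F i)) -> vfac v (\sum_(i <- r) F i).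
Proof.
move=> FV; apply: big_ind => //; first by move=> z _; rewrite bact0.
exact: vfacD.
Qed.

Lemma vfac_bact_id x (z : Lbeta T) : vfac v x -> vpr v z = 1 -> bact z x = x.
Proof.
move=> xv z1; have z10 : vpr v (z - 1) = 0 by rewrite rmorphB /= rmorph1 z1 subrr.
have b1 := bact_alg 1 x; rewrite !scale1r in b1.
by rewrite -[z](subrK 1) bactD xv // add0r b1.
Qed.

Definition ctw : {poly T} := sval (cid (U_cyc (tw_th U))).
Lemma ctwE : tw_th U = eact ctw U. Proof. exact: (svalP (cid (U_cyc (tw_th U)))). Qed.

Lemma ctw_inv_ex : exists q, U = eact q (tw_th U).
Proof.
have [s UE] := th_surj U; have [q sE] := U_cyc s.
by exists (map_poly zeta q); rewrite -eact_th -sE.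
Qed.
Definition ctw_inv : {poly T} := sval (cid ctw_inv_ex).
Lemma ctw_invE : U = eact ctw_inv (tw_th U). Proof. exact: (svalP (cid ctw_inv_ex)). Qed.

(* theta twisted by a unit of F (x) L so that it fixes U; it has order n. *)
Definition thU (W : twmod T) (x : W) := eact ctw_inv (tw_th x).

Lemma thUD (W : twmod T) (x x' : W) : thU (x + x') = thU x + thU x'.
Proof. by rewrite /thU tw_thD eactDr. Qed.

Lemma thUZ (W : twmod T) (a : T) (x : W) : thU (a *: x) = zeta a *: thU x.
Proof. by rewrite /thU tw_thZ eactZr. Qed.

Lemma iter_thUE r : exists q, forall (W : twmod T) (x : W),
  iter r (@thU W) x = eact q (iter r (@tw_th _ _ W) x).
Proof.
elim: r => [|r [q IH]]; first by exists 1 => W x; rewrite eact1.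
exists (ctw_inv * map_poly zeta q) => W x.
by rewrite iterS IH /thU eact_th eactM.
Qed.

Lemma thU_fix : thU U = U. Proof. by rewrite /thU -ctw_invE. Qed.

(** The n-th iterate is multiplication by an element of F[b] that fixes U; by [eact_ann2] such an
    element acts trivially on the isotypic part. *)
Lemma thU_order x : vfac v x -> iter n (@thU V) x = x.
Proof.
move=> xv; have [q qE] := iter_thUE n.
have xE (W : twmod T) (z : W) : eact (q * 'X) z = iter n (@thU W) z.
  by rewrite eactMX -qE.
rewrite -xE -[RHS]eact1; apply: ann2 => //; rewrite xE eact1.
by elim: n => //= r ->; rewrite thU_fix.
Qed.

Lemma thU_vfac x : vfac v x -> vfac v (thU x).
Proof. by move=> xv; apply/vfac_eact/vfac_th. Qed.

Lemma ctwK x : vfac v x -> eact (ctw * ctw_inv) x = x.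
Proof.
move=> xv; rewrite -[RHS]eact1; apply: ann2 => //.
by rewrite eact1 mulrC eactM -ctwE -ctw_invE.
Qed.

(** The assignment q U -> q x is well defined by [eact_ann2]. It respects theta because thU x = x
    means theta x = [ctw] x, the relation that holds for U. *)
Lemma thU_fix_hom x : vfac v x -> thU x = x -> exists f : Mult v V, f U = x.
Proof.
move=> xv xfix.
have xth : tw_th x = eact ctw x.
  by rewrite -[in RHS]xfix /thU -eactM ctwK //; apply: vfac_th.
pose qU (u : S) := sval (cid (U_cyc u)).
have qUE u : eact (qU u) U = u by rewrite -(svalP (cid (U_cyc u))).
pose f u := eact (qU u) x.
have fE q : f (eact q U) = eact q x by apply: ann2 => //; rewrite qUE.
have fhom : is_twhom f.
  split=> [u u'|a u|u].
  - by have [q ->] := U_cyc u; have [q' ->] := U_cyc u'; rewrite -eactDl !fE eactDl.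
  - by have [q ->] := U_cyc u; rewrite -eactZ !fE eactZ.
  - by have [q ->] := U_cyc u; rewrite eact_th ctwE -eactM !fE eactM eact_th xth.
by exists (TwHom fhom); rewrite -[LHS]/(f U) -{1}(eact1 U) fE eact1.
Qed.

Lemma hom_thU (f : Mult v V) : thU (f U) = f U.
Proof. by rewrite /thU -hom_th -eact_hom -ctw_invE. Qed.

Lemma thUZk (c : k) x : thU (c%:A *: x) = c%:A *: thU x.
Proof. by rewrite thUZ tzeta_k. Qed.

Lemma thU_sum (I : Type) (r : seq I) (F : I -> V) :
  thU (\sum_(i <- r) F i) = \sum_(i <- r) thU (F i).
Proof.
apply: (big_morph (@thU V)); first exact: thUD.
by rewrite /thU th0 eact0r.
Qed.

(** The average over the powers of [thU]. On isotypic vectors it projects onto the fixed ones, which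
    are the values at U of homomorphisms. *)
Definition hproj (x : V) : V := (n%:R^-1)%:A *: \sum_(j < n) iter j (@thU V) x.

Lemma iter_thUD r x x' : iter r (@thU V) (x + x') = iter r (@thU V) x + iter r (@thU V) x'.
Proof. by elim: r => //= r ->; rewrite thUD. Qed.

Lemma iter_thUZk r (c : k) x : iter r (@thU V) (c%:A *: x) = c%:A *: iter r (@thU V) x.
Proof. by elim: r => //= r ->; rewrite thUZk. Qed.

Lemma hprojD x x' : hproj (x + x') = hproj x + hproj x'.
Proof.
rewrite /hproj -scalerDr -big_split; congr (_ *: _).
by apply: eq_bigr => j _; rewrite iter_thUD.
Qed.

Lemma hprojZ (c : k) x : hproj (c%:A *: x) = c%:A *: hproj x.
Proof.
rewrite /hproj scalerA mulrC -scalerA; congr (_ *: _); rewrite scaler_sumr.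
by apply: eq_bigr => j _; rewrite iter_thUZk.
Qed.

Lemma iter_thU_vfac r x : vfac v x -> vfac v (iter r (@thU V) x).
Proof. by move=> xv; elim: r => //= r; apply: thU_vfac. Qed.

Lemma vfacZ (a : T) x : vfac v x -> vfac v (a *: x).
Proof. by move=> xv z z0; rewrite bactZr xv // scaler0. Qed.

Lemma hproj_hom x : vfac v x -> exists f : Mult v V, f U = hproj x.
Proof.
move=> xv; apply: thU_fix_hom.
  by apply/vfacZ/vfac_sum => j; apply: iter_thU_vfac.
rewrite /hproj thUZk thU_sum; congr (_ *: _).
have := thU_order xv; case: n => [|m] xn; first by rewrite !big_ord0.
by rewrite big_ord_recr [RHS]big_ord_recl addrC; congr (_ + _); exact: xn.
Qed.

Lemma nV (x : V) : (n%:R^-1)%:A *: (x *+ n) = x.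
Proof.
by rewrite -scaler_nat scalerA mulr_algl -(scaler_nat n (1 : T)) scalerA mulVf // !scale1r.
Qed.

Lemma hproj_id (f : Mult v V) : hproj (f U) = f U.
Proof.
rewrite /hproj (eq_bigr (fun=> f U)) => [|j _]; first by rewrite sumr_const card_ord nV.
by elim: (nat_of_ord j) => //= r ->; rewrite hom_thU.
Qed.

(* The eigencomponents of x under thU, shifted to eigenvalue 1 by powers of y. *)
Lemma vfac_gen x : vfac v x ->
  exists f : 'I_n -> Mult v V, x = \sum_(s < n) y ^+ s *: f s U.
Proof.
move=> xv; have w0 : w != 0 by rewrite (prim_root_eq0 w_prim) gtn_eqF ?tn_gt0.
have itY j s : iter j zeta (y ^- s) = w^-1 ^+ (s * j) *: y ^- s.
  elim: j => [|j IH]; first by rewrite muln0 scale1r.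
  rewrite iterS IH tzetaZ rmorphV ?unitrX // rmorphXn /= y_eigen exprZn.
  by rewrite invrZ ?unitrX ?unitfE // scalerA -exprVn -exprD mulnS addnC.
have /choice[f fE] (s : 'I_n) : exists f : Mult v V, f U = hproj (y ^- s *: x).
  by apply/hproj_hom/vfacZ.
exists f; under eq_bigr do rewrite fE /hproj scaler_sumr scaler_sumr.
have itx j (s : 'I_n) : iter j (@thU V) (y ^- s *: x) =
    (w^-1 ^+ (s * j) *: y ^- s) *: iter j (@thU V) x.
  rewrite -itY; elim: j => // j IH; by rewrite !iterS IH thUZ.
rewrite exchange_big /= (bigD1 (Ordinal (tn_gt0 T))) //= [X in _ + X]big1 ?addr0 => [|j j0].
  under eq_bigr do
    rewrite scalerA mulrC -scalerA [y ^+ _ *: (_ *: _)]scalerA mulrV ?unitrX // scale1r.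
  by rewrite -scaler_sumr sumr_const card_ord nV.
under eq_bigr => s _.
  rewrite itx scalerA mulr_algr scalerA -scalerAl -scalerAr mulrV ?unitrX //.
  rewrite scalerA.
  over.
rewrite -scaler_suml -scaler_suml -mulr_sumr sum_w //.
have j1 : (0 < j)%N by rewrite lt0n; apply: contraNneq j0 => j0; apply/eqP/val_inj.
rewrite ifN ?mulr0 ?scale0r //.
by apply/negP => /(dvdn_leq j1); rewrite leqNgt ltn_ord.
Qed.

Hypothesis V_fg : fin_gen V.

(** The powers y^j with j < n span F over k, since y^-j times the w^j-eigencomponent of an element
    is fixed by zeta. *)
Lemma kspan_ex : exists (J : finType) (g : J -> V), forall x,
  exists c : J -> k, x = \sum_j (c j)%:A *: g j.
Proof.
have [r [s sE]] := V_fg.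
exists ('I_r * 'I_n)%type, (fun j : 'I_r * 'I_n => y ^+ j.2 *: s j.1) => x.
have aE (a : T) : exists c : 'I_n -> k, a = \sum_(j < n) c j *: y ^+ j.
  have /choice[c cE] (j : 'I_n) : exists c : k, y ^- j * tproj w j a = c%:A.
    apply/tzeta_fixed; rewrite rmorphM rmorphV ?unitrX // rmorphXn /= y_eigen exprZn.
    have w0 : w != 0 by rewrite (prim_root_eq0 w_prim) gtn_eqF ?tn_gt0.
    rewrite tprojE // invrZ ?unitrX ?unitfE // -scalerAr -scalerAl scalerA mulfV ?scale1r //.
    by rewrite expf_neq0.
  exists (fun j => n%:R^-1 * c j); apply: (scalerI n_neq0).
  rewrite -(sum_tproj w_prim) scaler_sumr; apply: eq_bigr => j _.
  rewrite scalerA mulrA mulfV // mul1r -[c j *: _]mulr_algl -cE mulrAC mulVr ?mul1r //.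
  by rewrite unitrX.
have [a ->] := sE x; have /choice[c cE] i := aE (a i).
exists (fun j => c j.1 j.2); rewrite -(pair_bigA _ (fun i j => (c i j)%:A *: (y ^+ j *: s i))) /=.
apply: eq_bigr => i _; rewrite {1}cE scaler_suml; apply: eq_bigr => j _.
by rewrite scalerA mulr_algl.
Qed.

(** Evaluation at U embeds Hom(S, V) into V. Cutting by the idempotent [e] and then applying [hproj]
    is a k-linear retraction onto the image, so a finite k-spanning family of V yields one of Hom(S,
    V). *)
Lemma mult_basis (e : Lbeta T) : vpr v e = 1 -> (forall x, vfac v (bact e x)) ->
  exists r (b : 'I_r -> Mult v V), lbasis b.
Proof.
move=> e1 eV; have [J [g gE]] := kspan_ex.
have /choice[m mE] (j : J) : exists f : Mult v V, f U = hproj (bact e (g j)).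
  exact: hproj_hom.
apply: (@lbasis_of_span _ _ J m) => f; have [c fE] := gE (f U).
exists (fun j => (c j)%:A : L); apply: hom_ext.
have sumE (I : Type) (r : seq I) (F : I -> Mult v V) :
    (\sum_(i <- r) F i) U = \sum_(i <- r) F i U.
  exact: (big_morph (fun h : Mult v V => h U)).
rewrite sumE -[LHS]hproj_id.
rewrite -(vfac_bact_id (vfac_hom f U) e1) {1}fE.
have bact_sum (F : J -> V) : bact e (\sum_j F j) = \sum_j bact e (F j).
  by apply: (big_morph (bact e)) => [x x'|]; rewrite ?bactDr ?bact0.
have hproj_sum (F : J -> V) : hproj (\sum_j F j) = \sum_j hproj (F j).
  apply: (big_morph hproj hprojD); rewrite /hproj big1 ?scaler0 // => i _.
  by elim: (nat_of_ord i) => //= r' ->; rewrite /thU th0 eact0r.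
rewrite bact_sum hproj_sum; apply: eq_bigr => j _.
rewrite bactZr hprojZ -mE -[RHS]/(m j (lact _ U)) lact_alg homZ //.
Qed.
End HomStructure.

(** * Forms and their adjoints *)

Section Norm.
Variables (k : fieldType) (T : twdata k).

Lemma NmM (a b : T) : Nm (a * b) = Nm a * Nm b.
Proof. by rewrite /Nm -big_split; apply: eq_bigr => j _; rewrite iter_zetaM. Qed.

Lemma Nm1 : Nm (1 : T) = 1.
Proof.
by rewrite /Nm big1 // => j _; elim: (nat_of_ord j) => //= r ->; rewrite rmorph1.
Qed.

Lemma Nm_unit (a : T) (x : k) : x != 0 -> Nm a = x%:A -> a \is a GRing.unit.
Proof.
move=> x0 ax; have: Nm a \is a GRing.unit.
  by rewrite ax -in_algE rmorph_unit // unitfE.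
rewrite /Nm; case: (tn T) (tn_gt0 T) => // m _.
by rewrite big_ord_recl unitrM => /andP[].
Qed.

Lemma NmV (a : T) (x : k) : x != 0 -> Nm a = x%:A -> Nm a^-1 = x^-1%:A.
Proof.
move=> x0 ax; have aU := Nm_unit x0 ax.
have: Nm a * Nm a^-1 = 1 by rewrite -NmM mulrV // Nm1.
rewrite ax mulr_algl => /(congr1 ( *:%R x^-1)).
by rewrite scalerA mulVf // scale1r.
Qed.

Lemma alg_inj (x x' : k) : (x%:A : T) = x'%:A -> x = x'.
Proof. exact: (@fmorph_inj _ _ (in_alg T)). Qed.

Lemma b_unit : b_ T \is a GRing.unit.
Proof.
apply/unitrP; exists ((tbeta T)^-1 *: b_ T ^+ (tm T %/ tn T).-1).
have E : (tbeta T)^-1 *: b_ T ^+ (tm T %/ tn T).-1 * b_ T = 1.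
  rewrite -scalerAl -exprSr prednK ?tN_gt0 // b_exp scalerA mulVf ?tbeta_neq0 //.
  by rewrite scale1r.
by rewrite [b_ T * _]mulrC.
Qed.
End Norm.

Section Adjoint.
Variables (k : fieldType) (T : twdata k) (V : twmod T) (P : polarization V).
Hypothesis sigma_k : forall x : k, psig P x%:A = x%:A.
Variables (c0 : T) (g : k) (s : {rmorphism Lbeta T -> Lbeta T}).
Hypothesis c0E : Nm c0 = g%:A.
Hypothesis sP : is_sigma P c0 s.
Variables (U1 U2 : twmod T) (h : U1 -> U2 -> T).
Hypothesis hDl : forall u u' v, h (u + u') v = h u v + h u' v.
Hypothesis hDr : forall u v v', h u (v + v') = h u v + h u v'.
Hypothesis hZl : forall a u v, h (a *: u) v = a * h u v.
Hypothesis hZr : forall a u v, h u (a *: v) = psig P a * h u v.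
Hypothesis hth : forall u v, h (tw_th u) (tw_th v) = c0 * @tzeta k T (h u v).

Lemma sigma_alg (x : k) : s x%:A = x%:A.
Proof. exact: sP.1. Qed.

Lemma sigma_b : s (b_ T) = g%:A * (b_ T)^-1.
Proof. by rewrite (sP.2 g) // mulr_algl. Qed.

Lemma sigmaZ (x : k) z : s (x *: z) = x *: s z.
Proof. by rewrite -mulr_algl rmorphM /= sigma_alg mulr_algl. Qed.

Lemma form_iter_th r (u : U1) (v : U2) :
  h (iter r (@tw_th _ _ U1) u) (iter r (@tw_th _ _ U2) v) =
  (\prod_(j < r) iter j (@tzeta k T) c0) * iter r (@tzeta k T) (h u v).
Proof.
elim: r => [|r IH]; first by rewrite big_ord0 mul1r.
rewrite !iterS hth IH rmorphM mulrA big_ord_recl; congr (_ * _ * _).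
by rewrite rmorph_prod; apply: eq_bigr.
Qed.

(** h(theta^n u, theta^n v) = Nm(c0) h(u, v), so b has adjoint Nm(c0) b^-1 = sigma_c0(b). Both
    modules and c0 are kept free so that the polarization, the pairings of simple modules and the
    forms of fixed arrows are all covered. *)
Lemma form_adjoint (z : Lbeta T) (u : U1) (v : U2) : h u (bact z v) = h (bact (s z) u) v.
Proof.
elim/Lbeta_ind: z u v => [x|z IH|z z' IH IH'] u v.
- by rewrite sigma_alg !bact_alg hZl hZr sigma_k.
- rewrite bactLM IH bact_b rmorphM mulrC bactLM; move: (bact (s z) u) => {IH}u.
  have {1}-> : u = iter (tn T) (@tw_th _ _ U1) (bact (b_ T)^-1 u).
    rewrite -bact_b -bactLM mulrV ?b_unit //.
    by have := bact_alg 1 u; rewrite !scale1r.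
  rewrite form_iter_th -/(Nm c0) c0E tzeta_order sigma_b bactLM bact_alg hZl //.
- by rewrite rmorphD !bactD hDl hDr IH IH'.
Qed.
End Adjoint.

Lemma sigma_invol (k : fieldType) (T : twdata k) (V : twmod T) (P : polarization V)
    (c0 : T) (g : k) (s : {rmorphism Lbeta T -> Lbeta T}) :
  (forall x : k, psig P x%:A = x%:A) -> Nm c0 = g%:A -> g != 0 -> is_sigma P c0 s ->
  forall z, s (s z) = z.
Proof.
move=> sigma_k c0E g0 sP z.
have sa := sigma_alg sigma_k sP; have sb := sigma_b c0E sP.
elim/Lbeta_ind: z => [x|z IH|z z' IH IH']; rewrite ?sa //; last by rewrite !rmorphD IH IH'.
rewrite !rmorphM IH; congr (_ * _).
have gU : (g%:A : Lbeta T) \is a GRing.unit by rewrite -in_algE rmorph_unit // unitfE.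
by rewrite sb rmorphM sa rmorphV ?b_unit // sb invrM ?unitrV ?b_unit // invrK mulrC divrK.
Qed.

(** When D = L, any two basis vectors satisfy c_1 e_0 = c_0 e_1. So r^2 = [D : L] is 1, and the
    splitting consists of matrices of size one. *)
Lemma is_trd_lact (k : fieldType) (T : twdata k) (v : vertex T) (a t : vL v) :
  (forall d : Mult v (vS v), exists! a : vL v, d = lact a) ->
  is_trd (lact a : Mult v (vS v)) t -> t = a.
Proof.
move=> DL [E [iota [r [rho [[e eb] _ rhoa tr]]]]].
have [u u0] := vS_neq0 v.
have eE j : exists c : vL v, e j = c *: (lact 1 : Mult v (vS v)).
  have [c [-> _]] := DL (e j); exists c; apply: hom_eqP => x.
  by rewrite -[RHS]/(lact 1 (lact c x)) lact1.
have /choice[c cE] := eE.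
have [d [dE _]] := eb (lact 1 : Mult v (vS v)).
have r0 : (r * r)%N != 0%N.
  apply/eqP => r0; have := congr1 (fun f : Mult v (vS v) => f u) dE.
  rewrite big1 => [|j _]; first by rewrite lact1 => /u0.
  by have := ltn_ord j; rewrite [X in (_ < X)%N]r0.
have r1 : (r * r <= 1)%N.
  rewrite leqNgt; apply/negP => r1.
  pose i0 : 'I_(r * r) := Ordinal (ltnW r1); pose i1 : 'I_(r * r) := Ordinal r1.
  have [d0 [d0E d0U]] := eb 0.
  have z0 : d0 = 0 by apply: d0U; rewrite big1 // => j _; rewrite mxE scale0r.
  pose a0 : 'rV[vL v]_(r * r) := c i1 *: delta_mx 0 i0 - c i0 *: delta_mx 0 i1.
  have a0E : 0 = \sum_(j < r * r) a0 0 j *: e j.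
    rewrite (bigD1 i0) //= (bigD1 i1) //= big1 ?addr0 => [|j /andP[/negPf j0 /negPf j1]].
      by rewrite !mxE /= mulr1 mulr0 subr0 mulr0 mulr1 sub0r !cE !scalerA mulNr
        mulrC -scalerDl subrr scale0r.
    by rewrite !mxE j0 j1 andbF !mulr0 subr0 scale0r.
  have a00 : a0 = 0 by rewrite -(d0U _ a0E) z0.
  have ci j : c j = 0 -> False.
    move=> cj; have ej : e j = 0 by rewrite cE cj scale0r.
    have := d0U (d0 + delta_mx 0 j).
    rewrite z0 add0r (bigD1 j) //= ej scaler0 add0r big1 => [/(_ erefl)|l lj].
      by move=> /matrixP/(_ 0 j)/eqP; rewrite !mxE !eqxx eq_sym oner_eq0.
    by rewrite mxE eqxx (negPf lj) scale0r.
  apply: (ci i1); have /matrixP/(_ 0 i0) := a00.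
  by rewrite !mxE /= mulr1 mulr0 subr0.
have r1' : r = 1%N by case: (r) r0 r1 => [|[|m]].
move: tr; rewrite rhoa mxtrace_scalar r1' mulr1n => /fmorph_inj.
by [].
Qed.

(* A quiver over a Kummer algebra F = k[y], zeta(y) = w y, whose simple modules
   are cyclic over F (x) k[b]. *)
Record cyclic_quiver (k : fieldType) (T : twdata k) (V : twmod T)
    (P : polarization V) (xi : T) (Q : quiver P xi) := CyclicQuiver {
  cq_w : k;
  cq_y : T;
  cq_gamma : k;
  cq_nu : k;
  cq_U : forall i : Q, vS (qv i);
  cq_prim : (tn T).-primitive_root cq_w;
  cq_n : (tn T)%:R != 0 :> k;
  cq_two : 2 != 0 :> k;
  cq_unit : cq_y \is a GRing.unit;
  cq_eigen : @tzeta k T cq_y = cq_w *: cq_y;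
  cq_sigma : forall x : k, psig P x%:A = x%:A;
  cq_xi : psig P xi = xi;
  cq_gammaE : Nm (pc P) = cq_gamma%:A;
  cq_nu0 : cq_nu != 0;
  cq_nuE : Nm xi = cq_nu%:A;
  cq_fg : fin_gen V;
  cq_U0 : forall i, cq_U i <> 0;
  cq_cyc : forall i (u : vS (qv i)), exists q, u = eact q (cq_U i)
}.

(** * The brackets on the multiplicity spaces *)

Section QuiverForms.
Variables (k : fieldType) (T : twdata k) (V : twmod T) (P : polarization V).
Variables (xi : T) (Q : quiver P xi) (C : cyclic_quiver Q).
Local Notation gamma := (cq_gamma C).
Local Notation U := (@cq_U _ _ _ _ _ _ C).
Local Notation L i := (vL (qv i)).
Local Notation M i := (Mult (qv i) V).
Local Notation form i j := (@qS _ _ _ _ _ Q i j).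
Local Notation br i j := (@qbr _ _ _ _ _ Q i j).
Implicit Types (i j l : qI Q).
Let w_prim := cq_prim C.
Let n_neq0 := cq_n C.
Let y_unit := cq_unit C.
Let y_eigen := cq_eigen C.
Let sigma_k := cq_sigma C.
Let gammaE := cq_gammaE C.
Let V_fg := cq_fg C.
Let U_neq0 := @cq_U0 _ _ _ _ _ _ C.
Let U_cyc := @cq_cyc _ _ _ _ _ _ C.

Lemma quiver_D_eq_L i : D_eq_L i.
Proof. exact: (cyclic_D_eq_L n_neq0 (@U_neq0 i) (@U_cyc i)). Qed.

Lemma qS_adjoint i j (z : Lbeta T) u v : j = qdia i ->
  form i j u (bact z v) = form i j (bact (qsc Q z) u) v.
Proof.
move=> ji; have [hDl hDr hZl hZr hth] := qS_adm ji.
exact: (form_adjoint sigma_k gammaE (qsc_spec Q) hDl hDr hZl hZr hth).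
Qed.

Lemma form0l i j v : j = qdia i -> form i j 0 v = 0.
Proof.
move=> ji; have [hDl _ _ _ _] := qS_adm ji.
by apply: (addIr (form i j 0 v)); rewrite -hDl !add0r.
Qed.

Lemma form0r i j u : j = qdia i -> form i j u 0 = 0.
Proof.
move=> ji; have [_ hDr _ _ _] := qS_adm ji.
by apply: (addIr (form i j u 0)); rewrite -hDr !add0r.
Qed.

Lemma qS_nondegl i j u : j = qdia i -> (forall v, form i j u v = 0) -> u = 0.
Proof.
move=> ji u0; have [hDl hDr hZl hZr hth] := qS_adm ji.
have [_ /(_ (fun=> 0))[v v'|a v|u' [_ u'U]]] := qS_perfect ji; rewrite /= ?addr0 ?mulr0 //.
rewrite -(u'U u) => [|v]; last by rewrite u0.
by apply: u'U => v; rewrite form0l.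
Qed.

(** Adjunction moves z to the first argument, where nondegeneracy shows that sigma_c(z) acts as
    zero; hence sigma_c descends to a map from L_j to L_i. *)
Lemma qsc_ker i j (z : Lbeta T) : j = qdia i ->
  vpr (qv j) z = 0 -> vpr (qv i) (qsc Q z) = 0.
Proof.
move=> ji z0; apply: (lact_eq0 (@U_neq0 i)); rewrite lactE; apply: (qS_nondegl ji) => v.
by rewrite -qS_adjoint // vS_factor // form0r.
Qed.

(* The isomorphism L_j -> L_i induced by sigma_c, for j = qdia i. *)
Definition rsc i j (a : L j) : L i := vpr (qv i) (qsc Q (vlift a)).

Lemma rscE i j (z : Lbeta T) : j = qdia i ->
  rsc i (vpr (qv j) z) = vpr (qv i) (qsc Q z).
Proof.
move=> ji; apply/eqP; rewrite -subr_eq0 -rmorphB -rmorphB; apply/eqP/(qsc_ker ji).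
by rewrite rmorphB /= vliftK subrr.
Qed.

Lemma cq_gamma_neq0 : gamma != 0.
Proof.
have := pc_unit P; apply: contraTneq => g0; rewrite -(unitrX_pos _ (tn_gt0 T)).
have := gammaE; rewrite g0 scale0r => NmP.
have := pc_norm P; rewrite NmP expr0n (gtn_eqF (tN_gt0 T)) sigma_k => /esym/eqP.
by rewrite mulr_algl scalerA scaler_eq0 oner_eq0 orbF mulf_eq0 (negPf (tbeta_neq0 T)).
Qed.

Lemma qscK (z : Lbeta T) : qsc Q (qsc Q z) = z.
Proof. exact: sigma_invol sigma_k gammaE cq_gamma_neq0 (qsc_spec Q) z. Qed.

Lemma rsc_surj i j (a : L i) : j = qdia i -> exists c : L j, a = rsc i c.
Proof.
move=> ji; exists (vpr (qv j) (qsc Q (vlift a))).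
by rewrite rscE // qscK vliftK.
Qed.

Lemma qbr'E i j (x : M i) (x' : M j) : j = qdia i ->
  @qbr' _ _ _ _ _ Q i j x x' = lact (br i j x x').
Proof.
move=> ji; have := qbr_spec ji x x'.
have [a [-> _]] := quiver_D_eq_L (@qbr' _ _ _ _ _ Q i j x x').
by move=> /(is_trd_lact (@quiver_D_eq_L i)) ->.
Qed.

Lemma qbrE i j (x : M i) (x' : M j) u v : j = qdia i ->
  pform P (x u) (x' v) = form i j (lact (br i j x x') u) v.
Proof. by move=> ji; rewrite (qbr'_spec ji) qbr'E. Qed.

(** Nondegeneracy turns the defining identity of the bracket into a characterization, to which its
    additivity, semilinearity and invariance rules reduce. *)
Lemma qbr_uniq i j (x : M i) (x' : M j) a : j = qdia i ->
  (forall u v, pform P (x u) (x' v) = form i j (lact a u) v) -> br i j x x' = a.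
Proof.
move=> ji aE; apply: (lact_inj (@U_neq0 i)); have [hDl hDr hZl hZr hth] := qS_adm ji.
apply/eqP; rewrite -subr_eq0; apply/eqP/(qS_nondegl ji) => v.
by rewrite hDl -scaleN1r hZl -qbrE // aE mulN1r subrr.
Qed.

Lemma pform0l (x : V) : pform P 0 x = 0.
Proof. by apply: (addIr (pform P 0 x)); rewrite -pformDl !add0r. Qed.

Lemma pform0r (x : V) : pform P x 0 = 0.
Proof. by rewrite pform_sym pform0l rmorph0 mulr0. Qed.

Lemma pformDr (x x' x'' : V) : pform P x (x' + x'') = pform P x x' + pform P x x''.
Proof.
by rewrite pform_sym pformDl rmorphD mulrDr -!pform_sym.
Qed.

Lemma pformZr (a : T) (x x' : V) : pform P x (a *: x') = psig P a * pform P x x'.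
Proof. by rewrite pform_sym pformZl rmorphM mulrCA -pform_sym. Qed.

Lemma pform_sumr (I : Type) (r : seq I) (F : I -> V) x :
  pform P x (\sum_(i <- r) F i) = \sum_(i <- r) pform P x (F i).
Proof. by apply: (big_morph (pform P x)) => [x' x''|]; rewrite ?pformDr ?pform0r. Qed.

Lemma pform_adjoint (z : Lbeta T) (x x' : V) :
  pform P x (bact z x') = pform P (bact (qsc Q z) x) x'.
Proof.
exact: (form_adjoint sigma_k gammaE (qsc_spec Q) (@pformDl _ _ _ P) pformDr
  (@pformZl _ _ _ P) pformZr (@pform_th _ _ _ P)).
Qed.

Lemma qbrDl i j (x1 x2 : M i) (x' : M j) : j = qdia i ->
  br i j (x1 + x2) x' = br i j x1 x' + br i j x2 x'.
Proof.
move=> ji; have [hDl hDr hZl hZr hth] := qS_adm ji; apply: qbr_uniq => // u v.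
by rewrite lactD hDl -!qbrE // -pformDl.
Qed.

Lemma qbrDr i j (x : M i) (x1 x2 : M j) : j = qdia i ->
  br i j x (x1 + x2) = br i j x x1 + br i j x x2.
Proof.
move=> ji; have [hDl hDr hZl hZr hth] := qS_adm ji; apply: qbr_uniq => // u v.
by rewrite lactD hDl -!qbrE // -pformDr.
Qed.

Lemma qbrZl i j a (x : M i) (x' : M j) : j = qdia i ->
  br i j (a *: x) x' = a * br i j x x'.
Proof.
move=> ji; apply: qbr_uniq => // u v.
by rewrite mulrC lactM -qbrE.
Qed.

Lemma qbrZr i j a (x : M i) (x' : M j) : j = qdia i ->
  br i j x (a *: x') = rsc i a * br i j x x'.
Proof.
move=> ji; apply: qbr_uniq => // u v.
rewrite -[(a *: x') v]/(x' (lact a v)) qbrE // -(vliftK a) lactE qS_adjoint //.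
by rewrite lactM -lactE rscE.
Qed.

Lemma qbr0l i j (x' : M j) : j = qdia i -> br i j 0 x' = 0.
Proof. by move=> ji; rewrite -(scale0r 0) qbrZl // mul0r. Qed.

Lemma qbr0r i j (x : M i) : j = qdia i -> br i j x 0 = 0.
Proof.
by move=> ji; apply: (addIr (br i j x 0)); rewrite -qbrDr // !add0r.
Qed.

Lemma qbr_suml i j (I : Type) (r : seq I) (F : I -> M i) (x : M j) : j = qdia i ->
  br i j (\sum_(t <- r) F t) x = \sum_(t <- r) br i j (F t) x.
Proof.
by move=> ji; apply: (big_morph (fun z => br i j z x)) => [z z'|]; rewrite ?qbrDl ?qbr0l.
Qed.

Lemma qbr_sumr i j (I : Type) (r : seq I) (F : I -> M j) (x : M i) : j = qdia i ->
  br i j x (\sum_(t <- r) F t) = \sum_(t <- r) br i j x (F t).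
Proof.
by move=> ji; apply: (big_morph (br i j x)) => [z z'|]; rewrite ?qbrDr ?qbr0r.
Qed.

Lemma in_H_qbr g i j (x : M i) (x' : M j) : j = qdia i -> in_H P g ->
  br i j (hom_comp g x) (hom_comp g x') = br i j x x'.
Proof.
move=> ji [_ gP]; apply: qbr_uniq => // u v; by rewrite /= gP qbrE.
Qed.

Lemma idem_ex i : exists e : Lbeta T,
  vpr (qv i) e = 1 /\ forall j, j != i -> vpr (qv j) e = 0.
Proof.
have [e [eE _]] := @qv_prod _ _ _ _ _ Q (fun j => (j == i)%:R).
by exists e; split=> [|j /negPf ji]; rewrite eE ?eqxx ?ji.
Qed.
Definition idem i : Lbeta T := sval (cid (idem_ex i)).
Lemma idem_id i : vpr (qv i) (idem i) = 1.
Proof. by case: (svalP (cid (idem_ex i))). Qed.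
Lemma idem_neq i j : j != i -> vpr (qv j) (idem i) = 0.
Proof. by case: (svalP (cid (idem_ex i))) => _; apply. Qed.

Lemma vpr_inj (z z' : Lbeta T) : (forall i, vpr (qv i) z = vpr (qv i) z') -> z = z'.
Proof.
move=> zz; have [e [_ eU]] := @qv_prod _ _ _ _ _ Q (fun i => vpr (qv i) z).
by rewrite -(eU z) // -(eU z') // => i; rewrite zz.
Qed.

Lemma vfac_idem i (x : V) : vfac (qv i) (bact (idem i) x).
Proof.
move=> z z0; rewrite -bactLM (_ : z * idem i = 0).
  by rewrite -(scale0r 1) bact_alg scale0r scale0r.
apply: vpr_inj => j; rewrite rmorphM rmorph0 /=.
by have [->|ji] := eqVneq j i; rewrite ?z0 ?mul0r // idem_neq ?mulr0.
Qed.

Lemma idem_sum (x : V) : x = \sum_i bact (idem i) x.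
Proof.
have bs (I : Type) (r : seq I) (F : I -> Lbeta T) :
    \sum_(i <- r) bact (F i) x = bact (\sum_(i <- r) F i : Lbeta T) x.
  elim: r => [|a r IH]; first by rewrite !big_nil -(scale0r 1) bact_alg !scale0r.
  by rewrite !big_cons bactD IH.
rewrite bs (_ : \sum_i idem i = 1).
  by have := bact_alg 1 x; rewrite !scale1r.
apply: vpr_inj => j; rewrite rmorph_sum rmorph1 (bigD1 j) //= idem_id big1 ?addr0 //.
by move=> i ij; rewrite idem_neq // eq_sym.
Qed.

(** The adjoint of the idempotent of [l] is its image under sigma_c, which vanishes in L_i unless l
    is the dual vertex of i. *)
Lemma vfac_orth i l (x x' : V) : vfac (qv i) x -> vfac (qv l) x' -> l != qdia i ->
  pform P x x' = 0.
Proof.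
move=> xi' xl li; rewrite -(vfac_bact_id xl (idem_id l)) pform_adjoint xi' ?pform0l //.
by apply: (@qsc_ker i (qdia i)) => //; apply: idem_neq; rewrite eq_sym.
Qed.

(** Only the part of V at the dual vertex can pair with [x]. By [vfac_gen] it is spanned over F by
    values of homomorphisms, on which the pairing is governed by the bracket. *)
Lemma qbr_nondegl i j (x : M i) : j = qdia i -> (forall x' : M j, br i j x x' = 0) -> x = 0.
Proof.
move=> ji x0; apply: (hom_ext (@U_cyc i)); apply: (@pform_nondeg _ _ _ P) => z.
rewrite (idem_sum z) pform_sumr big1 // => l _.
have [lj|lj] := eqVneq l j; last first.
  by apply: (@vfac_orth i l); [exact: vfac_hom | exact: vfac_idem | rewrite -ji].
have [f ->] := vfac_gen w_prim n_neq0 y_unit y_eigen (@U_neq0 l) (@U_cyc l) (@vfac_idem l z).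
rewrite pform_sumr big1 // => s _; rewrite pformZr; move: (f s) => {}f.
by rewrite lj in f *; rewrite qbrE // x0 lact0 form0l // mulr0.
Qed.

Lemma qbr_nondegr i j (x' : M j) : j = qdia i -> (forall x : M i, br i j x x' = 0) -> x' = 0.
Proof.
move=> ji x0; apply: (hom_ext (@U_cyc j)); apply: (@pform_nondeg _ _ _ P) => z.
suff z0 : pform P z (x' (U j)) = 0 by rewrite pform_sym z0 rmorph0 mulr0.
rewrite pform_sym (idem_sum z) pform_sumr big1 ?rmorph0 ?mulr0 // => l _.
have [li|li] := eqVneq l i; last first.
  apply: (@vfac_orth j l); [exact: vfac_hom | exact: vfac_idem | by rewrite ji qdiaK].
have [f ->] := vfac_gen w_prim n_neq0 y_unit y_eigen (@U_neq0 l) (@U_cyc l) (@vfac_idem l z).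
rewrite pform_sumr big1 // => s _; rewrite pformZr; move: (f s) => {}f.
rewrite li in f *; rewrite pform_sym qbrE // x0 lact0 form0l // rmorph0 mulr0 mulr0 //.
Qed.

Lemma qmult_basis i : exists r (e : 'I_r -> M i), lbasis e.
Proof.
exact: (mult_basis w_prim n_neq0 y_unit y_eigen (@U_neq0 i) (@U_cyc i) V_fg (idem_id i)
  (@vfac_idem i)).
Qed.

Lemma lbasis0 i r (e : 'I_r -> M i) (c : 'rV_r) :
  lbasis e -> \sum_t c 0 t *: e t = 0 -> c = 0.
Proof.
move=> eb c0; have [d [_ dU]] := eb 0; rewrite -(dU c) ?c0 //.
by apply: dU; rewrite big1 // => t _; rewrite mxE scale0r.
Qed.

Lemma gram_unit i r (e : 'I_r -> M i) : qdia i = i -> lbasis e -> gram e \in unitmx.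
Proof.
move=> ii eb; rewrite -row_free_unit; apply: inj_row_free => c c0.
apply: (lbasis0 eb); apply: (@qbr_nondegl i i) => // x'.
have [d [-> _]] := eb x'; rewrite qbr_sumr // big1 // => t _; rewrite qbrZr //.
have /matrixP/(_ 0 t) := c0; rewrite !mxE => ct.
rewrite qbr_suml // (_ : \sum_(_ <- _) _ = 0) ?mulr0 // -[RHS]ct.
by apply: eq_bigr => s _; rewrite qbrZl // mxE.
Qed.

Lemma dual_basis i j : j = qdia i -> exists r (e : 'I_r -> M j) (e' : 'I_r -> M i),
  [/\ lbasis e, forall s t, br i j (e' s) (e t) = (s == t)%:R &
      forall x, x = \sum_t br i j x (e t) *: e' t].
Proof.
move=> ji; have [r [e eb]] := qmult_basis j; have [r' [f fb]] := qmult_basis i.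
pose G : 'M_(r', r) := \matrix_(s, t) br i j (f s) (e t).
have Gfree : row_free G^T.
  apply: inj_row_free => c c0.
  have /choice[c' c'E] t : exists c' : L j, c 0 t = rsc i c' by apply: rsc_surj.
  have z0 : \row_t c' t = 0.
    apply: (lbasis0 eb); apply: (qbr_nondegr ji) => x.
    have [d [-> _]] := fb x; rewrite qbr_suml // big1 // => s _; rewrite qbrZl //.
    have /matrixP/(_ 0 s) := c0; rewrite !mxE => cs.
    rewrite qbr_sumr // (_ : \sum_(_ <- _) _ = 0) ?mulr0 // -[RHS]cs.
    by apply: eq_bigr => t _; rewrite qbrZr // !mxE -c'E.
  apply/rowP => t; rewrite !mxE c'E; have /rowP/(_ t) := z0; rewrite !mxE => ->.
  by rewrite -(rmorph0 (vpr (qv j))) rscE // !rmorph0.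
have /row_fullP[B BG] : row_full G by rewrite /row_full -mxrank_tr; exact: Gfree.
pose e' t := \sum_s B t s *: f s.
have dual s t : br i j (e' s) (e t) = (s == t)%:R.
  have /matrixP/(_ s t) := BG; rewrite !mxE => <-; rewrite qbr_suml //.
  by apply: eq_bigr => s' _; rewrite qbrZl // mxE.
exists r, e, e'; split=> // x; apply/eqP; rewrite -subr_eq0; apply/eqP.
apply: (qbr_nondegl ji) => x'; have [d [-> _]] := eb x'.
rewrite qbr_sumr // big1 // => t _; rewrite qbrZr // qbrDl // -scaleN1r qbrZl // qbr_suml //.
rewrite (bigD1 t) //= qbrZl // dual eqxx mulr1 big1 ?addr0 ?mulN1r ?subrr ?mulr0 // => s st.
by rewrite qbrZl // dual (negPf st) mulr0.
Qed.
End QuiverForms.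

(** * Fixed vertices *)

Lemma lrmorphism_ex (K : fieldType) (L L' : fieldExtType K) (f : L -> L') :
  (forall a b, f (a + b) = f a + f b) -> (forall a b, f (a * b) = f a * f b) ->
  (forall (c : K) a, f (c *: a) = c *: f a) -> f 1 = 1 ->
  exists h : {lrmorphism L -> L'}, f =1 h.
Proof.
move=> fD fM fZ f1.
have fB : zmod_morphism f by move=> a b; rewrite fD -scaleN1r fZ scaleN1r.
have fMon : monoid_morphism f by split.
have fS : scalable f by move=> c a; apply: fZ.
pose h1 := GRing.isZmodMorphism.Build _ _ _ fB.
pose h2 := GRing.isMonoidMorphism.Build _ _ _ fMon.
pose h3 := GRing.isScalable.Build _ _ _ _ _ fS.
pose h : {lrmorphism L -> L'} := HB.pack f h1 h2 h3.
by exists h.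
Qed.

Lemma grp_iso_refl (K : fieldType) (G : grpfun K) : grp_iso G G.
Proof. by exists (fun R => id); split=> // R y yG; exists y. Qed.

Section FixedVertex.
Variables (k : fieldType) (T : twdata k) (V : twmod T) (P : polarization V).
Variables (xi : T) (Q : quiver P xi) (C : cyclic_quiver Q).
Local Notation L i := (vL (qv i)).
Local Notation S i := (vS (qv i)).
Local Notation M i := (Mult (qv i) V).
Local Notation form i j := (@qS _ _ _ _ _ Q i j).
Local Notation br i j := (@qbr _ _ _ _ _ Q i j).
Implicit Types (i j l : qI Q).

Lemma cyclic_sym i (B : S i -> S i -> T) :
  (forall u u' v, B (u + u') v = B u v + B u' v) ->
  (forall u v v', B u (v + v') = B u v + B u v') ->
  (forall a u v, B (a *: u) v = a * B u v) ->
  (forall a u v, B u (a *: v) = a * B u v) ->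
  (forall (z : Lbeta T) u v, B u (bact z v) = B (bact z u) v) ->
  forall u v, B u v = B v u.
Proof.
move=> BDl BDr BZl BZr Bz.
have B0l v : B 0 v = 0 by apply: (addIr (B 0 v)); rewrite -BDl !add0r.
have B0r u : B u 0 = 0 by apply: (addIr (B u 0)); rewrite -BDr !add0r.
have Bq q u v : B u (eact q v) = B (eact q u) v.
  rewrite /eact (big_morph (B u) (BDr u) (B0r u)).
  rewrite (big_morph (B^~ v) (fun u u' => BDl u u' v) (B0l v)); apply: eq_bigr => j _.
  rewrite BZl BZr; congr (_ * _).
  by have := Bz (in_qpoly (Lpoly T) 'X^j) u v; rewrite !bact_mod !bactXn.
move=> u v; have [q ->] := @cq_cyc _ _ _ _ _ _ C i u.
have [q' ->] := @cq_cyc _ _ _ _ _ _ C i v.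
by rewrite Bq -eactM mulrC eactM -Bq.
Qed.

Lemma qsgn_sign i : qdia i = i -> qsgn i = 1 \/ qsgn i = -1.
Proof.
move=> ii; set X := exists h : S i -> S i -> T,
  [/\ admissible P h, perfect P h & forall u v, h v u = psig P (h u v)].
by have [/(qsgn_1 ii)|/(qsgn_N1 ii)] := pselect X; [left|right].
Qed.

Lemma qsgn_id i : qdia i = i -> (forall a, psig P a = a) -> restr_id (qsc Q) i ->
  qsgn i = 1.
Proof.
move=> ii sid rid; apply: qsgn_1 => //; exists (form i i).
have [hDl hDr hZl hZr hth] := qS_adm (esym ii).
split; [exact: qS_adm | exact: qS_perfect |]; move=> u v; rewrite sid.
apply: cyclic_sym => // [a u' v'|z u' v']; first by rewrite hZr sid.
rewrite (qS_adjoint C) // -!lactE; congr (form i i (lact _ u') v').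
by rewrite -(rscE C z (esym ii)); apply: rid.
Qed.

(** The signs of the polarization and of the pairing on S_i multiply; moving the scalar back to the
    first argument introduces sigma_c. *)
Lemma qbr_sym i (x x' : M i) (s : int) : qdia i = i -> s = peps P * qsgn i ->
  br i i x x' = s%:~R * restr (qsc Q) (br i i x' x).
Proof.
move=> ii sE; have ss : s * s = 1.
  by rewrite sE; have [->|->] := peps_sign P; have [->|->] := qsgn_sign ii.
have qq : (qsgn i) * (qsgn i) = 1 by have [->|->] := qsgn_sign ii.
have [hDl hDr hZl hZr hth] := qS_adm (esym ii).
apply: (qbr_uniq C) => // u v.
have fs u' v' : psig P (form i i v' u') = (qsgn i)%:~R * form i i u' v'.
  by rewrite (@qS_sym _ _ _ _ _ Q i i (esym ii) v' u') mulrA -intrM qq mul1r.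
have ls (m : int) a u' : m = 1 \/ m = -1 -> lact (m%:~R * a) u' = m%:~R *: lact a u'.
  by case=> ->; rewrite ?mul1r ?scale1r // mulN1r scaleN1r lactN.
rewrite pform_sym (qbrE C) // fs mulrA -intrM -sE ls; last first.
  by rewrite sE; have [->|->] := peps_sign P; have [->|->] := qsgn_sign ii; [left|right|right|left].
rewrite hZl; congr (_ * _); rewrite -{1}(vliftK (br i i x' x)) lactE.
by rewrite (qS_adjoint C) // -lactE.
Qed.

Lemma gram_sym i r (e : 'I_r -> M i) (s : int) : qdia i = i -> s = peps P * qsgn i ->
  gram e = s%:~R *: (map_mx (@restr _ _ _ _ _ Q (qsc Q) i) (gram e))^T.
Proof.
by move=> ii sE; apply/matrixP => a b; rewrite !mxE (qbr_sym _ _ ii sE).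
Qed.

Lemma L_eq_k_restr_qsc i : qdia i = i -> L_eq_k i -> restr_id (qsc Q) i.
Proof.
move=> ii Lk a; have [x ->] := Lk a.
have xE : x%:A = vpr (qv i) x%:A by rewrite rmorph_alg.
by rewrite [in LHS]xE [LHS](rscE C _ (esym ii)) (sigma_alg (cq_sigma C) (qsc_spec Q)).
Qed.

Lemma peps_sgn_cases i : qdia i = i ->
  peps P * qsgn i = 1 \/ peps P * qsgn i = -1.
Proof.
by move=> ii; have [->|->] := peps_sign P; have [->|->] := qsgn_sign ii; [left|right|right|left].
Qed.

Lemma or_by_sign_vertex i (X Y : Prop) : qdia i = i -> restr_id (qsc Q) i ->
  (peps P * qsgn i = 1 -> X) -> (peps P * qsgn i = -1 -> Y) -> @or_by_sign _ _ _ P X Y.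
Proof.
move=> ii rid XP YP; split=> [|sid e1|sid e1].
- by have [/XP|/YP] := peps_sgn_cases ii; [left|right].
- by apply: XP; rewrite e1 qsgn_id.
- by apply: YP; rewrite e1 qsgn_id.
Qed.

Lemma skew_diag0 (F : fieldType) r (A : 'M[F]_r) : 2 != 0 :> F -> A^T = - A ->
  forall t, A t t = 0.
Proof.
move=> two AT t; have /matrixP/(_ t t) := AT; rewrite !mxE => /eqP.
by rewrite -addr_eq0 -mulr2n -mulr_natl mulf_eq0 (negPf two) => /eqP.
Qed.

Lemma fixed_vertex_orth i : qdia i = i -> L_eq_k i -> vertex_orth_or_sympl i.
Proof.
move=> ii Lk; have rid := L_eq_k_restr_qsc ii Lk.
have [r [e eb]] := qmult_basis C i.
have /choice[A0 A0E] s : exists a : 'I_r -> k, forall t, gram e s t = (a t)%:A.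
  by have [a aE] := choice (fun t => Lk (gram e s t)); exists a.
pose A := \matrix_(s, t) A0 s t.
have AE : gram e = map_mx (in_alg (L i)) A.
  by apply/matrixP => s t; rewrite A0E !mxE.
have AU : A \in unitmx by rewrite -(map_unitmx (in_alg (L i))) -AE (gram_unit C).
have AS (s : int) : s = peps P * qsgn i -> A = s%:~R *: A^T.
  move=> sE; apply: (map_mx_inj (f := in_alg (L i))).
  rewrite map_mxZ -map_trmx -AE rmorph_int {1}(gram_sym e ii sE); congr (_ *: _^T).
  by apply/matrixP => a b; rewrite mxE [LHS]rid.
apply: (or_by_sign_vertex ii rid) => /esym/AS; rewrite ?scale1r ?scaleN1r => AT.
  by exists r, e, A; split=> //; exists r, A; split=> //; exact: grp_iso_refl.
have AT' : A^T = - A by rewrite [in RHS]AT opprK.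
exists r, e, A; split=> //; exists r, A; split=> //; last exact: grp_iso_refl.
exact: skew_diag0 (cq_two C) AT'.
Qed.

Lemma tens_sig_id (R : comAlgType k) (K : fieldExtType k) (s : K -> K) :
  (forall a, s a = a) -> forall x : tens R K, tens_sig s x = x.
Proof. by move=> sid x; rewrite /tens_sig; under eq_bigr do rewrite sid; rewrite -tens_sum. Qed.

(** With [s] trivial, the equations at R are those of the bilinear group at R (x) L. *)
Lemma sesq_aut_res (K : fieldExtType k) (s : K -> K) r (A : 'M[K]_r) :
  (forall a, s a = a) -> grp_iso (sesq_aut s A) (weil_res (bil_aut A)).
Proof.
move=> sid; have idm (R : comAlgType k) (g : 'M[tens R K]_r) : map_mx (tens_sig s) g = g.
  by apply/matrixP => a b; rewrite mxE tens_sig_id.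
exists (fun R => id); split=> // R x /=; first by rewrite idm.
by move=> xG; exists x; rewrite //= idm.
Qed.

Lemma fixed_vertex_res_orth i : qdia i = i -> restr_id (qsc Q) i ->
  vertex_res_orth_or_sympl i.
Proof.
move=> ii rid; have [r [e eb]] := qmult_basis C i.
have GU := gram_unit C ii eb.
have GS (s : int) : s = peps P * qsgn i -> gram e = s%:~R *: (gram e)^T.
  move=> sE; rewrite {1}(gram_sym e ii sE); congr (_ *: _^T).
  by apply/matrixP => a b; rewrite mxE [LHS]rid.
have two : 2 != 0 :> L i by rewrite -(rmorph_nat (in_alg (L i))) fmorph_eq0 (cq_two C).
apply: (or_by_sign_vertex ii rid) => /esym/GS; rewrite ?scale1r ?scaleN1r => GT.
  exists r, e; split=> //; exists (bil_aut (gram e)); last exact: sesq_aut_res.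
  by exists r, (gram e); split=> //; exact: grp_iso_refl.
have GT' : (gram e)^T = - gram e by rewrite [in RHS]GT opprK.
exists r, e; split=> //; exists (bil_aut (gram e)); last exact: sesq_aut_res.
exists r, (gram e); split=> //; last exact: grp_iso_refl.
exact: skew_diag0 two GT'.
Qed.

Lemma restr_qsc_lrmorphism i : qdia i = i ->
  exists h : {lrmorphism L i -> L i}, @restr _ _ _ _ _ Q (qsc Q) i =1 h.
Proof.
move=> ii; have E z : restr (qsc Q) (vpr (qv i) z) = vpr (qv i) (qsc Q z).
  exact: (rscE C z (esym ii)).
apply: lrmorphism_ex => [a b|a b|c a|].
- by rewrite -[a]vliftK -[b]vliftK -rmorphD !E !rmorphD.
- by rewrite -[a]vliftK -[b]vliftK -rmorphM !E !rmorphM.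
- rewrite -[a]vliftK -linearZ !E (sigmaZ (cq_sigma C) (qsc_spec Q)) linearZ //.
- by rewrite -(rmorph1 (vpr (qv i))) E !rmorph1.
Qed.

(** The defining equation is homogeneous in the Gram matrix. This lets a skew-Hermitian form be
    replaced by a Hermitian one, on multiplying by an element that [s] negates. *)
Lemma sesq_aut_scale (K : fieldExtType k) (s : K -> K) r (A : 'M[K]_r) (c : K) :
  c != 0 -> grp_iso (sesq_aut s A) (sesq_aut s (c *: A)).
Proof.
move=> c0; have cE (R : comAlgType k) (g g' : 'M[tens R K]_r) :
    g *m map_mx (in_alg (tens R K)) (c *: A) *m g' = map_mx (in_alg (tens R K)) (c *: A) <->
    g *m map_mx (in_alg (tens R K)) A *m g' = map_mx (in_alg (tens R K)) A.
  rewrite map_mxZ /= -scalemxAr -scalemxAl; split=> [|-> //].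
  move=> /(congr1 ( *:%R (in_alg (tens R K) c^-1))).
  by rewrite !scalerA -rmorphM mulVf // rmorph1 !scale1r.
exists (fun R => id); split=> // R x [xi' xA]; first by split=> //; apply/cE.
by exists x => //; split=> //; apply/cE.
Qed.

Lemma sesq_aut_ext (K : fieldExtType k) (s s' : K -> K) r (A : 'M[K]_r) :
  s =1 s' -> sesq_aut s A = sesq_aut s' A.
Proof. by move=> /funext ->. Qed.

Lemma fixed_vertex_unitary i (c : L i) : qdia i = i -> \dim {:L i} = 2 ->
  c != 0 -> restr (qsc Q) c = - c -> vertex_unitary i.
Proof.
move=> ii d2 c0 rc; have [r [e eb]] := qmult_basis C i.
have [h hE] := restr_qsc_lrmorphism ii; have GU := gram_unit C ii eb.
have two : 2 != 0 :> L i by rewrite -(rmorph_nat (in_alg (L i))) fmorph_eq0 (cq_two C).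
have hc : h c = - c by rewrite -hE.
have hcN : h c <> c.
  rewrite hc => /eqP; rewrite -subr_eq0 -opprD oppr_eq0 -mulr2n -mulr_natl mulf_eq0.
  by rewrite (negPf two) (negPf c0).
exists r, e; split=> //; rewrite (sesq_aut_ext _ hE).
have GS := gram_sym e ii erefl.
have hm (A : 'M[L i]_r) : map_mx (@restr _ _ _ _ _ Q (qsc Q) i) A = map_mx h A.
  by apply/matrixP => a b; rewrite !mxE hE.
rewrite hm in GS; have [s1|s1] := peps_sgn_cases ii; rewrite s1 ?scale1r ?scaleN1r in GS.
  exists (L i), h, r, (gram e); split; [by split=> //; exists c | exact: GU | by rewrite -GS |].
  exact: grp_iso_refl.
exists (L i), h, r, (c *: gram e); split; [by split=> //; exists c | | |exact: sesq_aut_scale].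
  by rewrite unitmxZ ?unitfE.
by rewrite map_mxZ linearZ /= hc scaleNr -scalerN -GS.
Qed.
End FixedVertex.

(** * Fixed arrows *)

Section FixedArrow.
Variables (k : fieldType) (T : twdata k) (V : twmod T) (P : polarization V).
Variables (xi : T) (Q : quiver P xi) (C : cyclic_quiver Q).
Local Notation zeta := (@tzeta k T).
Local Notation U := (@cq_U _ _ _ _ _ _ C).
Local Notation L i := (vL (qv i)).
Local Notation S i := (vS (qv i)).
Local Notation M i := (Mult (qv i) V).
Local Notation form i j := (@qS _ _ _ _ _ Q i j).
Local Notation br i j := (@qbr _ _ _ _ _ Q i j).
Local Notation eta i j := (@qeta _ _ _ _ _ Q i j).
Local Notation restrx i := (@restr _ _ _ _ _ Q (qscx Q) i).
Implicit Types (i j l : qI Q).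

Lemma xi_unit : xi \is a GRing.unit.
Proof. exact: Nm_unit (cq_nu0 C) (cq_nuE C). Qed.

Lemma eta_th i j (x : S i) : j = qxi Q i ->
  eta i j (tw_th x) = xi^-1 *: tw_th (eta i j x).
Proof.
move=> /(@qeta_iso _ _ _ _ _ Q i j)[etaD etaZ etath _].
by rewrite -etath -etaZ scalerA mulVr ?xi_unit // scale1r.
Qed.

Lemma eta_iter i j r (x : S i) : j = qxi Q i ->
  eta i j (iter r (@tw_th _ _ _) x) =
  (\prod_(m < r) iter m zeta xi^-1) *: iter r (@tw_th _ _ _) (eta i j x).
Proof.
move=> ji; elim: r => [|r IH]; first by rewrite big_ord0 scale1r.
rewrite !iterS eta_th // IH tw_thZ scalerA big_ord_recl; congr (_ * _ *: _).
by rewrite rmorph_prod; apply: eq_bigr.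
Qed.

Lemma eta_bact_b i j (x : S i) : j = qxi Q i ->
  eta i j (bact (b_ T) x) = (cq_nu C)^-1%:A *: bact (b_ T) (eta i j x).
Proof.
by move=> ji; rewrite !bact_b eta_iter // -/(Nm _) (NmV (cq_nu0 C) (cq_nuE C)).
Qed.

(** [qeta] carries b to nu^-1 b, hence the action of any polynomial in b to that of another one. *)
Lemma eta_transfer i j (z : Lbeta T) : j = qxi Q i ->
  exists z' : Lbeta T, forall u, eta i j (bact z u) = bact z' (eta i j u).
Proof.
move=> ji; have [etaD etaZ _ _] := qeta_iso ji.
elim/Lbeta_ind: z => [x|z [z' IH]|z1 z2 [z1' IH1] [z2' IH2]].
- by exists x%:A => u; rewrite !bact_alg etaZ.
- exists (z' * ((cq_nu C)^-1%:A * b_ T)) => u.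
  by rewrite !bactLM IH eta_bact_b // bact_alg.
- by exists (z1' + z2') => u; rewrite !bactD etaD IH1 IH2.
Qed.

Lemma eta_transfer_inv i j (z : Lbeta T) : j = qxi Q i ->
  exists z' : Lbeta T, forall u, eta i j (bact z' u) = bact z (eta i j u).
Proof.
move=> ji; have [etaD etaZ _ _] := qeta_iso ji.
elim/Lbeta_ind: z => [x|z [z' IH]|z1 z2 [z1' IH1] [z2' IH2]].
- by exists x%:A => u; rewrite !bact_alg etaZ.
- exists (z' * ((cq_nu C)%:A * b_ T)) => u.
  rewrite !bactLM IH; congr (bact z _).
  by rewrite bact_alg etaZ eta_bact_b // scalerA mulr_algl scalerA mulfV ?(cq_nu0 C) // !scale1r.
- by exists (z1' + z2') => u; rewrite !bactD etaD IH1 IH2.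
Qed.

(* The graph of eta^flat : L_i -> L_j. *)
Definition etaL i j (a : L i) (a' : L j) := forall u, eta i j (lact a u) = lact a' (eta i j u).

Lemma etaL_ex i j (a : L i) : j = qxi Q i -> exists a', @etaL i j a a'.
Proof.
move=> ji; have [z' zE] := eta_transfer (vlift a) ji; exists (vpr (qv j) z') => u.
by rewrite lactE -zE -lactE vliftK.
Qed.

Lemma etaL_ex_inv i j (a' : L j) : j = qxi Q i -> exists a, @etaL i j a a'.
Proof.
move=> ji; have [z' zE] := eta_transfer_inv (vlift a') ji; exists (vpr (qv i) z') => u.
by rewrite lactE zE -lactE vliftK.
Qed.

Lemma etaU_neq0 i j : j = qxi Q i -> eta i j (U i) <> 0.
Proof.
move=> ji eU; have [etaD _ _ /bij_inj etaI] := qeta_iso ji.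
apply: (@cq_U0 _ _ _ _ _ _ C i); apply: etaI; rewrite eU.
by apply: (addIr (eta i j 0)); rewrite -etaD !add0r.
Qed.

Lemma etaL_uniq i j (a : L i) (a1 a2 : L j) : j = qxi Q i -> etaL a a1 -> etaL a a2 -> a1 = a2.
Proof.
by move=> ji e1 e2; apply: (lact_inj (etaU_neq0 ji)); rewrite -e1 -e2.
Qed.

Lemma etaLD i j (a1 a2 : L i) (c1 c2 : L j) : j = qxi Q i ->
  etaL a1 c1 -> etaL a2 c2 -> etaL (a1 + a2) (c1 + c2).
Proof.
move=> ji e1 e2 u; have [etaD _ _ _] := qeta_iso ji.
by rewrite !lactD etaD e1 e2.
Qed.

Lemma etaLM i j (a1 a2 : L i) (c1 c2 : L j) : 
  etaL a1 c1 -> etaL a2 c2 -> etaL (a1 * a2) (c1 * c2).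
Proof. by move=> e1 e2 u; rewrite !lactM e1 e2. Qed.

Lemma etaL_alg i j (x : k) : j = qxi Q i -> @etaL i j x%:A x%:A.
Proof. by move=> ji u; have [_ etaZ _ _] := qeta_iso ji; rewrite !lact_alg etaZ. Qed.

(** At a fixed arrow, composing with eta gives a form on S_i alone, with constant c / xi;
    [form_adjoint] and [cyclic_sym] then apply as at a fixed vertex. *)
Definition arrow_form i j u v := form i j u (eta i j v).
Local Notation aform i j := (@arrow_form i j).

Lemma NmCx : Nm (pc P / xi) = (cq_gamma C / cq_nu C)%:A.
Proof.
by rewrite NmM (cq_gammaE C) (NmV (cq_nu0 C) (cq_nuE C)) mulr_algl scalerA.
Qed.

Lemma aform_props i j : j = qdia i -> j = qxi Q i ->
  [/\ forall u u' v, aform i j (u + u') v = aform i j u v + aform i j u' v,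
      forall u v v', aform i j u (v + v') = aform i j u v + aform i j u v',
      forall a u v, aform i j (a *: u) v = a * aform i j u v,
      forall a u v, aform i j u (a *: v) = psig P a * aform i j u v &
      forall u v, aform i j (tw_th u) (tw_th v) = (pc P / xi) * zeta (aform i j u v)].
Proof.
move=> ji jx; have [hDl hDr hZl hZr hth] := qS_adm ji.
have [etaD etaZ etath _] := qeta_iso jx; rewrite /arrow_form; split=> *;
  rewrite ?etaD ?etaZ ?hDl ?hDr ?hZl ?hZr //.
rewrite eta_th // hZr hth mulrA; congr (_ * _).
by rewrite rmorphV ?xi_unit // (cq_xi C) mulrC.
Qed.

Lemma aform_adjoint i j (z : Lbeta T) u v : j = qdia i -> j = qxi Q i ->
  aform i j u (bact z v) = aform i j (bact (qscx Q z) u) v.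
Proof.
move=> ji jx; have [hDl hDr hZl hZr hth] := aform_props ji jx.
exact: (form_adjoint (cq_sigma C) NmCx (qscx_spec Q) hDl hDr hZl hZr hth).
Qed.

Lemma aform_nondegl i j u : j = qdia i -> j = qxi Q i ->
  (forall v, aform i j u v = 0) -> u = 0.
Proof.
move=> ji jx u0; apply: (qS_nondegl ji) => v.
by have [_ _ _ [g _ gK]] := qeta_iso jx; rewrite -(gK v) [LHS]u0.
Qed.

Lemma restrxE i j (z : Lbeta T) : j = qdia i -> j = qxi Q i ->
  restrx i (vpr (qv i) z) = vpr (qv i) (qscx Q z).
Proof.
move=> ji jx; apply/eqP; rewrite /restr -subr_eq0 -rmorphB -rmorphB; apply/eqP.
set z' := _ - _; have z'0 : vpr (qv i) z' = 0 by rewrite rmorphB /= vliftK subrr.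
apply: (lact_eq0 (@cq_U0 _ _ _ _ _ _ C i)); rewrite lactE; apply: (aform_nondegl ji jx) => v.
rewrite -aform_adjoint // vS_factor //; have [_ hDr _ _ _] := aform_props ji jx.
by apply: (addIr (aform i j (U i) 0)); rewrite -hDr !add0r.
Qed.

Lemma restrx_props i j : j = qdia i -> j = qxi Q i ->
  [/\ forall a b, restrx i (a + b) = restrx i a + restrx i b,
      forall a b, restrx i (a * b) = restrx i a * restrx i b,
      forall x : k, restrx i x%:A = x%:A &
      forall a, restrx i (restrx i a) = a].
Proof.
move=> ji jx; have E z : restrx i (vpr (qv i) z) = vpr (qv i) (qscx Q z) by apply: restrxE jx.
have g0 : cq_gamma C / cq_nu C != 0 by rewrite mulf_neq0 ?invr_eq0 ?(cq_nu0 C) ?cq_gamma_neq0.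
split=> [a b|a b|x|a].
- by rewrite -[a]vliftK -[b]vliftK -rmorphD !E !rmorphD.
- by rewrite -[a]vliftK -[b]vliftK -rmorphM !E !rmorphM.
- by rewrite -(rmorph_alg (vpr (qv i))) E (sigma_alg (cq_sigma C) (qscx_spec Q)) rmorph_alg.
- by rewrite -[a]vliftK !E (sigma_invol (cq_sigma C) NmCx g0 (qscx_spec Q)).
Qed.

Lemma qbr_eta i j a a' (x : M i) (x' : M j) : j = qdia i -> j = qxi Q i -> etaL a a' ->
  br i j x (a' *: x') = restrx i a * br i j x x'.
Proof.
move=> ji jx aa; apply: (qbr_uniq C) => // u v.
have [_ _ _ [g _ gK]] := qeta_iso jx; rewrite -(gK v); move: (g v) => {}v.
rewrite -[(a' *: x') _]/(x' (lact a' _)) -aa (qbrE C) //.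
rewrite -[LHS]/(aform i j _ _) -{1}(vliftK a) lactE aform_adjoint // lactM -lactE.
by rewrite -(restrxE _ ji jx) vliftK.
Qed.

Lemma qesgn_sign i j : j = qdia i -> j = qxi Q i -> qesgn i = 1 \/ qesgn i = -1.
Proof.
move=> ji jx; have ij : qdia j = i by rewrite ji qdiaK.
set X := exists2 f : S i -> S j, twist_iso xi f &
       forall u v, form i j u (f v) = psig P (form i j v (f u)).
by have [/(qesgn_1 jx ij)|/(qesgn_N1 jx ij)] := pselect X; [left|right].
Qed.

Lemma qesgn_id i j : j = qdia i -> j = qxi Q i -> (forall a, psig P a = a) ->
  restr_id (qscx Q) i -> qesgn i = 1.
Proof.
move=> ji jx sid rid; have ij : qdia j = i by rewrite ji qdiaK.
apply: (qesgn_1 jx ij); exists (eta i j); first exact: qeta_iso.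
move=> u v; rewrite sid; have [hDl hDr hZl hZr hth] := aform_props ji jx.
apply: (cyclic_sym C (B := aform i j)) => // [a u' v'|z u' v']; first by rewrite hZr sid.
rewrite aform_adjoint // -!lactE; congr (aform i j (lact _ u') v').
by rewrite -(restrxE _ ji jx); apply: rid.
Qed.

Lemma hspaceP (s : int) i j (phi : M i -> M j) :
  hspace s phi <->
  [/\ forall x y, phi (x + y) = phi x + phi y,
      forall a a', etaL a a' -> forall x, phi (a *: x) = a' *: phi x &
      forall x y, br i j y (phi x) = s%:~R * restrx i (br i j x (phi y))].
Proof.
split=> -[pD pZ pS]; split=> //.
  by move=> a a' aa x; apply: (pZ (lact a) (lact a')).
move=> d d' dd x; have [a [da _]] := quiver_D_eq_L C d; have [a' [da' _]] := quiver_D_eq_L C d'.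
by rewrite da da' in dd *; apply: pZ.
Qed.
End FixedArrow.

(** * The space h of a fixed arrow as a symmetrized tensor square *)

Section ArrowSpace.
Variables (k : fieldType) (T : twdata k) (V : twmod T) (P : polarization V).
Variables (xi : T) (Q : quiver P xi) (C : cyclic_quiver Q).
Variables (i j : qI Q).
Hypothesis ji : j = qdia i.
Hypothesis jx : j = qxi Q i.
Local Notation L i := (vL (qv i)).
Local Notation M i := (Mult (qv i) V).
Local Notation br := (@qbr _ _ _ _ _ Q i j).
Local Notation restrx := (@restr _ _ _ _ _ Q (qscx Q) i).

(** The isomorphism eta^flat from L_i to L_j, read off its graph [etaL]. *)
Definition tau (a : L i) : L j := sval (cid (etaL_ex C a jx)).
Lemma tauP a : etaL a (tau a). Proof. exact: (svalP (cid (etaL_ex C a jx))). Qed.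

Lemma etaL_tau a a' : etaL a a' -> a' = tau a.
Proof. by move=> aa; apply: (etaL_uniq C jx aa); apply: tauP. Qed.

Lemma tauD a b : tau (a + b) = tau a + tau b.
Proof. by apply/esym/etaL_tau/(etaLD jx); apply: tauP. Qed.

Lemma tauM a b : tau (a * b) = tau a * tau b.
Proof. by apply/esym/etaL_tau/etaLM; apply: tauP. Qed.

Lemma tau_alg (x : k) : tau x%:A = x%:A.
Proof. by apply/esym/etaL_tau/etaL_alg. Qed.

Lemma tau_surj a' : exists a, a' = tau a.
Proof. by have [a aa] := etaL_ex_inv C a' jx; exists a; apply: etaL_tau. Qed.

Lemma br_tau a x x' : br x (tau a *: x') = restrx a * br x x'.
Proof. by apply: (qbr_eta C) => //; apply: tauP. Qed.

Lemma hspace_tauP (s : int) (phi : M i -> M j) :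
  hspace s phi <->
  [/\ forall x y, phi (x + y) = phi x + phi y,
      forall a x, phi (a *: x) = tau a *: phi x &
      forall x y, br y (phi x) = s%:~R * restrx (br x (phi y))].
Proof.
split=> [/(hspaceP C)[pD pZ pS]|[pD pZ pS]]; first by split=> // a x; apply/pZ/tauP.
by apply/(hspaceP C); split=> // a a' /etaL_tau ->.
Qed.

Lemma br_ext x' x'' : (forall x, br x x' = br x x'') -> x' = x''.
Proof.
move=> xx; apply/eqP; rewrite -subr_eq0; apply/eqP/(qbr_nondegr C ji) => x.
by rewrite (qbrDr C) // -scaleN1r (qbrZr C) // xx /rsc -[-1]scaleN1r -(rmorph_alg (vpr (qv j)))
  -/(rsc i _) (rscE C) // (sigma_alg (cq_sigma C) (qsc_spec Q)) rmorph_alg scaleN1r mulN1r subrr.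
Qed.

Section Squares.
Variable s : int.
Hypothesis s_sign : s = 1 \/ s = -1.
Hypothesis rid : restr_id (qscx Q) i.

(** The bracket identifies Hom(M_i, M_j) with the tensor square of M_j; this is the image of p (x) q
    + s q (x) p. *)
Definition sqmap (p q : M j) : M i -> M j :=
  fun x => tau (br x p) *: q + s%:~R *: (tau (br x q) *: p).

Let br_tau_id a x x' : br x (tau a *: x') = a * br x x'.
Proof. by rewrite br_tau rid. Qed.

Let ss (R : pzRingType) : s%:~R * s%:~R = 1 :> R.
Proof. by rewrite -intrM; case: s_sign => ->. Qed.

Let brs x x' : br x (s%:~R *: x') = s%:~R * br x x'.
Proof.
have -> : s%:~R = tau s%:~R.
  have -> : (s%:~R : L i) = (s%:~R : k)%:A by rewrite -(rmorph_int (in_alg (L i))).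
  by rewrite tau_alg -(rmorph_int (in_alg (L j))).
by rewrite br_tau_id.
Qed.

Lemma hspace_subspace : hspace s (0 : M i -> M j) /\
  forall (a : L j) (phi psi : M i -> M j), hspace s phi -> hspace s psi ->
    hspace s (a *: phi + psi).
Proof.
split.
  apply/hspace_tauP; split=> [x x'|a x|x x'] /=; rewrite ?addr0 ?scaler0 //.
  by rewrite !(qbr0r C) // rid mulr0.
move=> a phi psi /hspace_tauP[pD pZ pS] /hspace_tauP[qD qZ qS].
have [c ->] := tau_surj a.
have vE x : (tau c *: phi + psi) x = tau c *: phi x + psi x by [].
apply/hspace_tauP; split=> [x x'|b x|x x']; rewrite !vE.
- by rewrite pD qD scalerDr addrACA.
- by rewrite pZ qZ scalerDr !scalerA mulrC.
- by rewrite !(qbrDr C) // !br_tau_id pS qS !rid mulrDr mulrCA.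
Qed.

Lemma sqmap_hspace p q : hspace s (sqmap p q).
Proof.
apply/hspace_tauP; rewrite /sqmap; split=> [x x'|a x|x x'].
- by rewrite !(qbrDl C) // !tauD !scalerDl scalerDr addrACA.
- by rewrite !(qbrZl C) // !tauM scalerDr !scalerA; congr (_ + _ *: _); rewrite -mulrA mulrCA.
- rewrite !(qbrDr C) // !brs !br_tau_id rid.
  move: (s%:~R : L i) (ss (L i)) => c cc; rewrite -[br x p * _]mul1r -cc; ring.
Qed.

Lemma sqmap_sym p q : sqmap q p = s%:~R *: sqmap p q.
Proof.
apply/funext => x; rewrite -[RHS]/(s%:~R *: sqmap p q x) /sqmap scalerDr.
by rewrite [s%:~R *: (s%:~R *: _)]scalerA ss scale1r addrC.
Qed.

Lemma sqmap_bilinear : bilinear_map (N := (M i -> M j : lmodType (L j))) sqmap.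
Proof.
have lin a p p' q : sqmap (a *: p + p') q = a *: sqmap p q + sqmap p' q.
  apply/funext => x; rewrite -[RHS]/(a *: sqmap p q x + sqmap p' q x) /sqmap.
  have [c ->] := tau_surj a.
  rewrite (qbrDr C) // br_tau_id tauD tauM scalerDl !scalerDr -!addrA; congr (_ + _).
    by rewrite scalerA.
  rewrite addrCA; congr (_ + _).
  by rewrite !scalerA [in LHS]mulrC mulrA.
split=> // a p q q'.
have E p' : sqmap p p' = s%:~R *: sqmap p' p by exact: sqmap_sym.
by rewrite !E lin scalerDr !scalerA mulrC.
Qed.

(** For dual bases e and e', every [phi] in the space is half the sum of the
    [sqmap (e t) (phi (e' t))]. The formula dictates the factorization and forces its uniqueness. *)
Lemma sqmap_universal (N : lmodType (L j)) (h : M j -> M j -> N) :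
  2 != 0 :> L j ->
  bilinear_map h -> (forall p q, h q p = s%:~R *: h p q) ->
  let fact (f : (M i -> M j) -> N) :=
    (forall (a : L j) x y, hspace s x -> hspace s y -> f (a *: x + y) = a *: f x + f y) /\
    (forall x y, f (sqmap x y) = h x y) in
  (exists f, fact f) /\
  (forall f f', fact f -> fact f' -> forall x, hspace s x -> f x = f' x).
Proof.
move=> two [hl hr] hs fact; have [r [e [e' [eb dual xE]]]] := dual_basis C ji.
have hDl p p' q : h (p + p') q = h p q + h p' q by rewrite -[p]scale1r hl !scale1r.
have hDr p q q' : h p (q + q') = h p q + h p q' by rewrite -[q]scale1r hr !scale1r.
have h0l q : h 0 q = 0 by apply: (addIr (h 0 q)); rewrite -hDl !add0r.
have h0r p : h p 0 = 0 by apply: (addIr (h p 0)); rewrite -hDr !add0r.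
have hZl a p q : h (a *: p) q = a *: h p q by rewrite -[a *: p]addr0 hl h0l addr0.
have hZr a p q : h p (a *: q) = a *: h p q by rewrite -[a *: q]addr0 hr h0r addr0.
have pE p : p = \sum_t tau (br (e' t) p) *: e t.
  apply: br_ext => x; rewrite (qbr_sumr C) // [in LHS](xE x) (qbr_suml C) //.
  by apply: eq_bigr => t _; rewrite br_tau_id (qbrZl C) // mulrC.
have half (W : lmodType (L j)) (z : W) : 2^-1 *: (z + z) = z.
  have -> : z + z = 2 *: z by rewrite scaler_nat.
  by rewrite scalerA mulVf // scale1r.
have phiE phi : hspace s phi -> phi = 2^-1 *: \sum_t sqmap (e t) (phi (e' t)).
  move=> /hspace_tauP[pD pZ pS]; apply/funext => x.
  have phi0 : phi 0 = 0 by apply: (addIr (phi 0)); rewrite -pD !add0r.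
  rewrite -[RHS]/(2^-1 *: (\sum_t sqmap (e t) (phi (e' t))) x).
  have -> : (\sum_t sqmap (e t) (phi (e' t))) x = \sum_t sqmap (e t) (phi (e' t)) x.
    exact: (big_morph (fun f : M i -> M j => f x)).
  rewrite /sqmap big_split /= -scaler_sumr.
  have -> : \sum_t tau (br x (e t)) *: phi (e' t) = phi x.
    rewrite [in RHS](xE x) (big_morph phi pD phi0); apply: eq_bigr => t _.
    by rewrite pZ.
  (* The s-symmetry of [phi] turns {x, phi e'_t} into s {e'_t, phi x}, so the second half of the sum
     repeats the first. *)
  have -> : \sum_t tau (br x (phi (e' t))) *: e t = s%:~R *: phi x.
    rewrite [in RHS](pE (phi x)) scaler_sumr; apply: eq_bigr => t _.
    rewrite (pS (e' t) x) rid tauM scalerA; congr (_ *: _); congr (_ * _).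
    have -> : (s%:~R : L i) = (s%:~R : k)%:A by rewrite -(rmorph_int (in_alg (L i))).
    by rewrite tau_alg -(rmorph_int (in_alg (L j))).
  by rewrite scalerA ss scale1r half.
split.
  exists (fun phi => 2^-1 *: \sum_t h (e t) (phi (e' t))); split.
    move=> a phi psi _ _; rewrite scalerA mulrC -scalerA -scalerDr.
    rewrite [a *: \sum_(_ <- _ | _) _]scaler_sumr -big_split.
    by congr (_ *: _); apply: eq_bigr => t _; exact: hr.
  move=> p q; rewrite /sqmap; under eq_bigr do rewrite hDr !hZr -!hZl.
  rewrite big_split /= -(big_morph (h^~ q) (fun p p' => hDl p p' q) (h0l q)) -pE.
  rewrite -(big_morph (h^~ p) (fun q q' => hDl q q' p) (h0l p)) -scaler_sumr -pE.
  by rewrite hZl (hs p q) [X in _ + X]scalerA ss scale1r half.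
move=> f f' [fl fw] [fl' fw'] phi /phiE ->.
have [H0 HD] := hspace_subspace.
have lin0 (g : (M i -> M j) -> N) :
   (forall (a : L j) x y, hspace s x -> hspace s y -> g (a *: x + y) = a *: g x + g y) ->
   g 0 = 0.
  by move=> gl; have := gl (-1) 0 0 H0 H0; rewrite scaler0 addr0 scaleN1r addNr.
have [HS fS] : hspace s (\sum_t sqmap (e t) (phi (e' t))) /\
    f (\sum_t sqmap (e t) (phi (e' t))) = f' (\sum_t sqmap (e t) (phi (e' t))).
  elim/big_ind: _ => [|x x' [Hx fx] [Hx' fx']|t _].
  - by split; rewrite // (lin0 f) // (lin0 f').
  - split; first by rewrite -[x]scale1r; apply: HD.
    by rewrite -[x]scale1r fl // fl' // fx fx'.
  - by split; [exact: sqmap_hspace | rewrite fw fw'].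
by rewrite -[2^-1 *: _]addr0 fl // fl' // fS (lin0 f) // (lin0 f').
Qed.

Lemma sqmap_equivariant : equivariant_square sqmap.
Proof.
move=> g gH x y z; rewrite /sqmap !(in_H_qbr C) //.
apply: hom_eqP => u /=.
by rewrite homD; congr (_ + _).
Qed.
End Squares.
End ArrowSpace.

Section ArrowTypes.
Variables (k : fieldType) (T : twdata k) (V : twmod T) (P : polarization V).
Variables (xi : T) (Q : quiver P xi) (C : cyclic_quiver Q).
Local Notation L i := (vL (qv i)).
Local Notation M i := (Mult (qv i) V).
Local Notation br i j := (@qbr _ _ _ _ _ Q i j).
Local Notation restrx i := (@restr _ _ _ _ _ Q (qscx Q) i).
Implicit Types (i j l : qI Q).

Lemma two_neq0 i : 2 != 0 :> L i.
Proof. by rewrite -(rmorph_nat (in_alg (L i))) fmorph_eq0 (cq_two C). Qed.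

Lemma hspace_ext2 i j : j = qdia i -> j = qxi Q i -> restr_id (qscx Q) i ->
  hspace_is_ext2 (-1) i j.
Proof.
move=> ji jx rid; have s1 : (-1 : int) = 1 \/ (-1 : int) = -1 by right.
exists (sqmap C jx (-1)); last exact: (sqmap_equivariant C ji jx _).
split; [exact: (hspace_subspace C ji jx _ rid) | exact: (sqmap_hspace C ji jx s1 rid) | split |].
- exact: (sqmap_bilinear C ji jx s1 rid).
- move=> p; apply/funext => x; have := congr1 (fun f => f x) (sqmap_sym C jx s1 p p).
  rewrite -[((-1)%:~R *: _) x]/((-1)%:~R *: sqmap C jx (-1) p p x) mulrN1z scaleN1r => /eqP.
  by rewrite -addr_eq0 -mulr2n -scaler_nat scaler_eq0 (negPf (two_neq0 j)) => /eqP.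
- move=> N h [hb h0]; apply: (sqmap_universal C ji jx s1 rid (two_neq0 j) hb) => p q.
  have [hl hr] := hb.
  have hDl p1 p2 q1 : h (p1 + p2) q1 = h p1 q1 + h p2 q1 by rewrite -[p1]scale1r hl !scale1r.
  have hDr p1 q1 q2 : h p1 (q1 + q2) = h p1 q1 + h p1 q2 by rewrite -[q1]scale1r hr !scale1r.
  have /eqP := h0 (p + q); rewrite hDl !hDr !h0 addr0 add0r addrC addr_eq0 => /eqP ->.
  by rewrite mulrN1z scaleN1r.
Qed.

Lemma hspace_sym2 i j : j = qdia i -> j = qxi Q i -> restr_id (qscx Q) i ->
  hspace_is_sym2 1 i j.
Proof.
move=> ji jx rid; have s1 : (1 : int) = 1 \/ (1 : int) = -1 by left.
exists (sqmap C jx 1); last exact: (sqmap_equivariant C ji jx _).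
split; [exact: (hspace_subspace C ji jx _ rid) | exact: (sqmap_hspace C ji jx s1 rid) | split |].
- exact: (sqmap_bilinear C ji jx s1 rid).
- by move=> p q; rewrite (sqmap_sym C jx s1 q p) scale1r.
- move=> N h [hb hs]; apply: (sqmap_universal C ji jx s1 rid (two_neq0 j) hb) => p q.
  by rewrite scale1r.
Qed.

Lemma fixed_arrow_eq i : fixed_arrow i -> qdia i = qxi Q i.
Proof. by move=> fi; rewrite -{1}fi /qadia qdiaK. Qed.

Lemma peps_esgn_cases i : fixed_arrow i ->
  - (peps P * qesgn i) = 1 \/ - (peps P * qesgn i) = -1.
Proof.
move=> /fixed_arrow_eq jx.
by have [->|->] := peps_sign P; have [->|->] := qesgn_sign erefl jx; [right|left|left|right].
Qed.

Lemma fixed_arrow_ext_or_sym i : fixed_arrow i -> restr_id (qscx Q) i -> arrow_ext_or_sym i.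
Proof.
move=> fi rid; have jx := fixed_arrow_eq fi; split.
- have [->|->] := peps_esgn_cases fi; [right|left].
    exact: hspace_sym2.
  exact: hspace_ext2.
- by move=> sid ->; rewrite (qesgn_id C erefl jx sid rid); apply: hspace_ext2.
- by move=> sid ->; rewrite (qesgn_id C erefl jx sid rid); apply: hspace_sym2.
Qed.

(** {x, phi x'} is sesquilinear with symmetry sign [s], and a factor [c] with sigma(c) = s c cancels
    the sign. A Hermitian form is turned back into [phi] through dual bases. *)
Lemma hspace_herm i j (s : int) (c : L i) : j = qdia i -> j = qxi Q i ->
  s = 1 \/ s = -1 -> c != 0 -> restrx i c = s%:~R * c -> hspace_is_herm s i j.
Proof.
move=> ji jx s1 c0 rc; have [rD rM ra rK] := restrx_props C ji jx.
have ss : s%:~R * s%:~R = 1 :> L i by rewrite -intrM; case: s1 => ->.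
have rV : restrx i c^-1 = s%:~R * c^-1.
  apply: (mulfI (_ : s%:~R * c != 0)).
    by rewrite mulf_neq0 //; apply/eqP => s0; have /eqP := ss; rewrite s0 mul0r eq_sym oner_eq0.
  rewrite -rc -rM mulfV // rc mulrACA ss mulfV // mulr1.
  by have := ra 1; rewrite scale1r.
have ext := br_ext C ji; have taur := br_tau C ji jx.
have brZk (a : k) x x' : br i j x (a%:A *: x') = a%:A * br i j x x'.
  by rewrite -(tau_alg C jx) taur ra.
exists (fun phi x x' => c * br i j x (phi x')); split.
- move=> phi /(hspace_tauP C jx)[pD pZ pS]; split=> [a x x' z|x x'].
    by rewrite (qbrDl C) // (qbrZl C) // mulrDr mulrCA.
  by rewrite rM rc (pS x x') mulrCA mulrA.
- move=> a phi psi _ _; apply/funext => x; apply/funext => x'.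
  by rewrite (qbrDr C) // brZk mulrDr mulrCA.
- move=> phi psi _ _ pp; apply/funext => x'; apply: ext => x.
  by apply: (mulfI c0); have := congr1 (fun f => f x x') pp.
- move=> f [fl fs]; have [r [e [e' [eb dual xE]]]] := dual_basis C ji.
  have fDl x x' z : f (x + x') z = f x z + f x' z by rewrite -[x]scale1r fl mul1r scale1r.
  have f0l z : f 0 z = 0 by apply: (addIr (f 0 z)); rewrite -fDl !add0r.
  have fZl a x z : f (a *: x) z = a * f x z by rewrite -[a *: x]addr0 fl f0l addr0.
  have fZr a x z : f x (a *: z) = restrx i a * f x z by rewrite fs fZl rM -fs.
  have fDr x z z' : f x (z + z') = f x z + f x z' by rewrite fs fDl rD -!fs.
  pose phi (z : M i) := \sum_t tau C jx (restrx i (c^-1 * f (e' t) z)) *: e t.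
  have phiE x z : br i j x (phi z) = c^-1 * f x z.
    rewrite (qbr_sumr C) // [in RHS](xE x) (big_morph (f^~ z) (fun x x' => fDl x x' z) (f0l z)).
    rewrite mulr_sumr; apply: eq_bigr => t _.
    by rewrite taur rK fZl mulrCA mulrC mulrCA mulrA mulrC.
  exists phi; last first.
    by apply/funext => x; apply/funext => z; rewrite phiE mulrA mulfV // mul1r.
  apply/(hspace_tauP C jx); split=> [x x'|a x|x x'].
  + by apply: ext => z; rewrite (qbrDr C) // !phiE fDr mulrDr.
  + by apply: ext => z; rewrite taur !phiE fZr mulrCA.
  + by rewrite !phiE rM rV -fs !mulrA ss mul1r.
- move=> g gH phi psi _ _ gp x x'.
  by rewrite gp (in_H_qbr C).
Qed.

Lemma fixed_arrow_herm i (c : L i) : fixed_arrow i -> c != 0 -> restrx i c = - c ->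
  arrow_herm i.
Proof.
move=> fi c0 rc; have jx := fixed_arrow_eq fi.
have [rD rM ra rK] := restrx_props C erefl jx; rewrite /arrow_herm.
have [s1|s1] := peps_esgn_cases fi; rewrite s1.
  (* With sign 1 the form is Hermitian already; only sign -1 calls for the anti-invariant [c]. *)
  apply: (@hspace_herm i (qdia i) 1 1) => //; [by left | exact: oner_neq0 |].
  by have := ra 1; rewrite mul1r scale1r.
by apply: (@hspace_herm i (qdia i) (-1) c) => //; [right | rewrite mulN1r].
Qed.
End ArrowTypes.

(** * The cycle *)

Section Cycle.
Variables (k : fieldType) (T : twdata k) (V : twmod T) (P : polarization V).
Variables (xi : T) (Q : quiver P xi) (C : cyclic_quiver Q).
Local Notation N := (tm T %/ tn T)%N.
Local Notation beta := (tbeta T).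
Local Notation gamma := (cq_gamma C).
Local Notation nu := (cq_nu C).
(** [X^e - y_i] is the minimal polynomial of b_i, with e = 1 if L_i = k and e = 2 if L_i is
    quadratic. Working with y_i = b_i^e, an element of k, treats both cases at once. *)
Variables (e N' : nat) (yv : qI Q -> k).
Hypothesis NE : N = (e * N')%N.
Hypothesis yE : forall i : Q, vb (qv i) ^+ e = (yv i)%:A.
Hypothesis y_dvd : forall (i : Q) (p : {poly k}), vpr (qv i) (in_qpoly (Lpoly T) p) = 0 ->
  exists q, p = q * ('X^e - (yv i)%:P).
Hypothesis nu_prim : N.-primitive_root nu.
Implicit Types (i j l : qI Q).

Lemma vpr_Xe i (q : {poly k}) (c : k) :
  vpr (qv i) (in_qpoly (Lpoly T) (q * ('X^e - c%:P))) =
  vpr (qv i) (in_qpoly (Lpoly T) q) * (vb (qv i) ^+ e - c%:A).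
Proof.
rewrite in_qpolyM rmorphM (raddfB (in_qpoly (Lpoly T))) rmorphB /= -algLE rmorph_alg.
by rewrite (rmorphXn (in_qpoly (Lpoly T))) rmorphXn.
Qed.

(** If y_i = y_j, the idempotent of i, being zero at j, is divisible by X^e - y_j and so vanishes at
    i too, where it should be 1. *)
Lemma yv_inj : injective yv.
Proof.
move=> i j yij; apply/eqP/negPn/negP => ij.
have := idem_neq (i := i) (j := j); rewrite eq_sym ij => /(_ isT).
rewrite -(Lbeta_in (idem i)) => /y_dvd[q qE].
have := idem_id i; rewrite -(Lbeta_in (idem i)) qE vpr_Xe yE yij subrr mulr0.
by move=> /esym/eqP; rewrite oner_eq0.
Qed.

Lemma N'_gt0 : (0 < N')%N.
Proof. by have := tN_gt0 T; rewrite NE muln_gt0 => /andP[]. Qed.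

Lemma yv_exp i : yv i ^+ N' = beta.
Proof.
apply: (fmorph_inj (in_alg (vL (qv i)))).
by rewrite rmorphXn /= -yE -exprM -NE vb_exp.
Qed.

Lemma yv_neq0 i : yv i != 0.
Proof.
apply: contraNneq (tbeta_neq0 T) => y0; rewrite -(yv_exp i) y0.
by rewrite expr0n (gtn_eqF N'_gt0).
Qed.

Lemma bact_be i (u : vS (qv i)) : bact (b_ T ^+ e) u = (yv i)%:A *: u.
Proof. by rewrite -lactE rmorphXn /= yE lact_alg. Qed.

(** eta(b^e U) is computed twice: b^e is the scalar y_i on the source, and eta carries b to nu^-1
    b. *)
Lemma yv_xi i : yv (qxi Q i) = nu ^+ e * yv i.
Proof.
set j := qxi Q i; have jx : j = qxi Q i by [].
have eE m u : @qeta _ _ _ _ _ Q i j (bact (b_ T ^+ m) u) =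
    (nu^-1 ^+ m)%:A *: bact (b_ T ^+ m) (@qeta _ _ _ _ _ Q i j u).
  elim: m u => [|m IH] u.
    by have b1 (W : twmod T) (x : W) : bact (1 : Lbeta T) x = x
      by [have := bact_alg 1 x; rewrite !scale1r]; rewrite !expr0 !b1 !scale1r.
  rewrite exprS bactLM (eta_bact_b C _ jx) IH bactZr -bactLM -exprS scalerA.
  by rewrite mulr_algl scalerA -exprS.
have [_ etaZ _ _] := qeta_iso jx.
have := eE e (cq_U C i); rewrite !bact_be etaZ scalerA mulr_algl scalerA => /eqP.
rewrite -subr_eq0 -scalerBl -scalerBl -lact_alg => /eqP/(lact_eq0 (etaU_neq0 (C := C) jx))/eqP.
rewrite scaler_eq0 oner_eq0 orbF subr_eq0 => /eqP ->.
by rewrite exprVn mulrA mulfV ?mul1r // expf_neq0 // cq_nu0.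
Qed.

Lemma yv_dia i : yv i * yv (qdia i) = gamma ^+ e.
Proof.
set j := qdia i; have ji : j = qdia i by [].
have bj : vpr (qv j) (b_ T ^+ e) = vpr (qv j) (yv j)%:A by rewrite rmorphXn /= yE rmorph_alg.
have := rscE C (b_ T ^+ e) ji; rewrite bj (rscE C) //.
rewrite (sigma_alg (cq_sigma C) (qsc_spec Q)) rmorph_alg rmorphXn /=.
rewrite (sigma_b (cq_gammaE C) (qsc_spec Q)) rmorphXn rmorphM /= rmorph_alg rmorphV ?b_unit //=.
rewrite -/(vb (qv i)) exprMn exprVn yE => E.
apply: (fmorph_inj (in_alg (vL (qv i)))); rewrite rmorphM rmorphXn /= E mulrCA mulfV ?mulr1 //.
by rewrite -in_algE fmorph_eq0 yv_neq0.
Qed.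

Lemma nue_prim : N'.-primitive_root (nu ^+ e).
Proof.
have := dvdn_prim_root nu_prim (_ : N' %| N)%N; rewrite {1}NE dvdn_mull // => /(_ isT).
by rewrite NE mulnK ?N'_gt0.
Qed.

Lemma yv_iter i t : yv (iter t (qxi Q) i) = nu ^+ e ^+ t * yv i.
Proof. by elim: t => [|t IH]; rewrite ?mul1r // iterS yv_xi IH mulrA -exprS. Qed.

(** The N'-th roots of beta form a single orbit under nu^e, the factor by which [qxi] acts; so each
    root belongs to a vertex, and counting vertices becomes counting roots. *)
Lemma yv_root i x : x ^+ N' = beta -> exists t : 'I_N', x = yv (iter t (qxi Q) i).
Proof.
move=> xN; have: (x / yv i) ^+ N' = 1.
  by rewrite expr_div_n xN yv_exp mulfV ?tbeta_neq0.
by case/(prim_rootP nue_prim) => t tE; exists t; rewrite yv_iter -tE divfK ?yv_neq0.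
Qed.

Lemma vertex_ex : exists i : Q, True.
Proof.
apply: contrapT => noI; have /eqP := oner_neq0 (Lbeta T); apply.
by apply: (@vpr_inj _ _ _ _ _ Q) => i; case: noI; exists i.
Qed.

Lemma single_cycleP : single_cycle Q N'.
Proof.
have [i0 _] := vertex_ex; split; last first.
  move=> i j; have [t tE] := yv_root i (yv_exp j).
  by rewrite (yv_inj tE) -permX mem_porbit.
apply/eqP; rewrite eqn_leq; apply/andP; split.
  have /choice[t tE] i : exists t : 'I_N', yv i = yv (iter t (qxi Q) i0).
    exact/yv_root/yv_exp.
  have tI : injective t by move=> i j tij; apply: yv_inj; rewrite (tE i) (tE j) tij.
  by have := leq_card t tI; rewrite card_ord.
pose f (t : 'I_N') := iter t (qxi Q) i0.
have fI : injective f.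
  move=> t t' /(congr1 yv); rewrite !yv_iter => /(mulIf (yv_neq0 i0))/eqP.
  by rewrite (eq_prim_root_expr nue_prim) !modn_small // => /eqP/val_inj.
by have := leq_card f fI; rewrite card_ord.
Qed.

Lemma fixed_vertexE i : (qdia i == i) = (yv i ^+ 2 == gamma ^+ e).
Proof.
rewrite -(inj_eq yv_inj) -(yv_dia i) expr2 eq_sym; apply/eqP/eqP => [<- //|].
by move/(mulfI (yv_neq0 i)).
Qed.

Lemma fixed_arrowE i : (qadia i == i) = (yv i ^+ 2 == gamma ^+ e / nu ^+ e).
Proof.
have nu0 : nu ^+ e != 0 by rewrite expf_neq0 // cq_nu0.
rewrite -(inj_eq yv_inj) -(yv_dia (qxi Q i)) yv_xi mulrAC [_ / _]mulrAC mulfV // mul1r.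
by rewrite expr2; apply/eqP/eqP => [-> //|/(mulfI (yv_neq0 i)) ->].
Qed.

Lemma card_yv x : #|[set i : Q | yv i == x]| = (x ^+ N' == beta).
Proof.
have [xN|xN] := eqVneq (x ^+ N') beta.
  have [i0 _] := vertex_ex; have [t xE] := yv_root i0 xN.
  rewrite (_ : [set _ | _] = [set iter t (qxi Q) i0]) ?cards1 //.
  by apply/setP => i; rewrite !inE {1}xE (inj_eq yv_inj).
apply/eqP; rewrite cards_eq0; apply/eqP/setP => i; rewrite !inE.
by apply: contraNF xN => /eqP <-; rewrite yv_exp.
Qed.

Lemma card_yv_sqr a : a != 0 -> #|[set i : Q | yv i ^+ 2 == a ^+ 2]| =
  ((a ^+ N' == beta) + ((- a) ^+ N' == beta))%N.
Proof.
move=> a0; rewrite -!card_yv.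
have -> : [set i : Q | yv i ^+ 2 == a ^+ 2] = [set i | yv i == a] :|: [set i | yv i == - a].
  by apply/setP => i; rewrite !inE eqf_sqr.
rewrite cardsU (_ : _ :&: _ = finset.set0) ?cards0 ?subn0 //.
apply/setP => i; rewrite !inE; apply/negP => /andP[/eqP ->].
by rewrite -addr_eq0 -mulr2n -mulr_natl mulf_eq0 (negPf (cq_two C)) (negPf a0).
Qed.

Lemma card_fixed_vertices h : h != 0 -> h ^+ 2 = gamma ^+ e ->
  nb_fixed_vertices Q = ((h ^+ N' == beta) + ((- h) ^+ N' == beta))%N.
Proof.
move=> h0 h2; rewrite -card_yv_sqr // /nb_fixed_vertices.
by apply: eq_card => i; rewrite !inE fixed_vertexE h2.
Qed.

Lemma card_fixed_arrows h : h != 0 -> h ^+ 2 = gamma ^+ e / nu ^+ e ->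
  nb_fixed_arrows Q = ((h ^+ N' == beta) + ((- h) ^+ N' == beta))%N.
Proof.
move=> h0 h2; rewrite -card_yv_sqr // /nb_fixed_arrows.
by apply: eq_card => i; rewrite !inE fixed_arrowE h2.
Qed.

Lemma fixed_vertex_yv i : fixed_vertex i -> yv i ^+ 2 = gamma ^+ e.
Proof. by move=> fi; apply/eqP; rewrite -fixed_vertexE; apply/eqP. Qed.

Lemma fixed_arrow_yv i : fixed_arrow i -> yv i ^+ 2 = gamma ^+ e / nu ^+ e.
Proof. by move=> fi; apply/eqP; rewrite -fixed_arrowE; apply/eqP. Qed.

Lemma vertex_of_root x : x ^+ N' = beta -> exists i, yv i = x.
Proof.
by have [i0 _] := vertex_ex; move=> /(yv_root i0)[t ->]; exists (iter t (qxi Q) i0).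
Qed.
End Cycle.

(** * Quadratic extensions *)

Section QuadraticExtension.
Variables (k : fieldType) (L : fieldExtType k) (b : L).
Hypothesis b_notin : forall x : k, b != x%:A.

Lemma quad_free : free [:: 1; b].
Proof.
rewrite free_cons seq1_free span_seq1; apply/andP; split; last first.
  by have := b_notin 0; rewrite scale0r.
apply/vlineP => -[c cE]; have c0 : c != 0.
  by apply: contraPneq cE => ->; rewrite scale0r; apply/eqP/oner_neq0.
by have /eqP := b_notin c^-1; apply; rewrite cE scalerA mulVf // scale1r.
Qed.

Lemma quad_dim2_span : \dim {:L} = 2%N -> forall a : L, exists x y : k, a = x%:A + y%:A * b.
Proof.
move=> d2 a.
have bs : basis_of fullv [:: 1; b].
  by rewrite basisEfree quad_free subvf d2.
have := memvf a; rewrite -(span_basis bs) span_cons => /memv_addP[u uL [v vb ->]].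
move: vb; rewrite span_seq1 => /vlineP[y ->].
move: uL => /vlineP[x ->].
by exists x, y; rewrite mulr_algl.
Qed.

Lemma quad_span_dim2 : (forall a : L, exists x y : k, a = x%:A + y%:A * b) ->
  \dim {:L} = 2%N.
Proof.
move=> sp; have bs : basis_of fullv [:: 1; b].
  rewrite basisEdim; have/eqP := quad_free; rewrite /free => fr.
  apply/andP; split.
    apply/subvP => a _; have [x [y ->]] := sp a.
    rewrite span_cons span_seq1 memv_add //; first by rewrite memvZ // memv_line.
    by rewrite mulr_algl memvZ // memv_line.
  by apply: leq_trans (dimvS (subvf <<[:: 1; b]>>)); rewrite fr.
by rewrite -(size_basis bs).
Qed.
End QuadraticExtension.

(** Completing the square in r^2 = u + p r. *)
Lemma quad_gen (k : fieldType) (E : fieldExtType k) : 2 != 0 :> k -> \dim {:E} = 2%N ->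
  exists (d : E) (D : k), d ^+ 2 = D%:A /\ forall x : k, d != x%:A.
Proof.
move=> two dE.
have [r rN] : exists r : E, forall x : k, r != x%:A.
  apply: contrapT => rN; have: (\dim {:E} <= \dim <[1 : E]>)%N.
    apply/dimvS/subvP => r _; apply: contrapT => r1; apply: rN; exists r => x.
    by apply/eqP => rx; apply: r1; apply/vlineP; exists x.
  by rewrite dE dim_vline oner_neq0.
have [u [p rE]] := quad_dim2_span rN dE (r ^+ 2).
pose h := p / 2; have pE : p = h + h by rewrite -mulr2n -mulr_natr divfK.
exists (r - h%:A), (u + h ^+ 2); split; last first.
  move=> x; apply: contraTneq (rN (x + h)) => dx; rewrite negbK scalerDl -dx.
  by rewrite subrK.
rewrite sqrrB rE pE !scalerDl mulrDl -[(h ^+ 2)%:A]/(in_alg E (h ^+ 2)) rmorphXn /=.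
rewrite mulr2n [r * _]mulrC; move: (h%:A : E) (u%:A : E) => H G.
by rewrite addrK.
Qed.

Section VertexField.
Variables (k : fieldType) (T : twdata k) (v : vertex T).
Local Notation L := (vL v).
Local Notation N := (tm T %/ tn T)%N.
Implicit Types (p q : {poly k}).

Lemma vpr_poly p : vpr v (in_qpoly (Lpoly T) p) = (map_poly (in_alg L) p).[vb v].
Proof.
elim/poly_ind: p => [|p c IH]; first by rewrite !rmorph0 horner0.
by rewrite !rmorphD !rmorphM /= IH map_polyX map_polyC !hornerE /= -algLE rmorph_alg.
Qed.

Lemma vL_poly (a : L) : exists p, a = vpr v (in_qpoly (Lpoly T) p).
Proof. by have [z <-] := vpr_surj a; exists z; rewrite Lbeta_in. Qed.

(** As k contains all N-th roots of unity, one N-th root of beta in k forces every other one, b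
    included, into k. *)
Lemma vb_split (nu h0 : k) : N.-primitive_root nu -> h0 ^+ N = tbeta T ->
  exists x : k, vb v = x%:A.
Proof.
move=> nuP h0E; have nuL : N.-primitive_root (in_alg L nu) by rewrite fmorph_primitive_root.
have h00 : (h0%:A : L) != 0.
  rewrite -in_algE fmorph_eq0; apply: contraNneq (tbeta_neq0 T) => h00.
  by rewrite -h0E h00 expr0n (gtn_eqF (tN_gt0 T)).
have: (vb v / h0%:A) ^+ N = 1.
  rewrite expr_div_n vb_exp -h0E -[in X in X / _]in_algE rmorphXn /=.
  by rewrite mulfV // expf_neq0.
case/(prim_rootP nuL) => t tE; exists (nu ^+ t * h0).
by rewrite -in_algE rmorphM rmorphXn /= -tE divfK.
Qed.

Section Split.
Variable x : k.
Hypothesis bx : vb v = x%:A.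

Lemma vpr_split p : vpr v (in_qpoly (Lpoly T) p) = p.[x]%:A.
Proof. by rewrite vpr_poly bx -in_algE horner_map. Qed.

Lemma split_L_k (a : L) : exists c : k, a = c%:A.
Proof. by have [p ->] := vL_poly a; exists p.[x]; rewrite vpr_split. Qed.

Lemma split_dvd p : vpr v (in_qpoly (Lpoly T) p) = 0 ->
  exists q, p = q * ('X^1 - x%:P).
Proof.
rewrite vpr_split => /eqP; rewrite scaler_eq0 oner_eq0 orbF => px.
by have /factor_theorem[q ->] : root p x by []; exists q; rewrite expr1.
Qed.
End Split.

Section Quad.
Variable y : k.
Hypothesis by2 : vb v ^+ 2 = y%:A.
Hypothesis y_nsq : forall x : k, x ^+ 2 != y.

Lemma vb_notin (x : k) : vb v != x%:A.
Proof.
apply/eqP => bx; have /eqP := y_nsq x; apply; apply: (fmorph_inj (in_alg L)).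
by rewrite rmorphXn /= -bx by2.
Qed.

Lemma quad_divp p : exists q r0 r1, p = q * ('X^2 - y%:P) + (r0%:P + r1 *: 'X).
Proof.
have d0 : 'X^2 - y%:P != 0 :> {poly k} by rewrite -size_poly_eq0 size_XnsubC.
exists (p %/ ('X^2 - y%:P)), (p %% ('X^2 - y%:P))`_0, (p %% ('X^2 - y%:P))`_1.
rewrite {1}(divp_eq p ('X^2 - y%:P)); congr (_ + _).
have := ltn_modp p ('X^2 - y%:P); rewrite d0 size_XnsubC // ltnS => sr.
apply/polyP => -[|[|j]]; rewrite coefD coefC coefZ coefX /= ?mulr0 ?mulr1 ?addr0 ?add0r //.
by rewrite nth_default // (leq_trans sr).
Qed.

Lemma vpr_quad q r0 r1 :
  vpr v (in_qpoly (Lpoly T) (q * ('X^2 - y%:P) + (r0%:P + r1 *: 'X))) = r0%:A + r1%:A * vb v.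
Proof.
rewrite vpr_poly !rmorphD rmorphM rmorphB /= map_polyXn !map_polyC linearZ /= map_polyX.
by rewrite !hornerE /= by2 subrr mulr0 add0r mulr_algl.
Qed.

Lemma quad_dvd p : vpr v (in_qpoly (Lpoly T) p) = 0 -> exists q, p = q * ('X^2 - y%:P).
Proof.
have [q [r0 [r1 pE]]] := quad_divp p; rewrite {1}pE vpr_quad => r0E; exists q.
have r10 : r1 = 0.
  apply/eqP/negPn/negP => r1n; have /eqP := vb_notin (- r0 / r1); apply.
  have r1A : (r1%:A : L) != 0 by rewrite -in_algE fmorph_eq0.
  apply: (mulfI r1A); apply/eqP; rewrite -subr_eq0 mulr_algl mulr_algl scalerA mulrC divfK //.
  by rewrite -r0E mulr_algl scaleNr opprK addrC.
move: r0E; rewrite r10 scale0r mul0r addr0 => /eqP; rewrite scaler_eq0 oner_eq0 orbF => /eqP r00.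
by rewrite pE r10 r00 scale0r polyC0 !addr0.
Qed.

Lemma quad_span (a : L) : exists c d : k, a = c%:A + d%:A * vb v.
Proof.
have [p ->] := vL_poly a; have [q [r0 [r1 ->]]] := quad_divp p.
by exists r0, r1; rewrite vpr_quad.
Qed.

Lemma quad_dim : \dim {:L} = 2%N.
Proof. exact: quad_span_dim2 vb_notin quad_span. Qed.

(** L is k[X] / (X^2 - y), so evaluation at [d] descends to L; it is onto because 1 and [d] span
    E. *)
Lemma quad_embed (E : fieldExtType k) (d : E) : d ^+ 2 = y%:A -> \dim {:E} = 2%N ->
  exists f : {lrmorphism L -> E}, bijective f.
Proof.
move=> d2 dE; pose ev (p : {poly k}) := (map_poly (in_alg E) p).[d].
have ev0 p : vpr v (in_qpoly (Lpoly T) p) = 0 -> ev p = 0.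
  case/quad_dvd=> q ->; rewrite /ev rmorphM rmorphB /= map_polyXn map_polyC.
  by rewrite !hornerE /= d2 subrr mulr0.
have evD p q : ev (p + q) = ev p + ev q by rewrite /ev rmorphD hornerD.
have evM p q : ev (p * q) = ev p * ev q by rewrite /ev rmorphM hornerM.
have evZ c p : ev (c *: p) = c *: ev p by rewrite /ev linearZ /= hornerZ mulr_algl.
pose f (a : L) := ev (vlift a).
have fE p : f (vpr v (in_qpoly (Lpoly T) p)) = ev p.
  rewrite /f; set z := vlift _; apply/eqP; rewrite -subr_eq0 -scaleN1r -evZ -evD; apply/eqP/ev0.
  rewrite scaleN1r raddfB rmorphB /= Lbeta_in -/z /z vliftK subrr //.
have [g gE] : exists g : {lrmorphism L -> E}, f =1 g.
  apply: lrmorphism_ex => [a c|a c|c a|].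
  - have [p ->] := vL_poly a; have [q ->] := vL_poly c.
    by rewrite -rmorphD -raddfD !fE evD.
  - have [p ->] := vL_poly a; have [q ->] := vL_poly c.
    by rewrite -rmorphM -in_qpolyM !fE evM.
  - have [p ->] := vL_poly a.
    by rewrite -linearZ -in_qpolyZ !fE evZ.
  - rewrite -(rmorph1 (vpr v)) -(in_qpoly1 (Lpoly T)) fE /ev rmorph1 hornerC //.
exists g; have gb : g (vb v) = d by rewrite -gE fE /ev map_polyX hornerX.
have dN x : d != x%:A.
  apply/eqP => dx; have /eqP := y_nsq x; apply; apply: (fmorph_inj (in_alg E)).
  by rewrite rmorphXn /= -dx d2.
have gS x : exists a, g a = x.
  have [c [e ->]] := quad_dim2_span dN dE x; exists (c%:A + e%:A * vb v).
  by rewrite rmorphD rmorphM /= !rmorph_alg gb.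
have /choice[h hE] := gS; exists h => x; last exact: hE.
apply: (fmorph_inj g); exact: (hE (g x)).
Qed.

End Quad.
End VertexField.

(** * Constants and quadratic extensions of the Laurent series field *)

Section LaurentField.
Import Num.Theory.
Variable K : numClosedFieldType.
Local Notation k := (laurent K).

Lemma lconst_rmorphism : exists f : {rmorphism K -> k}, f =1 @lconst K.
Proof.
have cB : zmod_morphism (@lconst K).
  move=> a b; rewrite /lconst -tofracB; congr tofrac; apply: psP => -[|j] //=.
  by rewrite subrr.
have cM : monoid_morphism (@lconst K).
  split; first exact: tofrac1.
  move=> a b; rewrite /lconst -tofracM; congr tofrac; apply: psP => j.
  rewrite -[RHS]/(\sum_(i < j.+1) _) big_ord_recl big1 ?addr0 => [|i _]; last by rewrite mul0r.
  by case: j => [|j] //=; rewrite mulr0.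
pose f1 := GRing.isZmodMorphism.Build _ _ _ cB.
pose f2 := GRing.isMonoidMorphism.Build _ _ _ cM.
pose f : {rmorphism K -> k} := HB.pack (@lconst K) f1 f2.
by exists f.
Qed.

Lemma prim_root_ex n : (0 < n)%N -> exists z : K, n.-primitive_root z.
Proof.
move=> n0; have [r rE] := closed_field_poly_normal ('X^n - 1 : {poly K}).
have mon : ('X^n - 1 : {poly K}) \is monic by rewrite monicXnsubC.
rewrite (monicP mon) scale1r in rE.
have nK : n%:R != 0 :> K by rewrite pnatr_eq0 -lt0n.
have sep : separable_poly ('X^n - 1 : {poly K}) by rewrite separable_Xn_sub_1.
have ur : uniq r by rewrite -separable_prod_XsubC -rE.
have sr : (n <= size r)%N.
  by have := size_prod_XsubC r id; rewrite -rE size_XnsubC // => -[->].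
have ar : all n.-unity_root r.
  apply/allP => z zr; rewrite unity_rootE -subr_eq0.
  have: root ('X^n - 1) z by rewrite rE root_prod_XsubC.
  by rewrite rootE !hornerE.
by have /hasP[z _ zP] := cyclic.has_prim_root n0 ar ur sr; exists z.
Qed.

Lemma laurent_char0 r : (0 < r)%N -> r%:R != 0 :> k.
Proof.
move=> r0; have [f _] := lconst_rmorphism.
by rewrite -(rmorph_nat f) fmorph_eq0 pnatr_eq0 -lt0n.
Qed.

Lemma lconst_root (a : K) n : (0 < n)%N -> exists x : k, x ^+ n = lconst a.
Proof.
move=> n0; have [f fE] := lconst_rmorphism; exists (f (n.-root a)).
by rewrite -fE -rmorphXn rootCK.
Qed.

Lemma lconst_prim (a : K) n : n.-primitive_root (lconst a) = n.-primitive_root a.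
Proof. by have [f fE] := lconst_rmorphism; rewrite -fE fmorph_primitive_root. Qed.

Lemma lconst_eq0 (a : K) : (lconst a == 0) = (a == 0).
Proof. by have [f fE] := lconst_rmorphism; rewrite -fE fmorph_eq0. Qed.

Lemma quad_root_uniform (L : fieldExtType k) (b : L) (y : k) :
  b ^+ 2 = in_alg L y -> (forall x, x ^+ 2 != y) ->
  (forall a : L, exists c d : k, a = c%:A + d%:A * b) -> root_uniform L.
Proof.
move=> b2 yN sp; have [c c0 yE] := nonsquareE yN.
have cL : in_alg L c != 0 by rewrite fmorph_eq0.
have s2 : (b / in_alg L c) ^+ 2 = in_alg L (tofrac (ps_X K)).
  rewrite expr_div_n b2 yE rmorphM rmorphXn mulrAC mulfV ?mul1r //.
  by rewrite expf_neq0.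
apply: (quadratic_root_uniform s2) => a; have [x [z ->]] := sp a.
exists x, (z * c); congr (_ + _).
by rewrite rmorphM mulrA mulrAC mulfK.
Qed.

(** The ratio of two nonsquares of k is a square, so any quadratic extension contains a square root
    of y. *)
Lemma quad_unique (T : twdata k) (v : vertex T) (y : k) :
  vb v ^+ 2 = y%:A -> (forall x, x ^+ 2 != y) ->
  forall E : fieldExtType k, \dim {:E} = 2%N ->
    exists f : {lrmorphism vL v -> E}, bijective f.
Proof.
move=> b2 yN E dE.
have two : 2 != 0 :> k by apply: (laurent_char0 (ltn0Sn 1)).
have [d [D [d2 dN]]] := quad_gen two dE.
have DN x : x ^+ 2 != D.
  apply/eqP => xD; have: d ^+ 2 == in_alg E x ^+ 2 by rewrite d2 -xD -(rmorphXn (in_alg E)).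
  rewrite eqf_sqr => /orP[/eqP dx|/eqP dx]; first by have /eqP := dN x.
  by have /eqP := dN (- x); rewrite dx scaleNr.
have [z z0 yE] := nonsquare_ratio yN DN.
apply: (quad_embed b2 yN (d := in_alg E z * d)) => //.
by rewrite exprMn d2 yE -[RHS]/(in_alg E (z ^+ 2 * D)) rmorphM rmorphXn.
Qed.
End LaurentField.

(** * The cases of the theorem *)

Section SignedPowers.
Variable k : fieldType.
Hypothesis two : 2 != 0 :> k.

Lemma neq_opp (x : k) : x != 0 -> (x == - x) = false.
Proof. by move=> x0; rewrite -addr_eq0 -mulr2n -mulr_natl mulf_eq0 (negPf two) (negPf x0). Qed.

Lemma exprN_odd (x : k) m : odd m -> (- x) ^+ m = - x ^+ m.
Proof. by move=> om; rewrite exprNn -signr_odd om mulN1r. Qed.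

Lemma exprN_even (x : k) m : ~~ odd m -> (- x) ^+ m = x ^+ m.
Proof. by move=> /negPf om; rewrite exprNn -signr_odd om mul1r. Qed.

(** g^m = c^2 gives c^2 / g^(m-1) = g. For gamma^N = beta^2 this is the common solution of h^2 =
    gamma and h^N = beta. *)
Lemma odd_sqrt (g c : k) m : odd m -> g != 0 -> g ^+ m = c ^+ 2 ->
  (c / g ^+ m./2) ^+ 2 = g /\ (c / g ^+ m./2) ^+ m = c.
Proof.
move=> om g0 gm; have gh0 : g ^+ m./2 != 0 by rewrite expf_neq0.
have mE : m = (m./2 * 2).+1 by rewrite muln2 -[LHS](odd_double_half m) om.
have h2 : (c / g ^+ m./2) ^+ 2 = g.
  by rewrite expr_div_n -gm -exprM {1}mE exprS mulfK // expf_neq0.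
by split=> //; rewrite [X in _ ^+ X]mE exprS mulnC exprM h2 divfK.
Qed.

Lemma expr_half (h g : k) m : ~~ odd m -> h ^+ 2 = g -> h ^+ m = g ^+ m./2.
Proof.
by move=> /negPf om <-; rewrite -exprM mul2n halfK om subn0.
Qed.

Lemma prim_root_half (nu : k) N : ~~ odd N -> (0 < N)%N -> N.-primitive_root nu ->
  nu ^+ N./2 = -1.
Proof.
move=> evN N0 nuP; have NE : (N./2 * 2 = N)%N by rewrite muln2 halfK (negPf evN) subn0.
have: (nu ^+ N./2) ^+ 2 == 1 ^+ 2 by rewrite -exprM NE (prim_expr_order nuP) expr1n.
rewrite eqf_sqr => /orP[|/eqP //]; rewrite -(prim_order_dvd nuP) => /dvdn_leq.
have h0 : (0 < N./2)%N by move: N0; rewrite -{1}NE muln_gt0 => /andP[].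
by move=> /(_ h0); rewrite -{1}NE muln2 -addnn -{3}[N./2]addn0 leq_add2l leqNgt h0.
Qed.
End SignedPowers.

Section Restriction.
Variables (k : fieldType) (T : twdata k) (V : twmod T) (P : polarization V).
Variables (xi : T) (Q : quiver P xi) (C : cyclic_quiver Q).
Local Notation gamma := (cq_gamma C).
Local Notation nu := (cq_nu C).
Local Notation L i := (vL (qv i)).
Local Notation restrx i := (@restr _ _ _ _ _ Q (qscx Q) i).
Local Notation restrc i := (@restr _ _ _ _ _ Q (qsc Q) i).
Implicit Types (i : qI Q).

Lemma restrc_vb i : qdia i = i -> restrc i (vb (qv i)) = gamma%:A / vb (qv i).
Proof.
move=> ii; rewrite [LHS](rscE C _ (esym ii)) (sigma_b (cq_gammaE C) (qsc_spec Q)).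
by rewrite rmorphM /= rmorph_alg rmorphV ?b_unit.
Qed.

Lemma restrx_vb i : fixed_arrow i -> restrx i (vb (qv i)) = (gamma / nu)%:A / vb (qv i).
Proof.
move=> fi; rewrite (restrxE C _ erefl (fixed_arrow_eq fi)) (sigma_b (NmCx C) (qscx_spec Q)).
by rewrite rmorphM /= rmorph_alg rmorphV ?b_unit.
Qed.

Lemma sqr_div_eq i (g : k) : vb (qv i) ^+ 2 = g%:A -> g%:A / vb (qv i) = vb (qv i).
Proof. by move=> <-; rewrite expr2 mulfK ?vb_neq0. Qed.

Lemma sqr_div_eqN i (g : k) : vb (qv i) ^+ 2 = (- g)%:A -> g%:A / vb (qv i) = - vb (qv i).
Proof. by move=> bE; rewrite -[g]opprK scaleNr -bE expr2 mulNr mulfK ?vb_neq0. Qed.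

Lemma vb_neqN i : - vb (qv i) <> vb (qv i).
Proof.
by move=> /esym/eqP; rewrite neq_opp ?vb_neq0 // (two_neq0 C).
Qed.

Lemma restrx_id_k i : fixed_arrow i -> L_eq_k i -> restr_id (qscx Q) i.
Proof.
move=> fi Lk a; have [_ _ ra _] := restrx_props C erefl (fixed_arrow_eq fi).
by have [x ->] := Lk a; apply: ra.
Qed.

Section QuadVertex.
Variable i : Q.
Hypothesis span : forall a : L i, exists c d : k, a = c%:A + d%:A * vb (qv i).
Hypothesis dim2 : \dim {:L i} = 2%N.

Lemma quad_vertex_id : fixed_vertex i -> vb (qv i) ^+ 2 = gamma%:A ->
  [/\ vb (qv i) ^+ 2 = gamma%:A, restr_id (qsc Q) i & vertex_res_orth_or_sympl i].
Proof.
move=> ii b2; have rid : restr_id (qsc Q) i.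
  move=> a; have [h hE] := restr_qsc_lrmorphism C ii; have [c [d ->]] := span a.
  by rewrite hE rmorphD rmorphM /= !rmorph_alg -hE restrc_vb // sqr_div_eq.
by split=> //; apply: (fixed_vertex_res_orth C).
Qed.

Lemma quad_vertex_unitary : fixed_vertex i -> vb (qv i) ^+ 2 = (- gamma)%:A ->
  [/\ vb (qv i) ^+ 2 = (- gamma)%:A, ~ restr_id (qsc Q) i & vertex_unitary i].
Proof.
move=> ii b2; have bN : restrc i (vb (qv i)) = - vb (qv i).
  by rewrite restrc_vb // sqr_div_eqN.
split=> //; first by move=> /(_ (vb (qv i))); rewrite bN => /vb_neqN.
by apply: (fixed_vertex_unitary C ii dim2 _ bN); apply: vb_neq0.
Qed.

Lemma quad_arrow_id : fixed_arrow i -> vb (qv i) ^+ 2 = (gamma / nu)%:A ->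
  [/\ vb (qv i) ^+ 2 = (gamma / nu)%:A, restr_id (qscx Q) i & arrow_ext_or_sym i].
Proof.
move=> fi b2; have rid : restr_id (qscx Q) i.
  move=> a; have [rD rM ra _] := restrx_props C erefl (fixed_arrow_eq fi).
  by have [c [d ->]] := span a; rewrite rD rM !ra restrx_vb // sqr_div_eq.
by split=> //; apply: (fixed_arrow_ext_or_sym C).
Qed.

Lemma quad_arrow_herm : fixed_arrow i -> vb (qv i) ^+ 2 = (- (gamma / nu))%:A ->
  [/\ vb (qv i) ^+ 2 = (- (gamma / nu))%:A, ~ restr_id (qscx Q) i & arrow_herm i].
Proof.
move=> fi b2; have bN : restrx i (vb (qv i)) = - vb (qv i).
  by rewrite restrx_vb // sqr_div_eqN.
split=> //; first by move=> /(_ (vb (qv i))); rewrite bN => /vb_neqN.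
by apply: (fixed_arrow_herm C fi _ bN); apply: vb_neq0.
Qed.
End QuadVertex.
End Restriction.

(** * Fixed vertices and fixed arrows, counted by signs *)

Section Cases.
Variables (k : fieldType) (T : twdata k) (V : twmod T) (P : polarization V).
Variables (xi : T) (Q : quiver P xi) (C : cyclic_quiver Q).
Local Notation N := (tm T %/ tn T)%N.
Local Notation gamma := (cq_gamma C).
Local Notation beta := (tbeta T).
Local Notation nu := (cq_nu C).
Local Notation gnu := (gamma / nu).
Local Notation b i := (vb (qv i)).
Variable yv : qI Q -> k.
Hypothesis nu_prim : N.-primitive_root nu.

Let two := cq_two C.
Let beta0 := tbeta_neq0 T.
Let gamma0 := cq_gamma_neq0 C.
Let nu0 := cq_nu0 C.
Let N0 := tN_gt0 T.

Section SplitCase.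
Hypothesis yE1 : forall i : Q, b i = (yv i)%:A.
Let NE1 : N = (1 * N)%N. Proof. by rewrite mul1n. Qed.
Let yE (i : Q) : b i ^+ 1 = (yv i)%:A. Proof. exact: yE1. Qed.
Let y_dvd (i : Q) (p : {poly k}) : vpr (qv i) (in_qpoly (Lpoly T) p) = 0 ->
  exists q, p = q * ('X^1 - (yv i)%:P).
Proof. exact: (split_dvd (yE1 i)). Qed.
Let Lk (i : Q) : L_eq_k i. Proof. exact: (split_L_k (yE1 i)). Qed.

Let yN := yv_exp NE1 yE.

Lemma split_cycle : single_cycle Q N.
Proof. exact: (single_cycleP NE1 yE y_dvd nu_prim). Qed.

Lemma uniq_root_odd (x g : k) : odd N -> x ^+ 2 = g -> x ^+ N = beta ->
  forall z, z ^+ 2 = g -> z ^+ N = beta -> z = x.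
Proof.
move=> oN <- xN z /eqP; rewrite eqf_sqr => /orP[/eqP //|/eqP -> /eqP].
by rewrite exprN_odd // xN eq_sym neq_opp.
Qed.

Lemma split_odd : odd N ->
  [/\ forall i : Q, L_eq_k i, single_cycle Q N, type_VE Q,
      forall i : Q, fixed_vertex i ->
        (exists x : k, [/\ b i = x%:A, x ^+ 2 = gamma, x ^+ N = beta &
          forall z : k, z ^+ 2 = gamma -> z ^+ N = beta -> z = x]) /\
        vertex_orth_or_sympl i &
      forall j : Q, fixed_arrow j ->
        (exists x : k, [/\ b j = x%:A, x ^+ 2 = gnu, x ^+ N = beta &
          forall z : k, z ^+ 2 = gnu -> z ^+ N = beta -> z = x]) /\
        arrow_ext_or_sym j].
Proof.
move=> oN; split=> //; first exact: split_cycle.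
- have gN : gamma ^+ N = beta ^+ 2.
    have := cq_gammaE C; have := pc_norm P => pn gE; move: pn.
    rewrite gE (cq_sigma C) mulr_algl scalerA -expr2 => pn.
    by apply: (@alg_inj _ T); rewrite -pn -[in LHS]in_algE rmorphXn.
  pose h := beta / gamma ^+ N./2; have [h2 hN] := odd_sqrt oN gamma0 gN.
  have gh0 : gamma ^+ N./2 != 0 by rewrite expf_neq0.
  have h0 : h != 0 by rewrite mulf_neq0 ?invr_eq0.
  (* The exponent is (N + 1)/2, so ka^2 = nu while ka^N = 1: dividing by [ka] moves the solution for
     vertices to the one for arrows. *)
  pose ka := nu ^+ (N./2).+1.
  have ka2 : ka ^+ 2 = nu.
    have NhE : (N./2).*2.+1 = N by rewrite -[RHS](odd_double_half N) oN.
    by rewrite -exprM muln2 doubleS -addn1 exprD NhE (prim_expr_order nu_prim) mul1r.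
  have kaN : ka ^+ N = 1.
    by rewrite -exprM mulnC exprM (prim_expr_order nu_prim) expr1n.
  have ka0 : ka != 0 by rewrite expf_neq0.
  split.
    rewrite (card_fixed_vertices NE1 yE y_dvd nu_prim h0) ?expr1 //.
    by rewrite exprN_odd // hN eqxx eq_sym neq_opp.
  have hk0 : h / ka != 0 by rewrite mulf_neq0 ?invr_eq0.
  rewrite (card_fixed_arrows NE1 yE y_dvd nu_prim hk0).
    by rewrite exprN_odd // expr_div_n hN kaN divr1 eqxx eq_sym neq_opp.
  by rewrite expr_div_n h2 ka2 !expr1.
- move=> i fi; split; last exact: (fixed_vertex_orth C).
  have y2 := fixed_vertex_yv C NE1 yE y_dvd fi; rewrite expr1 in y2.
  exists (yv i); split=> //; exact: uniq_root_odd.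
- move=> i fi; split; last by apply: (fixed_arrow_ext_or_sym C) => //; apply: restrx_id_k.
  have y2 := fixed_arrow_yv C NE1 yE y_dvd fi; rewrite !expr1 in y2.
  exists (yv i); split=> //; exact: uniq_root_odd.
Qed.

Lemma split_even (h ka : k) : ~~ odd N -> h ^+ 2 = gamma -> ka ^+ 2 = nu ->
  [/\ forall i : Q, L_eq_k i, single_cycle Q N,
      beta = gamma ^+ N./2 ->
        type_VV Q /\ (forall i : Q, fixed_vertex i -> vertex_orth_or_sympl i) &
      beta = - gamma ^+ N./2 ->
        type_EE Q /\ (forall i : Q, fixed_arrow i -> arrow_ext_or_sym i)].
Proof.
move=> eN h2 ka2; have hN := expr_half eN h2.
(* Here a square root of nu has N-th power nu^(N/2) = -1; this sign separates the vertex case from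
   the arrow case. *)
have kaN : ka ^+ N = -1 by rewrite (expr_half eN ka2) (prim_root_half eN N0 nu_prim).
have h0 : h != 0 by apply: contraNneq gamma0 => h0; rewrite -h2 h0 expr0n.
have ka0 : ka != 0 by apply: contraNneq nu0 => ka0; rewrite -ka2 ka0 expr0n.
have hk0 : h / ka != 0 by rewrite mulf_neq0 ?invr_eq0.
have cv : nb_fixed_vertices Q = (2 * (gamma ^+ N./2 == beta))%N.
  rewrite (card_fixed_vertices NE1 yE y_dvd nu_prim h0) ?expr1 //.
  by rewrite exprN_even // hN mul2n addnn.
have ca : nb_fixed_arrows Q = (2 * (- gamma ^+ N./2 == beta))%N.
  rewrite (card_fixed_arrows NE1 yE y_dvd nu_prim hk0); last first.
    by rewrite expr_div_n h2 ka2 !expr1.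
  by rewrite exprN_even // expr_div_n hN kaN invrN1 mulrN1 mul2n addnn.
split=> //; first exact: split_cycle.
- move=> bE; split; last by move=> i fi; apply: (fixed_vertex_orth C).
  by split; rewrite ?cv ?ca -bE ?eqxx // eq_sym neq_opp.
- move=> bE; split; last first.
    by move=> i fi; apply: (fixed_arrow_ext_or_sym C) => //; apply: restrx_id_k.
  have bE' : gamma ^+ N./2 = - beta by rewrite bE opprK.
  by split; rewrite ?cv ?ca bE' ?opprK ?eqxx // eq_sym neq_opp.
Qed.
End SplitCase.

Section QuadCase.
Hypothesis eN : ~~ odd N.
Hypothesis yE : forall i : Q, b i ^+ 2 = (yv i)%:A.
Hypothesis y_nsq : forall (i : Q) (x : k), x ^+ 2 != yv i.
Let N' := N./2.
Let NE : N = (2 * N')%N. Proof. by rewrite mul2n halfK (negPf eN) subn0. Qed.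
Let y_dvd (i : Q) (p : {poly k}) : vpr (qv i) (in_qpoly (Lpoly T) p) = 0 ->
  exists q, p = q * ('X^2 - (yv i)%:P).
Proof. exact: (quad_dvd (yE i) (y_nsq i)). Qed.
Let span (i : Q) := quad_span (yE i).
Let dim2 (i : Q) := quad_dim (yE i) (y_nsq i).
Let yN := yv_exp NE yE.

Lemma quad_cycle : single_cycle Q N'.
Proof. exact: (single_cycleP NE yE y_dvd nu_prim). Qed.

Let gnu0 : gnu != 0. Proof. by rewrite mulf_neq0 ?invr_eq0. Qed.

(** The sign comes from nu^(N/2) = -1 and makes the values for arrows behave oppositely to those for
    vertices. *)
Let gnuN : gnu ^+ N' = - gamma ^+ N'.
Proof. by rewrite expr_div_n (prim_root_half eN N0 nu_prim) // invrN1 mulrN1. Qed.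

Let gnu2 : gnu ^+ 2 = gamma ^+ 2 / nu ^+ 2. Proof. exact: expr_div_n. Qed.

Let vtx (i : Q) : fixed_vertex i -> yv i = gamma \/ yv i = - gamma.
Proof.
move=> /(fixed_vertex_yv C NE yE y_dvd)/eqP; rewrite eqf_sqr.
by case/orP => /eqP; [left|right].
Qed.

Let arr (i : Q) : fixed_arrow i -> yv i = gnu \/ yv i = - gnu.
Proof.
move=> /(fixed_arrow_yv C NE yE y_dvd)/eqP; rewrite -gnu2 eqf_sqr.
by case/orP => /eqP; [left|right].
Qed.

(** The candidates are y = gamma and y = -gamma. For N' odd exactly one of them has N'-th power
    beta; for N' even both have it or neither. *)
Let cv := card_fixed_vertices NE yE y_dvd nu_prim gamma0 erefl.
Let ca := card_fixed_arrows NE yE y_dvd nu_prim gnu0 gnu2.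

Lemma quad_odd_pos : odd N' -> beta = gamma ^+ N' ->
  [/\ type_VE Q,
      forall i : Q, fixed_vertex i ->
        [/\ b i ^+ 2 = gamma%:A, restr_id (qsc Q) i & vertex_res_orth_or_sympl i] &
      forall j : Q, fixed_arrow j ->
        [/\ b j ^+ 2 = (- gnu)%:A, ~ restr_id (qscx Q) j & arrow_herm j]].
Proof.
move=> oN bE; split.
- split; first by rewrite cv exprN_odd // -bE eqxx eq_sym neq_opp.
  by rewrite ca exprN_odd // gnuN -bE opprK eqxx eq_sym neq_opp.
- move=> i fi; apply: (quad_vertex_id (@span i) fi).
  rewrite yE; have [-> //|yi] := vtx fi; have /eqP := yN i.
  by rewrite yi exprN_odd // -bE eq_sym neq_opp.
- move=> i fi; apply: (quad_arrow_herm fi).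
  rewrite yE; have [yi|-> //] := arr fi; have /eqP := yN i.
  by rewrite yi gnuN -bE eq_sym neq_opp.
Qed.

Lemma quad_odd_neg : odd N' -> beta = - gamma ^+ N' ->
  [/\ type_VE Q,
      forall i : Q, fixed_vertex i ->
        [/\ b i ^+ 2 = (- gamma)%:A, ~ restr_id (qsc Q) i & vertex_unitary i] &
      forall j : Q, fixed_arrow j ->
        [/\ b j ^+ 2 = gnu%:A, restr_id (qscx Q) j & arrow_ext_or_sym j]].
Proof.
move=> oN bE; have bE' : gamma ^+ N' = - beta by rewrite bE opprK.
split.
- split; first by rewrite cv exprN_odd // bE' opprK eqxx eq_sym neq_opp.
  by rewrite ca exprN_odd // gnuN bE' opprK eqxx eq_sym neq_opp.
- move=> i fi; apply: (quad_vertex_unitary (dim2 i) fi).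
  rewrite yE; have [yi|-> //] := vtx fi; have /eqP := yN i.
  by rewrite yi bE' eq_sym neq_opp.
- move=> i fi; apply: (quad_arrow_id (@span i) fi).
  rewrite yE; have [-> //|yi] := arr fi; have /eqP := yN i.
  by rewrite yi exprN_odd // gnuN bE' opprK eq_sym neq_opp.
Qed.

Lemma quad_even_pos : ~~ odd N' -> beta = gamma ^+ N' ->
  type_VV Q /\
  exists i i' : Q,
    [/\ i != i', fixed_vertex i, fixed_vertex i',
        [/\ b i ^+ 2 = gamma%:A, restr_id (qsc Q) i & vertex_res_orth_or_sympl i] &
        [/\ b i' ^+ 2 = (- gamma)%:A, ~ restr_id (qsc Q) i' & vertex_unitary i']].
Proof.
move=> eN' bE; split.
  split; first by rewrite cv exprN_even // -bE eqxx.
  by rewrite ca exprN_even // gnuN -bE eq_sym neq_opp.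
have [i yi] := vertex_of_root NE yE nu_prim (esym bE).
have [|i' yi'] := vertex_of_root NE yE nu_prim (x := - gamma).
  by rewrite exprN_even.
have fi : fixed_vertex i by apply/eqP; rewrite (fixed_vertexE C NE yE y_dvd) yi.
have fi' : fixed_vertex i'.
  by apply/eqP; rewrite (fixed_vertexE C NE yE y_dvd) yi' sqrrN.
exists i, i'; split=> //.
- by apply: contraFneq (neq_opp two gamma0) => ii; rewrite -yi' -ii yi.
- by apply: (quad_vertex_id (@span i) fi); rewrite yE yi.
- by apply: (quad_vertex_unitary (dim2 i') fi'); rewrite yE yi'.
Qed.

Lemma quad_even_neg : ~~ odd N' -> beta = - gamma ^+ N' ->
  type_EE Q /\
  exists i i' : Q,
    [/\ i != i', fixed_arrow i, fixed_arrow i',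
        [/\ b i ^+ 2 = gnu%:A, restr_id (qscx Q) i & arrow_ext_or_sym i] &
        [/\ b i' ^+ 2 = (- gnu)%:A, ~ restr_id (qscx Q) i' & arrow_herm i']].
Proof.
move=> eN' bE; have bE' : gamma ^+ N' = - beta by rewrite bE opprK.
split.
  split; first by rewrite cv exprN_even // bE' eq_sym neq_opp.
  by rewrite ca exprN_even // gnuN -bE eqxx.
have [|i yi] := vertex_of_root NE yE nu_prim (x := gnu); first by rewrite gnuN.
have [|i' yi'] := vertex_of_root NE yE nu_prim (x := - gnu).
  by rewrite exprN_even // gnuN.
have fi : fixed_arrow i by apply/eqP; rewrite (fixed_arrowE C NE yE y_dvd) yi gnu2.
have fi' : fixed_arrow i'.
  by apply/eqP; rewrite (fixed_arrowE C NE yE y_dvd) yi' sqrrN gnu2.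
exists i, i'; split=> //.
- by apply: contraFneq (neq_opp two gnu0) => ii; rewrite -yi' -ii yi.
- by apply: (quad_arrow_id (@span i) fi); rewrite yE yi.
- by apply: (quad_arrow_herm fi'); rewrite yE yi'.
Qed.
End QuadCase.
End Cases.

(** * Quivers over the Laurent series field *)

Section LaurentQuiver.
Variable K : numClosedFieldType.
Local Notation k := (laurent K).
Variables (T : twdata k) (V : twmod T) (V_fg : fin_gen V) (P : polarization V).
Hypothesis sigma_k : forall x : k, psig P x%:A = x%:A.
Variables (xi : T) (xi_fixed : psig P xi = xi) (nu : K).
Hypothesis nu_prim : (tm T %/ tn T).-primitive_root nu.
Hypothesis xi_norm : Nm xi = (lconst nu)%:A.
Variables (gamma : k) (gammaE : Nm (pc P) = gamma%:A) (Q : quiver P xi).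
Local Notation N := (tm T %/ tn T)%N.
Local Notation beta := (tbeta T).

Lemma cyclic_quiver_ex : (forall i : Q, root_uniform (vL (qv i))) ->
  exists2 C : cyclic_quiver Q, cq_gamma C = gamma & cq_nu C = lconst nu.
Proof.
move=> unif; have n0 := tn_gt0 T.
have [w0 w0P] := prim_root_ex K n0; pose w : k := lconst w0.
have wP : (tn T).-primitive_root w by rewrite lconst_prim.
have nk := laurent_char0 K n0.
have [y [yU yE [d yd]]] := kummer_generator wP nk.
have wr r : (0 < r)%N -> exists x : k, x ^+ r = w by apply: lconst_root.
have cyc i := cid2 (cyclic_vector (v := qv i) wP wr (@laurent_char0 K) yU yE yd (unif i)).
have nu0 : lconst nu != 0.
  by rewrite lconst_eq0 (prim_root_eq0 nu_prim) gtn_eqF ?tN_gt0.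
pose U (i : Q) := sval (sig_of_sig2 (cyc i)).
have U0 (i : Q) : U i <> 0 by rewrite /U; case: (cyc i).
have UC (i : Q) (u : vS (qv i)) : exists q, u = eact q (U i).
  by rewrite /U; case: (cyc i) u.
by exists (CyclicQuiver wP nk (laurent_char0 K (ltn0Sn 1)) yU yE sigma_k xi_fixed gammaE
  nu0 xi_norm V_fg U0 UC).
Qed.

Lemma gamma_exp : gamma ^+ N = beta ^+ 2.
Proof.
have := pc_norm P; rewrite gammaE sigma_k mulr_algl scalerA -expr2 => pn.
by apply: (@alg_inj _ T); rewrite -pn -[LHS]/(in_alg T (gamma ^+ N)) rmorphXn.
Qed.

Lemma gamma_neq0 : gamma != 0.
Proof.
apply: contraNneq (tbeta_neq0 T) => g0; have /eqP := gamma_exp.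
by rewrite g0 expr0n (gtn_eqF (tN_gt0 T)) eq_sym expf_eq0.
Qed.

Lemma nuk_prim : N.-primitive_root (lconst nu : k).
Proof. by rewrite lconst_prim. Qed.

Lemma split_quiver_ex (h0 : k) : h0 ^+ N = beta ->
  exists2 C : cyclic_quiver Q, cq_gamma C = gamma /\ cq_nu C = lconst nu &
  exists yv : Q -> k, forall i, vb (qv i) = (yv i)%:A.
Proof.
move=> h0E; have /choice[yv yE] (i : Q) : exists x : k, vb (qv i) = x%:A.
  exact: vb_split nuk_prim h0E.
have [i|C gE nuE] := cyclic_quiver_ex; last by exists C; [|exists yv].
have [t t0 tP] := laurent_root_uniform K.
exists (in_alg (vL (qv i)) t); first by rewrite fmorph_eq0.
move=> n a n0; have [x ->] := split_L_k (yE i) a => x0.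
have {}x0 : x != 0 by apply: contraNneq x0 => ->; rewrite scale0r.
have [m [z xE]] := tP n x n0 x0; exists m, (in_alg (vL (qv i)) z).
by rewrite -[LHS]/(in_alg (vL (qv i)) x) xE rmorphM !rmorphXn.
Qed.

Lemma quad_quiver_ex : ~~ odd N -> odd `|val_tau gamma|%N ->
  exists2 C : cyclic_quiver Q, cq_gamma C = gamma /\ cq_nu C = lconst nu &
  exists2 yv : Q -> k, forall i, vb (qv i) ^+ 2 = (yv i)%:A & forall i x, x ^+ 2 != yv i.
Proof.
move=> eN oval; have gN := (odd_val_nonsquare gamma_neq0).1 oval.
have NhE : (2 * N./2)%N = N by rewrite mul2n halfK (negPf eN) subn0.
have [sn snE] := lconst_root nu (ltn0Sn 1).
have sn0 : sn != 0.
  have: lconst nu != 0 by rewrite lconst_eq0 (prim_root_eq0 nu_prim) gtn_eqF ?tN_gt0.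
  by apply: contraNneq => s0; rewrite -snE s0 expr0n.
have bE (i : Q) : exists t, vb (qv i) ^+ 2 = in_alg (vL (qv i)) (lconst nu ^+ t * gamma).
  have nuL : N.-primitive_root (in_alg (vL (qv i)) (lconst nu)).
    by rewrite fmorph_primitive_root nuk_prim.
  have gL : in_alg (vL (qv i)) gamma != 0 by rewrite fmorph_eq0 gamma_neq0.
  (* b^(2N) = beta^2 = gamma^N, so b^2 is gamma times an N-th root of unity. Constants are squares
     in k, so b^2 is a nonsquare along with gamma. *)
  have: (vb (qv i) ^+ 2 / in_alg (vL (qv i)) gamma) ^+ N = 1.
    rewrite expr_div_n -(rmorphXn (in_alg (vL (qv i)))) gamma_exp -exprM mulnC exprM vb_exp.
    rewrite -[X in X ^+ 2]/(in_alg (vL (qv i)) beta) -(rmorphXn (in_alg (vL (qv i)))).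
    by rewrite mulfV // fmorph_eq0 expf_neq0 // tbeta_neq0.
  case/(prim_rootP nuL) => t tE; exists t.
  by rewrite rmorphM rmorphXn -tE divfK.
have /choice[t tE] := bE; pose yv i := lconst nu ^+ t i * gamma.
have yN i x : x ^+ 2 != yv i.
  apply/eqP => xE; have /eqP := gN (x / sn ^+ t i); apply.
  by rewrite expr_div_n xE -exprM mulnC exprM snE mulrAC mulfV ?mul1r // -snE !expf_neq0.
have [i|C gE nuE] := cyclic_quiver_ex; last by exists C => //; exists yv.
apply: (quad_root_uniform (tE i) (yN i)).
exact: (quad_span (tE i)).
Qed.

Lemma beta_sign : ~~ odd N -> beta = gamma ^+ N./2 \/ beta = - gamma ^+ N./2.
Proof.
move=> eN; have NhE : (N./2 * 2)%N = N by rewrite muln2 halfK (negPf eN) subn0.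
have /eqP := gamma_exp; rewrite -{1}NhE exprM eq_sym eqf_sqr.
by case/orP => /eqP; [left|right].
Qed.
End LaurentQuiver.

(* Stated over an arbitrary field so that it can be proved over a numClosedFieldType
   K and transported to R[i] in one step: comparing the field structures of R[i]
   inside the proof is prohibitively slow. *)
Definition main_statement (K : fieldType) : Prop :=
  forall (T : twdata (laurent K)) (V : twmod T) (V_fg : fin_gen V)
  (P : polarization V)
  (sigma_k : forall x : laurent K, psig P x%:A = x%:A)
  (xi : T) (xi_fixed : psig P xi = xi)
  (nu : K) (nu_prim : (tm T %/ tn T).-primitive_root nu)
  (xi_norm : Nm xi = (lconst nu)%:A)
  (gamma : laurent K) (gammaE : Nm (pc P) = gamma%:A)
  (Q : quiver P xi),
  let k := laurent K in
  let N := (tm T %/ tn T)%N in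
  let beta := tbeta T in
  let gnu := gamma / lconst nu in
  let b (i : Q) := vb (qv i) in
  [/\ gamma != 0 /\ gamma ^+ N = beta ^+ 2,
      forall i : Q, D_eq_L i,
      odd N ->
      [/\ forall i : Q, L_eq_k i,
          single_cycle Q N,
          type_VE Q,
          forall i : Q, fixed_vertex i ->
            (exists x : k,
               [/\ b i = x%:A, x ^+ 2 = gamma, x ^+ N = beta &
                   forall y : k, y ^+ 2 = gamma -> y ^+ N = beta -> y = x]) /\
            vertex_orth_or_sympl i &
          forall j : Q, fixed_arrow j ->
            (exists x : k,
               [/\ b j = x%:A, x ^+ 2 = gnu, x ^+ N = beta &
                   forall y : k, y ^+ 2 = gnu -> y ^+ N = beta -> y = x]) /\
            arrow_ext_or_sym j],
      ~~ odd N -> ~~ odd `|val_tau gamma|%N ->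
      [/\ beta = gamma ^+ N./2 \/ beta = - gamma ^+ N./2,
          forall i : Q, L_eq_k i,
          single_cycle Q N,
          beta = gamma ^+ N./2 ->
            type_VV Q /\
            (forall i : Q, fixed_vertex i -> vertex_orth_or_sympl i) &
          beta = - gamma ^+ N./2 ->
            type_EE Q /\
            (forall i : Q, fixed_arrow i -> arrow_ext_or_sym i)] &
      ~~ odd N -> odd `|val_tau gamma|%N ->
      [/\ (beta = gamma ^+ N./2 \/ beta = - gamma ^+ N./2) /\
          (forall i : Q, L_is_quadratic i) /\ single_cycle Q N./2,
          odd N./2 -> beta = gamma ^+ N./2 ->
          [/\ type_VE Q,
              forall i : Q, fixed_vertex i ->
                [/\ b i ^+ 2 = gamma%:A, restr_id (qsc Q) i &
                    vertex_res_orth_or_sympl i] &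
              forall j : Q, fixed_arrow j ->
                [/\ b j ^+ 2 = (- gnu)%:A, ~ restr_id (qscx Q) j &
                    arrow_herm j]],
          odd N./2 -> beta = - gamma ^+ N./2 ->
          [/\ type_VE Q,
              forall i : Q, fixed_vertex i ->
                [/\ b i ^+ 2 = (- gamma)%:A, ~ restr_id (qsc Q) i &
                    vertex_unitary i] &
              forall j : Q, fixed_arrow j ->
                [/\ b j ^+ 2 = gnu%:A, restr_id (qscx Q) j &
                    arrow_ext_or_sym j]],
          ~~ odd N./2 -> beta = gamma ^+ N./2 ->
          type_VV Q /\
          exists i i' : Q,
            [/\ i != i', fixed_vertex i, fixed_vertex i',
                [/\ b i ^+ 2 = gamma%:A, restr_id (qsc Q) i &
                    vertex_res_orth_or_sympl i] &
                [/\ b i' ^+ 2 = (- gamma)%:A, ~ restr_id (qsc Q) i' &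
                    vertex_unitary i']] &
          ~~ odd N./2 -> beta = - gamma ^+ N./2 ->
          type_EE Q /\
          exists i i' : Q,
            [/\ i != i', fixed_arrow i, fixed_arrow i',
                [/\ b i ^+ 2 = gnu%:A, restr_id (qscx Q) i &
                    arrow_ext_or_sym i] &
                [/\ b i' ^+ 2 = (- gnu)%:A, ~ restr_id (qscx Q) i' &
                    arrow_herm i']]]].

(** An N-th root of beta in k puts all b_i in k. It exists for N odd by [odd_sqrt], and for
    val(gamma) even because gamma is then a square h^2 and beta is h^N up to sign. In the remaining
    case gamma, hence each b_i^2, is a nonsquare. *)
Lemma main_statement_closed (K : numClosedFieldType) : main_statement K.
Proof.
move=> T V V_fg P sigma_k xi xi_fixed nu nu_prim xi_norm gamma gammaE Q k N beta gnu b.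
have nuP := nuk_prim nu_prim; have gE := gamma_exp sigma_k gammaE.
have split_ex (h0 : k) (h0E : h0 ^+ N = beta) :=
  split_quiver_ex V_fg sigma_k xi_fixed nu_prim xi_norm gammaE Q h0E.
have quad_ex := quad_quiver_ex V_fg sigma_k xi_fixed nu_prim xi_norm gammaE Q.
have g0 : gamma != 0 := gamma_neq0 sigma_k gammaE.
have bs := beta_sign sigma_k gammaE.
have odd_ex : odd N -> exists h0 : k, h0 ^+ N = beta.
  by move=> oN; exists (beta / gamma ^+ N./2); have [] := odd_sqrt oN g0 gE.
have even_sqrt : ~~ odd `|val_tau gamma|%N -> exists h : k, h ^+ 2 = gamma.
  move=> ev; apply: contrapT => hN; move/negP: ev; apply.
  by apply/(odd_val_nonsquare g0) => z; apply/eqP => zE; apply: hN; exists z.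
have even_ex (h : k) : ~~ odd N -> h ^+ 2 = gamma -> exists h0 : k, h0 ^+ N = beta.
  move=> eN h2; have hN := expr_half eN h2.
  have [bE|bE] := bs eN; first by exists h; rewrite hN.
  (* For beta = -gamma^(N/2), an N-th root of the constant -1 corrects the sign. *)
  have [r rE] := lconst_root (-1 : K) (tN_gt0 T).
  exists (r * h); rewrite exprMn hN rE; have [f fE] := lconst_rmorphism (K).
  by rewrite -fE rmorphN1 mulN1r.
split.
- by split.
- move=> i; have [oN|eN] := boolP (odd N).
    have [h0 h0E] := odd_ex oN; have [C _ _] := split_ex h0 h0E.
    exact: quiver_D_eq_L C i.
  have [ov|ev] := boolP (odd `|val_tau gamma|%N).
    by have [C _ _] := quad_ex eN ov; exact: quiver_D_eq_L C i.
  have [h h2] := even_sqrt ev; have [h0 h0E] := even_ex h eN h2.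
  by have [C _ _] := split_ex h0 h0E; exact: quiver_D_eq_L C i.
- move=> oN; have [h0 h0E] := odd_ex oN; have [C [gC nC] [yv yE]] := split_ex h0 h0E.
  by rewrite -nC in nuP; have := split_odd nuP yE oN; rewrite gC nC.
- move=> eN ev; have [h h2] := even_sqrt ev; have [h0 h0E] := even_ex h eN h2.
  have [C [gC nC] [yv yE]] := split_ex h0 h0E.
  have [ka ka2] := lconst_root nu (ltn0Sn 1).
  rewrite -nC in nuP ka2; rewrite -gC in h2.
  have [Lk cyc pos neg] := split_even nuP yE eN h2 ka2.
  by rewrite -gC; split=> //; rewrite gC; apply: bs.
- move=> eN ov; have [C [gC nC] [yv yE yN]] := quad_ex eN ov.
  rewrite -nC in nuP.
  have := quad_odd_pos nuP eN yE yN; have := quad_odd_neg nuP eN yE yN.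
  have := quad_even_pos nuP eN yE yN; have := quad_even_neg nuP eN yE yN.
  rewrite gC nC => c4 c3 c2 c1; split=> //.
  split; first exact: bs.
  split; last exact: (quad_cycle nuP eN yE yN).
  move=> i; split; first exact: (quad_dim (yE i) (yN i)).
  exact: (quad_unique (yE i) (yN i)).
Qed.

Theorem mainTheorem2 (R : realType)
  (T : twdata (laurent R[i]%C)) (V : twmod T) (V_fg : fin_gen V)
  (P : polarization V)
  (sigma_k : forall x : laurent R[i]%C, psig P x%:A = x%:A)
  (xi : T) (xi_fixed : psig P xi = xi)
  (nu : R[i]%C) (nu_prim : (tm T %/ tn T).-primitive_root nu)
  (xi_norm : Nm xi = (lconst nu)%:A)
  (gamma : laurent R[i]%C) (gammaE : Nm (pc P) = gamma%:A)
  (Q : quiver P xi) :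
  let k := laurent R[i]%C in
  let N := (tm T %/ tn T)%N in
  let beta := tbeta T in
  let gnu := gamma / lconst nu in
  let b (i : Q) := vb (qv i) in
  [/\ gamma != 0 /\ gamma ^+ N = beta ^+ 2,
      forall i : Q, D_eq_L i,
      (* (A) *)
      odd N ->
      [/\ forall i : Q, L_eq_k i,
          single_cycle Q N,
          type_VE Q,
          forall i : Q, fixed_vertex i ->
            (exists x : k,
               [/\ b i = x%:A, x ^+ 2 = gamma, x ^+ N = beta &
                   forall y : k, y ^+ 2 = gamma -> y ^+ N = beta -> y = x]) /\
            vertex_orth_or_sympl i &
          forall j : Q, fixed_arrow j ->
            (exists x : k,
               [/\ b j = x%:A, x ^+ 2 = gnu, x ^+ N = beta &
                   forall y : k, y ^+ 2 = gnu -> y ^+ N = beta -> y = x]) /\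
            arrow_ext_or_sym j],
      (* (B) *)
      ~~ odd N -> ~~ odd `|val_tau gamma|%N ->
      [/\ beta = gamma ^+ N./2 \/ beta = - gamma ^+ N./2,
          forall i : Q, L_eq_k i,
          single_cycle Q N,
          beta = gamma ^+ N./2 ->
            type_VV Q /\
            (forall i : Q, fixed_vertex i -> vertex_orth_or_sympl i) &
          beta = - gamma ^+ N./2 ->
            type_EE Q /\
            (forall i : Q, fixed_arrow i -> arrow_ext_or_sym i)] &
      (* (C) *)
      ~~ odd N -> odd `|val_tau gamma|%N ->
      [/\ (beta = gamma ^+ N./2 \/ beta = - gamma ^+ N./2) /\
          (forall i : Q, L_is_quadratic i) /\ single_cycle Q N./2,
          (* (C1) *)
          odd N./2 -> beta = gamma ^+ N./2 ->
          [/\ type_VE Q,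
              forall i : Q, fixed_vertex i ->
                [/\ b i ^+ 2 = gamma%:A, restr_id (qsc Q) i &
                    vertex_res_orth_or_sympl i] &
              forall j : Q, fixed_arrow j ->
                [/\ b j ^+ 2 = (- gnu)%:A, ~ restr_id (qscx Q) j &
                    arrow_herm j]],
          (* (C2) *)
          odd N./2 -> beta = - gamma ^+ N./2 ->
          [/\ type_VE Q,
              forall i : Q, fixed_vertex i ->
                [/\ b i ^+ 2 = (- gamma)%:A, ~ restr_id (qsc Q) i &
                    vertex_unitary i] &
              forall j : Q, fixed_arrow j ->
                [/\ b j ^+ 2 = gnu%:A, restr_id (qscx Q) j &
                    arrow_ext_or_sym j]],
          (* (C3) *)
          ~~ odd N./2 -> beta = gamma ^+ N./2 ->
          type_VV Q /\
          exists i i' : Q,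
            [/\ i != i', fixed_vertex i, fixed_vertex i',
                [/\ b i ^+ 2 = gamma%:A, restr_id (qsc Q) i &
                    vertex_res_orth_or_sympl i] &
                [/\ b i' ^+ 2 = (- gamma)%:A, ~ restr_id (qsc Q) i' &
                    vertex_unitary i']] &
          (* (C4) *)
          ~~ odd N./2 -> beta = - gamma ^+ N./2 ->
          type_EE Q /\
          exists i i' : Q,
            [/\ i != i', fixed_arrow i, fixed_arrow i',
                [/\ b i ^+ 2 = gnu%:A, restr_id (qscx Q) i &
                    arrow_ext_or_sym i] &
                [/\ b i' ^+ 2 = (- gnu)%:A, ~ restr_id (qscx Q) i' &
                    arrow_herm i']]]].
Proof.
move: T V V_fg P sigma_k xi xi_fixed nu nu_prim xi_norm gamma gammaE Q.
have E : ((R[i]%C : numClosedFieldType) : fieldType) = (R[i]%C : fieldType) by [].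
have H : main_statement ((R[i]%C : numClosedFieldType) : fieldType) := @main_statement_closed _.
by rewrite E in H; exact: H.
Qed.
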